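(* Let $\mathbb{M}=(M_p)_{p\in\mathbb{N}_0}$ be a weight sequence satisfying the derivation closedness condition (dc). (i) Let $\alpha>0$ be such that $\widetilde{\mathcal{B}}:\widetilde{\mathcal{A}}^u_{\mathbb{M}}(S_\alpha)\to\mathbb{C}[[z]]_{\mathbb{M}}$ is surjective. Then $\gamma(\mathbb{M})>\lfloor\alpha\rfloor$. (ii) If $\widetilde{S}^u_{\mathbb{M}}=(0,\infty)$, then $S_{\mathbb{M}}=\widetilde{S}^u_{\mathbb{M}}=\widetilde{S}_{\mathbb{M}}=(0,\infty)$ and $\gamma(\mathbb{M})=\infty$.
   Context: Sequences. $\mathbb{N}_0=\{0,1,2,\dots\}$. A weight sequence is a sequence $\mathbb{M}=(M_p)_{p\in\mathbb{N}_0}$ of positive reals with $M_0=1$, logarithmically convex ($M_p^2\le M_{p-1}M_{p+1}$ for $p\ge1$), whose sequence of quotients $m_p:=M_{p+1}/M_p$ tends to $\infty$. (dc): there is $D>0$ with $M_{p+1}\le D^{p+1}M_p$ for all $p\in\mathbb{N}_0$. For $\gamma\in\mathbb{R}$, $\mathbb{M}$ satisfies $(P_\gamma)$ if there are a real sequence $(m'_p)_{p\in\mathbb{N}_0}$ and $a\ge1$ with $a^{-1}m_p\le m'_p\le am_p$ for $p\ge 1$ and $((p+1)^{-\gamma}m'_p)_{p\in\mathbb{N}_0}$ increasing; $\gamma(\mathbb{M}):=\sup\{\gamma\in\mathbb{R}:(P_\gamma)\text{ holds}\}\in[0,\infty]$. (Equivalently, for a weight sequence, $\gamma(\mathbb{M})$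 is the supremum, $0$ if the set is empty, of the $\gamma>0$ for which there is $a>0$ with $m_p/(p+1)^\gamma\le a\,m_q/(q+1)^\gamma$ for all $q\ge p$.) Sectors. $\mathcal{R}$ is the Riemann surface of the logarithm. For $\gamma>0$, $S_\gamma=\{z\in\mathcal{R}:|\arg z|<\gamma\pi/2\}$ (unbounded). A bounded sector $T=\{z\in\mathcal{R}:|\arg z-d|<\alpha\pi/2,\ |z|<r\}$ is a proper subsector of $S_\gamma$, written $T\ll S_\gamma$, if its closure in $\mathcal{R}$ (so the vertex $0$ is not considered) is contained in $S_\gamma$. Classes, for $S=S_\gamma$. $\widetilde{\mathcal{A}}_{\mathbb{M}}(S)$: holomorphic $f:S\to\mathbb{C}$ for which there is a formal series $\widehat f=\sum_{p\ge0}a_pz^p$ such that for every $T\ll S$ there are $C_T,A_T>0$ with $|f(z)-\sum_{n=0}^{p-1}a_nz^n|\le C_TA_T^pM_p|z|^p$ for all $z\in T$, $p\in\mathbb{N}_0$. $\widetilde{\mathcal{A}}^u_{\mathbb{M}}(S)$: same, but with constants $C,A>0$ valid for all $z\in S$, $p\in\mathbb{N}_0$. $\mathcal{A}_{\mathbb{M}}(S)$: holomorphic $f$ on $S$ for which there is $A>0$ with $\sup_{z\in S,\,n\in\mathbb{N}_0}\frac{|f^{(n)}(z)|}{A^nn!M_n}<\infty$. One has $\mathcal{A}_{\mathbb{M}}(S)\subseteq\widetilde{\mathcal{A}}^u_{\mathbb{M}}(S)\subseteq\widetilde{\mathcal{A}}_{\mathbb{M}}(S)$, $\widehat f$ is unique,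 and $a_p=\lim_{z\to0,z\in T}f^{(p)}(z)/p!$ for any $T\ll S$. $\mathbb{C}[[z]]_{\mathbb{M}}$ is the set of $\sum a_pz^p\in\mathbb{C}[[z]]$ for which there is $A>0$ with $\sup_p|a_p|/(A^pM_p)<\infty$. The asymptotic Borel map $\widetilde{\mathcal{B}}$ sends $f$ to $\widehat f\in\mathbb{C}[[z]]_{\mathbb{M}}$. Intervals. $S_{\mathbb{M}}$, $\widetilde{S}^u_{\mathbb{M}}$, $\widetilde{S}_{\mathbb{M}}$ are the sets of $\gamma>0$ such that $\widetilde{\mathcal{B}}$ is surjective onto $\mathbb{C}[[z]]_{\mathbb{M}}$ on $\mathcal{A}_{\mathbb{M}}(S_\gamma)$, $\widetilde{\mathcal{A}}^u_{\mathbb{M}}(S_\gamma)$, $\widetilde{\mathcal{A}}_{\mathbb{M}}(S_\gamma)$, respectively. *)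

(* Defs.v *)
(* Stdlib reals and Coquelicot. *)
From Stdlib Require Import Reals Factorial.
From Coquelicot Require Import Coquelicot.

Open Scope R_scope.

(** * Weight sequences *)

Definition quot (M : nat -> R) (p : nat) : R := M (S p) / M p.

Definition weight_sequence (M : nat -> R) : Prop :=
  (forall p, 0 < M p) /\
  M 0%nat = 1 /\
  (forall p, M (S p) ^ 2 <= M p * M (S (S p))) /\
  is_lim_seq (quot M) p_infty.

Definition dc (M : nat -> R) : Prop :=
  exists D : R, 0 < D /\ forall p, M (S p) <= D ^ (S p) * M p.

(* "Increasing" means nondecreasing; requiring strict monotonicity instead
   would not change the supremum below. *)
Definition P_gamma (M : nat -> R) (gamma : R) : Prop :=
  exists (m' : nat -> R) (a : R),
    1 <= a /\
    (forall p, (1 <= p)%nat -> / a * quot M p <= m' p <= a * quot M p) /\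
    (forall p, Rpower (INR (S p)) (- gamma) * m' p
               <= Rpower (INR (S (S p))) (- gamma) * m' (S p)).

Definition gamma_index (M : nat -> R) : Rbar := Lub_Rbar (P_gamma M).

(** * The Riemann surface of the logarithm *)

(* A point is the pair (modulus, argument), the argument being an arbitrary
   real.  The surface is the open subset [on_surface] of R * R, with the induced
   topology; functions on it are total functions on R * R whose values outside
   of it are irrelevant. *)
Definition LogPoint : Type := (R * R)%type.

Definition modulus (z : LogPoint) : R := fst z.
Definition arg (z : LogPoint) : R := snd z.
Definition on_surface (z : LogPoint) : Prop := 0 < modulus z.

Definition proj (z : LogPoint) : C :=
  (modulus z * cos (arg z), modulus z * sin (arg z)).

(* The projection is the local coordinate; it is injective near every point of
   the surface, so the difference quotient is eventually meaningful. *)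
Definition is_log_derive (f : LogPoint -> C) (z : LogPoint) (l : C) : Prop :=
  filterlim (fun w : LogPoint => ((f w - f z) / (proj w - proj z))%C)
            (locally' (z : R * R)) (locally l).

Definition holomorphic (U : LogPoint -> Prop) (f : LogPoint -> C) : Prop :=
  forall z, U z -> exists l : C, is_log_derive f z l.

(* [g n] is the n-th derivative of [f] on the (open) set [U]. *)
Definition derivatives_on (U : LogPoint -> Prop) (f : LogPoint -> C)
    (g : nat -> LogPoint -> C) : Prop :=
  (forall z, U z -> g 0%nat z = f z) /\
  (forall n z, U z -> is_log_derive (g n) z (g (S n) z)).

Definition sector (gamma : R) (z : LogPoint) : Prop :=
  on_surface z /\ Rabs (arg z) < gamma * PI / 2.

Definition bounded_sector (d alpha r : R) (z : LogPoint) : Prop :=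
  on_surface z /\ Rabs (arg z - d) < alpha * PI / 2 /\ modulus z < r.

(* Closure within the surface, with the same formulation of adherent points as
   in Coquelicot's [closed]. *)
Definition log_closure (T : LogPoint -> Prop) (z : LogPoint) : Prop :=
  on_surface z /\ ~ locally (z : R * R) (fun w => ~ T w).

Definition proper_subsector (T : LogPoint -> Prop) (gamma : R) : Prop :=
  (exists d alpha r : R, 0 < alpha /\ 0 < r /\
     forall z, T z <-> bounded_sector d alpha r z) /\
  (forall z, log_closure T z -> sector gamma z).

(** * Ultraholomorphic classes *)

(* A formal power series is its sequence of coefficients.
   [partial_sum a p z] is the sum of the terms of index n < p. *)
Fixpoint partial_sum (a : nat -> C) (p : nat) (z : C) : C :=
  match p with
  | O => RtoC 0
  | S q => (partial_sum a q z + a q * Cpow z q)%C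
  end.

Definition expansion_bound (M : nat -> R) (T : LogPoint -> Prop)
    (f : LogPoint -> C) (a : nat -> C) : Prop :=
  exists K A : R, 0 < K /\ 0 < A /\
    forall z p, T z ->
      Cmod (f z - partial_sum a p (proj z))%C
        <= K * A ^ p * M p * modulus z ^ p.

Definition asymptotic_expansion (M : nat -> R) (gamma : R)
    (f : LogPoint -> C) (a : nat -> C) : Prop :=
  forall T, proper_subsector T gamma -> expansion_bound M T f a.

Definition At (M : nat -> R) (gamma : R) (f : LogPoint -> C) : Prop :=
  holomorphic (sector gamma) f /\
  exists a : nat -> C, asymptotic_expansion M gamma f a.

Definition Atu (M : nat -> R) (gamma : R) (f : LogPoint -> C) : Prop :=
  holomorphic (sector gamma) f /\
  exists a : nat -> C, expansion_bound M (sector gamma) f a.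

Definition A_class (M : nat -> R) (gamma : R) (f : LogPoint -> C) : Prop :=
  holomorphic (sector gamma) f /\
  exists g : nat -> LogPoint -> C,
    derivatives_on (sector gamma) f g /\
    exists A K : R, 0 < A /\
      forall z n, sector gamma z ->
        Cmod (g n z) / (A ^ n * INR (fact n) * M n) <= K.

Definition formal_class (M : nat -> R) (a : nat -> C) : Prop :=
  exists A K : R, 0 < A /\ forall p, Cmod (a p) / (A ^ p * M p) <= K.

(** * Surjectivity of the asymptotic Borel map *)

(* The Borel map is given by its graph [asymptotic_expansion M gamma]: all three
   classes are contained in [At M gamma] and expansions are unique there. *)
Definition Borel_surjective
    (cls : (nat -> R) -> R -> (LogPoint -> C) -> Prop)
    (M : nat -> R) (gamma : R) : Prop :=
  forall a : nat -> C, formal_class M a ->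
    exists f : LogPoint -> C, cls M gamma f /\ asymptotic_expansion M gamma f a.

Definition S_int (M : nat -> R) (gamma : R) : Prop :=
  0 < gamma /\ Borel_surjective A_class M gamma.

Definition Stu_int (M : nat -> R) (gamma : R) : Prop :=
  0 < gamma /\ Borel_surjective Atu M gamma.

Definition St_int (M : nat -> R) (gamma : R) : Prop :=
  0 < gamma /\ Borel_surjective At M gamma.

(* Main.v *)
Require Import Defs.
From Stdlib Require Import Reals Lra Lia Factorial.
From Stdlib Require Import Classical ClassicalChoice ClassicalEpsilon.
From Coquelicot Require Import Coquelicot.

Open Scope R_scope.

(**
In fact surjectivity on S_alpha forces gamma(M) > alpha.  A gliding hump argument on lacunary
sequences with entries 0 or M_p makes surjectivity uniform: there is one constant A such that
for all p and N some f has the expansion M_p z^p up to order N, with remainders bounded by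
A^(q+1) M_q |z|^q on all of S_alpha.  Put g = f / (M_p z^p) - 1 with p = 2k.  The remainder
estimates give |g| <= 2 A^(p+1) prod_(p <= q < r) (A m_q |z|) for every r in [p, N], whereas
|g| >= 1/2 at x0 = 2 A^2 / m_k.  With zeta = z^(1/alpha), consider the zero-free functions
E_q(z) = exp (phi (c_q zeta)), where phi(u) = 1/(1+u)^2 + 1/(2(1+u)) and c_q is proportional to
m_q^(1/alpha).  On the boundary of S_alpha they satisfy A m_q |z| |E_q| <= 1 near 0 and |E_q|
<= 1 far from 0, while log E_q(x) >= 1/(2 (1 + c_q x^(1/alpha))) for x > 0.  Hence g prod E_q
is bounded by a constant times A^(p+1) on the boundary, and a Phragmen-Lindelof bound at x0
yields sum_(q >= 2k) m_q^(-1/alpha) <= C k m_k^(-1/alpha) for all k >= 1.  The sums over dyadic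
blocks then decay geometrically, so m_q / m_p grows at least like a power of q/p with exponent
greater than alpha.

For (ii), a function of the uniform class on S_(gamma+1) lies in A_M(S_gamma): Cauchy estimates
for f minus its n-th partial sum, on a neighbourhood of z of size proportional to |z|, bound
f^(n)(z) by K A^n n! M_n.

In the coordinate w = log z sectors become strips, and holomorphy is complex differentiability
on C.
*)

(** * Complex derivatives and the exponential *)

(** Uniformity is decisive: with a constant depending on p, the factor A^(p+1) would not be
    exponential in k, and its logarithm would not give a bound linear in k. The choice p = 2k leaves
    k spare orders below p. There the expansion of f has no terms, so f is small at x0 compared with
    M_p x0^p, while x0 still has the size of 1/m_k.

    The two summands of phi have different duties. On the imaginary axis Re 1/(1+iy)^2 behaves like
    -1/y^2 and outweighs Re 1/(2(1+iy)), which is about 1/(2y^2); this controls the boundary far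
    out. On the positive axis the second summand decays only like 1/u, and this slow decay is what
    brings the powers m_q^(-1/alpha) into the final sum.

    As f is controlled only inside the open sector, the contour runs at a small angle from its
    boundary, an angle that shrinks with the number of factors E_q.

    Cauchy's theory is set up on rectangles, and the winding integral is never evaluated: the lower
    bound 2 for its modulus suffices, both for the derivative estimates and for the
    Phragmen-Lindelof bound. *)

Definition cderiv (F : C -> C) (w l : C) : Prop :=
  forall eps, 0 < eps -> exists del, 0 < del /\
    forall v, Cmod (v - w) < del ->
      Cmod (F v - F w - l * (v - w)) <= eps * Cmod (v - w).

Lemma Cmod_triang3 (x y z : C) : Cmod (x + y + z) <= Cmod x + Cmod y + Cmod z.
Proof.
  eapply Rle_trans; [apply Cmod_triangle|].
  apply Rplus_le_compat_r, Cmod_triangle.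
Qed.

Lemma Cmod_minus_comm (x y : C) : Cmod (x - y) = Cmod (y - x).
Proof. rewrite <- Cmod_opp. f_equal. ring. Qed.

Lemma Cmod_minus_triangle (x y : C) : Cmod (x - y) <= Cmod x + Cmod y.
Proof.
  unfold Cminus. eapply Rle_trans; [apply Cmod_triangle|]. rewrite Cmod_opp. lra.
Qed.

Lemma Cmod_triangle_rev (x y : C) : Cmod x - Cmod y <= Cmod (x + y).
Proof.
  replace x with ((x + y) + - y)%C at 1 by ring.
  assert (H := Cmod_triangle (x + y) (- y)). rewrite Cmod_opp in H. lra.
Qed.

Lemma cderiv_lipschitz F w l : cderiv F w l ->
  exists del, 0 < del /\
    forall v, Cmod (v - w) < del -> Cmod (F v - F w) <= (Cmod l + 1) * Cmod (v - w).
Proof.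
  intros H. destruct (H 1 Rlt_0_1) as [d [Hd Hv]]. exists d. split; auto.
  intros v Hvd. specialize (Hv v Hvd).
  replace (F v - F w)%C with ((F v - F w - l * (v - w)) + l * (v - w))%C by ring.
  eapply Rle_trans; [apply Cmod_triangle|]. rewrite Cmod_mult. lra.
Qed.

Lemma cderiv_continuous F w l : cderiv F w l -> continuous (F : C_UniformSpace -> C_UniformSpace) w.
Proof.
  intros H. destruct (cderiv_lipschitz _ _ _ H) as [d [Hd Hv]].
  intros P [eps HP].
  set (K := Cmod l + 1). assert (HK : 0 < K) by (unfold K; generalize (Cmod_ge_0 l); lra).
  assert (H2 : 0 < sqrt 2) by (apply sqrt_lt_R0; lra).
  assert (Hm : 0 < Rmin d (eps / K) / sqrt 2).
  { apply Rdiv_lt_0_compat; auto. apply Rmin_pos; auto. apply Rdiv_lt_0_compat; auto. apply cond_pos. }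
  exists (mkposreal _ Hm). intros v Hvb. apply HP.
  assert (Hb := C_NormedModule_mixin_compat2 _ _ _ Hvb).
  simpl in Hb. replace (sqrt 2 * (Rmin d (eps / K) / sqrt 2)) with (Rmin d (eps / K)) in Hb by (field; lra).
  change (minus v w) with (v - w)%C in Hb.
  assert (Hb1 : Cmod (v - w) < d) by (eapply Rlt_le_trans; [apply Hb|apply Rmin_l]).
  assert (Hb2 : Cmod (v - w) < eps / K) by (eapply Rlt_le_trans; [apply Hb|apply Rmin_r]).
  apply (C_NormedModule_mixin_compat1 (F w) (F v)).
  change (Cmod (F v - F w) < eps). specialize (Hv v Hb1). fold K in Hv.
  eapply Rle_lt_trans; [apply Hv|].
  apply (Rmult_lt_compat_l K) in Hb2; auto. replace (K * (eps / K)) with (pos eps) in Hb2 by (field; lra). lra.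
Qed.

Lemma cderiv_ext_loc F G w l r : 0 < r ->
  (forall v, Cmod (v - w) < r -> F v = G v) -> cderiv F w l -> cderiv G w l.
Proof.
  intros Hr HE HF eps He. destruct (HF eps He) as [d [Hd Hv]].
  exists (Rmin d r). split; [apply Rmin_pos; auto|]. intros v Hvd.
  rewrite <- (HE v), <- (HE w).
  - apply Hv. eapply Rlt_le_trans; [apply Hvd|apply Rmin_l].
  - replace (w - w)%C with (RtoC 0) by ring. now rewrite Cmod_0.
  - eapply Rlt_le_trans; [apply Hvd|apply Rmin_r].
Qed.

Lemma cderiv_ext F G w l : (forall v, F v = G v) -> cderiv F w l -> cderiv G w l.
Proof. intros H. apply (cderiv_ext_loc _ _ _ _ 1); auto with real. Qed.

Lemma cderiv_eq F w l l' : l = l' -> cderiv F w l -> cderiv F w l'.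
Proof. now intros ->. Qed.

Lemma cderiv_const c w : cderiv (fun _ => c) w 0.
Proof.
  intros eps He. exists 1. split; [lra|]. intros v _.
  replace (c - c - 0 * (v - w))%C with (RtoC 0) by ring. rewrite Cmod_0.
  apply Rmult_le_pos; [lra|apply Cmod_ge_0].
Qed.

Lemma cderiv_id w : cderiv (fun v => v) w 1.
Proof.
  intros eps He. exists 1. split; [lra|]. intros v _.
  replace (v - w - 1 * (v - w))%C with (RtoC 0) by ring. rewrite Cmod_0.
  apply Rmult_le_pos; [lra|apply Cmod_ge_0].
Qed.

Lemma cderiv_plus F G w l m : cderiv F w l -> cderiv G w m ->
  cderiv (fun v => F v + G v)%C w (l + m)%C.
Proof.
  intros HF HG eps He.
  destruct (HF (eps / 2)) as [d [Hd Hv]]; [lra|]. destruct (HG (eps / 2)) as [d' [Hd' Hv']]; [lra|].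
  exists (Rmin d d'). split; [apply Rmin_pos; auto|]. intros v Hvd.
  assert (H1 := Hv v (Rlt_le_trans _ _ _ Hvd (Rmin_l _ _))).
  assert (H2 := Hv' v (Rlt_le_trans _ _ _ Hvd (Rmin_r _ _))).
  replace (F v + G v - (F w + G w) - (l + m) * (v - w))%C
    with ((F v - F w - l * (v - w)) + (G v - G w - m * (v - w)))%C by ring.
  eapply Rle_trans; [apply Cmod_triangle|]. lra.
Qed.

Lemma cderiv_mult F G w l m : cderiv F w l -> cderiv G w m ->
  cderiv (fun v => F v * G v)%C w (l * G w + F w * m)%C.
Proof.
  intros HF HG eps He.
  destruct (cderiv_lipschitz _ _ _ HF) as [d1 [Hd1 HL1]].
  destruct (cderiv_lipschitz _ _ _ HG) as [d2 [Hd2 HL2]].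
  set (g := Cmod (G w)). set (f := Cmod (F w)). set (K := (Cmod l + 1) * (Cmod m + 1)).
  assert (Hg : 0 <= g) by apply Cmod_ge_0. assert (Hf : 0 <= f) by apply Cmod_ge_0.
  assert (HK : 0 < K) by (apply Rmult_lt_0_compat; generalize (Cmod_ge_0 l), (Cmod_ge_0 m); lra).
  destruct (HF (eps / 3 / (g + 1))) as [d3 [Hd3 H3]]; [repeat apply Rdiv_lt_0_compat; lra|].
  destruct (HG (eps / 3 / (f + 1))) as [d4 [Hd4 H4]]; [repeat apply Rdiv_lt_0_compat; lra|].
  set (D := eps / 3 / K). assert (HD : 0 < D) by (unfold D; repeat apply Rdiv_lt_0_compat; lra).
  exists (Rmin (Rmin (Rmin d1 d2) (Rmin d3 d4)) D). split; [repeat apply Rmin_pos; auto|].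
  intros v Hvd.
  assert (A1 := Rlt_le_trans _ _ _ Hvd (Rmin_l _ _)). assert (B5 := Rlt_le_trans _ _ _ Hvd (Rmin_r _ _)).
  assert (A2 := Rlt_le_trans _ _ _ A1 (Rmin_l _ _)). assert (A3 := Rlt_le_trans _ _ _ A1 (Rmin_r _ _)).
  assert (B1 := Rlt_le_trans _ _ _ A2 (Rmin_l _ _)). assert (B2 := Rlt_le_trans _ _ _ A2 (Rmin_r _ _)).
  assert (B3 := Rlt_le_trans _ _ _ A3 (Rmin_l _ _)). assert (B4 := Rlt_le_trans _ _ _ A3 (Rmin_r _ _)).
  specialize (HL1 v B1). specialize (HL2 v B2). specialize (H3 v B3). specialize (H4 v B4).
  replace (F v * G v - F w * G w - (l * G w + F w * m) * (v - w))%C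
    with ((F v - F w - l * (v - w)) * G w + F w * (G v - G w - m * (v - w))
          + (F v - F w) * (G v - G w))%C by ring.
  eapply Rle_trans; [apply Cmod_triang3|]. rewrite !Cmod_mult. fold g f.
  set (x := Cmod (v - w)) in *. assert (Hx : 0 <= x) by apply Cmod_ge_0.
  assert (E1 : Cmod (F v - F w - l * (v - w)) * g <= eps / 3 * x).
  { eapply Rle_trans; [apply Rmult_le_compat_r; [auto|apply H3]|].
    replace (eps / 3 / (g + 1) * x * g) with (eps / 3 * x * (g / (g + 1))) by (field; lra).
    rewrite <- (Rmult_1_r (eps / 3 * x)) at 2. apply Rmult_le_compat_l; [apply Rmult_le_pos; lra|].
    apply Rle_div_l; lra. }
  assert (E2 : f * Cmod (G v - G w - m * (v - w)) <= eps / 3 * x).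
  { eapply Rle_trans; [apply Rmult_le_compat_l; [auto|apply H4]|].
    replace (f * (eps / 3 / (f + 1) * x)) with (eps / 3 * x * (f / (f + 1))) by (field; lra).
    rewrite <- (Rmult_1_r (eps / 3 * x)) at 2. apply Rmult_le_compat_l; [apply Rmult_le_pos; lra|].
    apply Rle_div_l; lra. }
  assert (E3 : Cmod (F v - F w) * Cmod (G v - G w) <= eps / 3 * x).
  { eapply Rle_trans; [apply Rmult_le_compat; [apply Cmod_ge_0|apply Cmod_ge_0|apply HL1|apply HL2]|].
    replace ((Cmod l + 1) * x * ((Cmod m + 1) * x)) with (K * x * x) by (unfold K; ring).
    apply Rmult_le_compat_r; auto. replace (eps / 3) with (K * D) by (unfold D; field; lra).
    apply Rmult_le_compat_l; lra. }
  lra.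
Qed.

Lemma cderiv_scal c F w l : cderiv F w l -> cderiv (fun v => c * F v)%C w (c * l)%C.
Proof.
  intros H. eapply cderiv_eq; [|apply cderiv_mult; [apply cderiv_const|apply H]]. cbv beta. ring.
Qed.

Lemma cderiv_opp F w l : cderiv F w l -> cderiv (fun v => - F v)%C w (- l)%C.
Proof.
  intros H. apply (cderiv_ext (fun v => -(1) * F v)%C). { intros; ring. }
  eapply cderiv_eq; [|apply cderiv_scal, H]. ring.
Qed.

Lemma cderiv_minus F G w l m : cderiv F w l -> cderiv G w m ->
  cderiv (fun v => F v - G v)%C w (l - m)%C.
Proof. intros. apply cderiv_plus; auto. now apply cderiv_opp. Qed.

Lemma cderiv_comp F G w l m : cderiv F (G w) l -> cderiv G w m ->
  cderiv (fun v => F (G v)) w (l * m)%C.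
Proof.
  intros HF HG eps He.
  destruct (cderiv_lipschitz _ _ _ HG) as [d2 [Hd2 HL2]].
  set (K := Cmod m + 1). set (f := Cmod l).
  assert (HK : 0 < K) by (unfold K; generalize (Cmod_ge_0 m); lra).
  assert (Hf : 0 <= f) by apply Cmod_ge_0.
  destruct (HF (eps / 2 / K)) as [d3 [Hd3 H3]]; [repeat apply Rdiv_lt_0_compat; lra|].
  destruct (HG (eps / 2 / (f + 1))) as [d4 [Hd4 H4]]; [repeat apply Rdiv_lt_0_compat; lra|].
  assert (Hd5 : 0 < d3 / K) by (apply Rdiv_lt_0_compat; lra).
  exists (Rmin (Rmin d2 d4) (d3 / K)). split; [repeat apply Rmin_pos; auto|].
  intros v Hvd.
  assert (A1 := Rlt_le_trans _ _ _ Hvd (Rmin_l _ _)). assert (B5 := Rlt_le_trans _ _ _ Hvd (Rmin_r _ _)).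
  assert (B1 := Rlt_le_trans _ _ _ A1 (Rmin_l _ _)). assert (B2 := Rlt_le_trans _ _ _ A1 (Rmin_r _ _)).
  specialize (HL2 v B1). specialize (H4 v B2). fold K in HL2.
  assert (B6 : Cmod (G v - G w) < d3).
  { eapply Rle_lt_trans; [apply HL2|]. apply (Rmult_lt_compat_l K) in B5; auto.
    replace (K * (d3 / K)) with d3 in B5 by (field; lra). lra. }
  specialize (H3 _ B6).
  set (x := Cmod (v - w)) in *. assert (Hx : 0 <= x) by apply Cmod_ge_0.
  replace (F (G v) - F (G w) - l * m * (v - w))%C
    with ((F (G v) - F (G w) - l * (G v - G w)) + l * (G v - G w - m * (v - w)))%C by ring.
  eapply Rle_trans; [apply Cmod_triangle|]. rewrite Cmod_mult. fold f.
  assert (E1 : Cmod (F (G v) - F (G w) - l * (G v - G w)) <= eps / 2 * x).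
  { eapply Rle_trans; [apply H3|]. replace (eps / 2 * x) with (eps / 2 / K * (K * x)) by (field; lra).
    apply Rmult_le_compat_l; auto. left. repeat apply Rdiv_lt_0_compat; lra. }
  assert (E2 : f * Cmod (G v - G w - m * (v - w)) <= eps / 2 * x).
  { eapply Rle_trans; [apply Rmult_le_compat_l; [auto|apply H4]|].
    replace (f * (eps / 2 / (f + 1) * x)) with (eps / 2 * x * (f / (f + 1))) by (field; lra).
    rewrite <- (Rmult_1_r (eps / 2 * x)) at 2. apply Rmult_le_compat_l; [apply Rmult_le_pos; lra|].
    apply Rle_div_l; lra. }
  lra.
Qed.

Lemma cderiv_inv w : w <> RtoC 0 -> cderiv Cinv w (- / (w * w))%C.
Proof.
  intros Hw eps He. assert (Hm : 0 < Cmod w) by now apply Cmod_gt_0.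
  set (c := Cmod w) in *.
  assert (Hd : 0 < eps * c * c * c / 2).
  { apply Rdiv_lt_0_compat; [|lra]. repeat apply Rmult_lt_0_compat; lra. }
  (* The remainder of the inverse is exactly (v-w)^2/(v w^2). The first radius keeps |v| above c/2,
     and the second then absorbs the denominator. *)
  exists (Rmin (c / 2) (eps * c * c * c / 2)). split; [apply Rmin_pos; lra|].
  intros v Hv.
  assert (B1 := Rlt_le_trans _ _ _ Hv (Rmin_l _ _)). assert (B2 := Rlt_le_trans _ _ _ Hv (Rmin_r _ _)).
  assert (Hv2 : c / 2 < Cmod v).
  { assert (T := Cmod_triangle_rev w (v - w)). replace (w + (v - w))%C with v in T by ring. fold c in T. lra. }
  assert (Hv0 : v <> RtoC 0) by (apply Cmod_gt_0; lra).
  replace (/ v - / w - - / (w * w) * (v - w))%C with ((v - w) * (v - w) / (v * (w * w)))%C by (field; auto).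
  rewrite Cmod_div, !Cmod_mult by (repeat apply Cmult_neq_0; auto). fold c.
  set (x := Cmod (v - w)) in *. assert (Hx : 0 <= x) by apply Cmod_ge_0.
  assert (Hden : 0 < Cmod v * (c * c)) by (repeat apply Rmult_lt_0_compat; lra).
  apply Rle_div_l; auto.
  assert (x * x <= x * (eps * (c / 2 * (c * c)))).
  { apply Rmult_le_compat_l; auto. lra. }
  assert (eps * x * (c / 2 * (c * c)) <= eps * x * (Cmod v * (c * c))).
  { apply Rmult_le_compat_l; [apply Rmult_le_pos; lra|]. apply Rmult_le_compat_r; [|lra].
    apply Rmult_le_pos; lra. }
  lra.
Qed.

Lemma cderiv_Cinv F w l : F w <> RtoC 0 -> cderiv F w l ->
  cderiv (fun v => / F v)%C w (- / (F w * F w) * l)%C.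
Proof. intros H HF. apply (cderiv_comp Cinv F); auto. now apply cderiv_inv. Qed.

Lemma cderiv_div F G w l m : G w <> RtoC 0 -> cderiv F w l -> cderiv G w m ->
  cderiv (fun v => F v / G v)%C w ((l * G w - F w * m) / (G w * G w))%C.
Proof.
  intros H HF HG. eapply cderiv_eq; [|apply (cderiv_mult F (fun v => / G v)%C); [apply HF|apply cderiv_Cinv; [auto|apply HG]]].
  cbv beta. field; auto.
Qed.

Lemma cderiv_pow F w l n : cderiv F w l ->
  cderiv (fun v => F v ^ S n)%C w (INR (S n) * F w ^ n * l)%C.
Proof.
  intros H. induction n as [|n IH].
  - apply (cderiv_ext F). { intros; simpl; ring. } eapply cderiv_eq; [|apply H]. simpl; ring.
  - apply (cderiv_ext (fun v => F v * F v ^ S n)%C). { intros; simpl; ring. }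
    eapply cderiv_eq; [|apply cderiv_mult; [apply H|apply IH]].
    rewrite (S_INR (S n)), RtoC_plus. cbn [Cpow]. ring.
Qed.

Lemma cderiv_unique F w l m : cderiv F w l -> cderiv F w m -> l = m.
Proof.
  intros HF HG. apply Ceq_minus. apply Cmod_eq_0.
  destruct (Req_dec (Cmod (l - m)) 0) as [E|E]; auto. exfalso.
  assert (Hp : 0 < Cmod (l - m)) by (generalize (Cmod_ge_0 (l - m)); lra).
  destruct (HF (Cmod (l - m) / 4)) as [d [Hd Hv]]; [lra|].
  destruct (HG (Cmod (l - m) / 4)) as [d' [Hd' Hv']]; [lra|].
  set (t := Rmin d d' / 2). assert (Ht : 0 < Rmin d d') by (apply Rmin_pos; auto).
  assert (Et : Cmod (w + RtoC t - w) = t).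
  { replace (w + RtoC t - w)%C with (RtoC t) by ring. rewrite Cmod_R. apply Rabs_pos_eq. unfold t; lra. }
  specialize (Hv (w + RtoC t)%C). specialize (Hv' (w + RtoC t)%C). rewrite Et in *.
  assert (H1 := Hv ltac:(generalize (Rmin_l d d'); unfold t; lra)).
  assert (H2 := Hv' ltac:(generalize (Rmin_r d d'); unfold t; lra)).
  assert (H3 := Cmod_minus_triangle (F (w + RtoC t) - F w - m * (w + RtoC t - w))%C (F (w + RtoC t) - F w - l * (w + RtoC t - w))%C).
  replace (F (w + RtoC t) - F w - m * (w + RtoC t - w) - (F (w + RtoC t) - F w - l * (w + RtoC t - w)))%C
   with ((l - m) * (w + RtoC t - w))%C in H3 by ring.
  rewrite Cmod_mult, Et in H3. assert (0 < Cmod (l - m) * t) by (apply Rmult_lt_0_compat; unfold t; lra). lra.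
Qed.

Definition cexp (w : C) : C := (exp (Re w) * cos (Im w), exp (Re w) * sin (Im w)).

Lemma cexp_plus v w : cexp (v + w) = (cexp v * cexp w)%C.
Proof.
  destruct v as [a b], w as [c d]. unfold cexp, Cmult; simpl.
  rewrite exp_plus, cos_plus, sin_plus. f_equal; ring.
Qed.

Lemma cexp_0 : cexp 0 = 1.
Proof. unfold cexp; simpl. rewrite exp_0, cos_0, sin_0. unfold RtoC. f_equal; ring. Qed.

Lemma Cmod_cexp w : Cmod (cexp w) = exp (Re w).
Proof.
  unfold cexp, Cmod; simpl. 
  replace (_ + _) with (Rsqr (exp (Re w)) * (Rsqr (sin (Im w)) + Rsqr (cos (Im w)))) by (unfold Rsqr; ring).
  rewrite sin2_cos2, Rmult_1_r. apply sqrt_Rsqr. left; apply exp_pos.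
Qed.

Lemma cexp_neq_0 w : cexp w <> RtoC 0.
Proof. apply Cmod_gt_0. rewrite Cmod_cexp. apply exp_pos. Qed.

Lemma Cmod_le_abs (a b : R) : Cmod (a, b) <= Rabs a + Rabs b.
Proof.
  replace ((a, b) : C) with (RtoC a + Ci * RtoC b)%C.
  - eapply Rle_trans; [apply Cmod_triangle|]. rewrite Cmod_mult, Cmod_Ci, !Cmod_R. lra.
  - unfold Ci, RtoC, Cplus, Cmult; simpl. f_equal; ring.
Qed.

Lemma derivable_pt_lim_0_linear (f : R -> R) l : derivable_pt_lim f 0 l ->
  forall eps, 0 < eps -> exists del, 0 < del /\
   forall h, Rabs h < del -> Rabs (f h - f 0 - l * h) <= eps * Rabs h.
Proof.
  intros H eps He. destruct (H eps He) as [d Hd]. exists d. split; [apply cond_pos|].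
  intros h Hh. destruct (Req_dec h 0) as [->|Hn].
  - replace (f 0 - f 0 - l * 0) with 0 by ring. rewrite Rabs_R0. lra.
  - specialize (Hd h Hn Hh). rewrite Rplus_0_l in Hd.
    replace (f h - f 0 - l * h) with (((f h - f 0) / h - l) * h) by (field; auto).
    rewrite Rabs_mult. apply Rmult_le_compat_r; [apply Rabs_pos|lra].
Qed.

(** Reduces to the real derivatives of [exp], [cos] and [sin] at 0; the functional equation
    [cexp_plus] carries the result to every other point. *)
Lemma cderiv_cexp_0 : cderiv cexp 0 1.
Proof.
  (* The two coordinates of the remainder will be at most 3 e x and 5 e x, whence the divisor 8; the
     cap 1 keeps e x below x. *)
  intros eps He. set (e := Rmin (eps / 8) 1).
  assert (He' : 0 < e) by (apply Rmin_pos; lra).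
  assert (Hee : e <= eps / 8) by apply Rmin_l. assert (He1 : e <= 1) by apply Rmin_r.
  destruct (derivable_pt_lim_0_linear _ _ (derivable_pt_lim_exp 0) e He') as [d1 [Hd1 H1]].
  destruct (derivable_pt_lim_0_linear _ _ (derivable_pt_lim_cos 0) e He') as [d2 [Hd2 H2]].
  destruct (derivable_pt_lim_0_linear _ _ (derivable_pt_lim_sin 0) e He') as [d3 [Hd3 H3]].
  exists (Rmin (Rmin d1 d2) (Rmin d3 e)). split; [repeat apply Rmin_pos; lra|].
  intros [a b]. replace ((a, b) - 0)%C with ((a, b) : C) by (unfold Cminus, Cplus, Copp; simpl; f_equal; ring).
  intros Hv. rewrite exp_0, sin_0, cos_0 in *.
  assert (A1 := Rlt_le_trans _ _ _ Hv (Rmin_l _ _)). assert (A2 := Rlt_le_trans _ _ _ Hv (Rmin_r _ _)).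
  assert (B1 := Rlt_le_trans _ _ _ A1 (Rmin_l _ _)). assert (B2 := Rlt_le_trans _ _ _ A1 (Rmin_r _ _)).
  assert (B3 := Rlt_le_trans _ _ _ A2 (Rmin_l _ _)). assert (B4 := Rlt_le_trans _ _ _ A2 (Rmin_r _ _)).
  assert (Hab := Rmax_Cmod (a, b)). simpl in Hab.
  set (x := Cmod (a, b)) in *.
  assert (Ha : Rabs a <= x) by (eapply Rle_trans; [apply Rmax_l|apply Hab]).
  assert (Hb : Rabs b <= x) by (eapply Rle_trans; [apply Rmax_r|apply Hab]).
  specialize (H1 a ltac:(lra)). specialize (H2 b ltac:(lra)). specialize (H3 b ltac:(lra)).
  rewrite cexp_0. unfold cexp; simpl.
  match goal with |- Cmod ?y <= _ => replace y with
    (((exp a - 1 - 1 * a) * cos b + (1 + a) * (cos b - 1 - - 0 * b),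
      (exp a - 1) * sin b + (sin b - 0 - 1 * b)) : C)
    by (unfold Cminus, Cplus, Copp, Cmult, RtoC; simpl; f_equal; ring) end.
  eapply Rle_trans; [apply Cmod_le_abs|].
  assert (Hc : Rabs (cos b) <= 1) by (apply Rabs_le; apply COS_bound).
  assert (Hx : 0 <= x) by apply Cmod_ge_0.
  assert (Pa := Rabs_pos a). assert (Pb := Rabs_pos b).
  assert (Ea : Rabs (exp a - 1) <= 2 * x).
  { replace (exp a - 1) with ((exp a - 1 - 1 * a) + a) by ring. eapply Rle_trans; [apply Rabs_triang|].
    assert (e * Rabs a <= 1 * x) by (apply Rmult_le_compat; lra). lra. }
  assert (Es : Rabs (sin b) <= 2 * x).
  { replace (sin b) with ((sin b - 0 - 1 * b) + b) by ring. eapply Rle_trans; [apply Rabs_triang|].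
    assert (e * Rabs b <= 1 * x) by (apply Rmult_le_compat; lra). lra. }
  assert (T1 : Rabs ((exp a - 1 - 1 * a) * cos b + (1 + a) * (cos b - 1 - -0 * b)) <= 3 * e * x).
  { eapply Rle_trans; [apply Rabs_triang|]. rewrite !Rabs_mult.
    assert (Rabs (exp a - 1 - 1 * a) * Rabs (cos b) <= (e * x) * 1).
    { apply Rmult_le_compat; try apply Rabs_pos; auto. eapply Rle_trans; [apply H1|]. apply Rmult_le_compat_l; lra. }
    assert (Rabs (1 + a) * Rabs (cos b - 1 - - 0 * b) <= 2 * (e * x)).
    { apply Rmult_le_compat; try apply Rabs_pos. 
      - eapply Rle_trans; [apply Rabs_triang|]. rewrite Rabs_R1. lra.
      - eapply Rle_trans; [apply H2|]. apply Rmult_le_compat_l; lra. }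
    lra. }
  assert (T2 : Rabs ((exp a - 1) * sin b + (sin b - 0 - 1 * b)) <= 5 * e * x).
  { eapply Rle_trans; [apply Rabs_triang|]. rewrite Rabs_mult.
    assert (Rabs (exp a - 1) * Rabs (sin b) <= (2 * x) * (2 * x)) by (apply Rmult_le_compat; try apply Rabs_pos; lra).
    assert (x * x <= e * x) by (apply Rmult_le_compat_r; lra).
    assert (e * Rabs b <= e * x) by (apply Rmult_le_compat_l; lra). lra. }
  assert (8 * e * x <= eps * x) by (apply Rmult_le_compat_r; lra). lra.
Qed.

Lemma cderiv_cexp w : cderiv cexp w (cexp w).
Proof.
  apply (cderiv_ext (fun v => cexp w * cexp (v - w))%C).
  { intros v. rewrite <- cexp_plus. f_equal. ring. }
  eapply cderiv_eq; [|apply cderiv_scal, (cderiv_comp cexp (fun v => v - w)%C)].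
  2:{ replace (w - w)%C with (RtoC 0) by ring. apply cderiv_cexp_0. }
  2:{ apply cderiv_minus; [apply cderiv_id|apply cderiv_const]. }
  ring.
Qed.

Lemma cderiv_Cexp F w l : cderiv F w l -> cderiv (fun v => cexp (F v)) w (cexp (F w) * l)%C.
Proof. intros H. apply (cderiv_comp cexp F); auto. apply cderiv_cexp. Qed.

(** * Integrals over rectangles and Goursat's theorem *)

Definition C_RInt (f : R -> C) (a b : R) : C :=
  (RInt (fun x => Re (f x)) a b, RInt (fun x => Im (f x)) a b).

Definition ex_C_RInt (f : R -> C) (a b : R) : Prop :=
  ex_RInt (fun x => Re (f x)) a b /\ ex_RInt (fun x => Im (f x)) a b.

Lemma ex_C_RInt_continuous (f : R -> C) a b : a <= b ->
  (forall x, a <= x <= b -> continuous (f : R_UniformSpace -> C_UniformSpace) x) -> ex_C_RInt f a b.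
Proof.
  intros Hab H. split; apply (ex_RInt_continuous (V := R_CompleteNormedModule));
    rewrite Rmin_left, Rmax_right by auto; intros z Hz.
  - apply (continuous_comp (U := R_UniformSpace) (V := C_UniformSpace) f (fun z => fst z)); [now apply H|apply (continuous_fst (U := R_UniformSpace) (V := R_UniformSpace))].
  - apply (continuous_comp (U := R_UniformSpace) (V := C_UniformSpace) f (fun z => snd z)); [now apply H|apply (continuous_snd (U := R_UniformSpace) (V := R_UniformSpace))].
Qed.

Lemma ex_C_RInt_scal c f a b : ex_C_RInt f a b -> ex_C_RInt (fun x => c * f x)%C a b.
Proof.
  intros [A1 A2]. split; simpl.
  - apply (ex_RInt_minus (V := R_NormedModule) (fun x => fst c * fst (f x)) (fun x => snd c * snd (f x)));
      apply (ex_RInt_scal (V := R_NormedModule)); auto.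
  - apply (ex_RInt_plus (V := R_NormedModule) (fun x => fst c * snd (f x)) (fun x => snd c * fst (f x)));
      apply (ex_RInt_scal (V := R_NormedModule)); auto.
Qed.

Lemma C_RInt_ext f g a b : a <= b -> (forall x, a <= x <= b -> f x = g x) -> C_RInt f a b = C_RInt g a b.
Proof.
  intros Hab H. unfold C_RInt. f_equal; apply RInt_ext;
   rewrite Rmin_left, Rmax_right by auto; intros x Hx; rewrite H; auto; lra.
Qed.

Lemma C_RInt_minus f g a b : ex_C_RInt f a b -> ex_C_RInt g a b ->
  C_RInt (fun x => f x - g x)%C a b = (C_RInt f a b - C_RInt g a b)%C.
Proof.
  intros [A1 A2] [B1 B2]. unfold C_RInt, Cminus, Cplus, Copp; simpl. f_equal.
  - apply (RInt_minus (V := R_CompleteNormedModule) (fun x => Re (f x)) (fun x => Re (g x))); auto.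
  - apply (RInt_minus (V := R_CompleteNormedModule) (fun x => Im (f x)) (fun x => Im (g x))); auto.
Qed.

Lemma C_RInt_scal c f a b : ex_C_RInt f a b -> C_RInt (fun x => c * f x)%C a b = (c * C_RInt f a b)%C.
Proof.
  intros [A1 A2]. unfold C_RInt, Cmult; simpl. f_equal.
  - assert (E := RInt_minus (V := R_CompleteNormedModule) (fun x => fst c * fst (f x)) (fun x => snd c * snd (f x)) a b).
    unfold minus, plus, opp in E; simpl in E. unfold Rminus.
    rewrite E by (apply (ex_RInt_scal (V := R_NormedModule)); auto). 
    f_equal; [|f_equal]; apply (RInt_scal (V := R_CompleteNormedModule)); auto.
  - assert (E := RInt_plus (V := R_CompleteNormedModule) (fun x => fst c * snd (f x)) (fun x => snd c * fst (f x)) a b).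
    unfold plus in E; simpl in E. 
    rewrite E by (apply (ex_RInt_scal (V := R_NormedModule)); auto). 
    f_equal; apply (RInt_scal (V := R_CompleteNormedModule)); auto.
Qed.

Lemma C_RInt_const c a b : C_RInt (fun _ => c) a b = (RtoC (b - a) * c)%C.
Proof.
  unfold C_RInt. rewrite !RInt_const. unfold scal; simpl; unfold mult; simpl.
  unfold Cmult, RtoC; simpl. f_equal; unfold Re, Im; ring.
Qed.

Lemma ex_C_RInt_sub f a b c d : a <= c -> c <= d -> d <= b -> ex_C_RInt f a b -> ex_C_RInt f c d.
Proof.
  intros H1 H2 H3 [A1 A2]. split.
  - apply (ex_RInt_Chasles_1 (V := R_CompleteNormedModule) _ c d b); [lra|].
    apply (ex_RInt_Chasles_2 (V := R_CompleteNormedModule) _ a c b); [lra|auto].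
  - apply (ex_RInt_Chasles_1 (V := R_CompleteNormedModule) _ c d b); [lra|].
    apply (ex_RInt_Chasles_2 (V := R_CompleteNormedModule) _ a c b); [lra|auto].
Qed.

Lemma C_RInt_Chasles f a e b : a <= e <= b -> ex_C_RInt f a b -> C_RInt f a b = (C_RInt f a e + C_RInt f e b)%C.
Proof.
  intros He H. destruct (ex_C_RInt_sub f a b a e) as [A1 A2]; try lra; auto.
  destruct (ex_C_RInt_sub f a b e b) as [B1 B2]; try lra; auto.
  unfold C_RInt, Cplus; simpl. f_equal; symmetry.
  - apply (RInt_Chasles (V := R_CompleteNormedModule) (fun x => Re (f x))); auto.
  - apply (RInt_Chasles (V := R_CompleteNormedModule) (fun x => Im (f x))); auto.
Qed.

(* Multiplying [f] by the conjugate of the integral reduces the estimate to a real integral. *)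
Lemma C_RInt_bound f g a b : a <= b -> ex_C_RInt f a b -> ex_RInt g a b ->
  (forall x, a <= x <= b -> Cmod (f x) <= g x) -> Cmod (C_RInt f a b) <= RInt g a b.
Proof.
  intros Hab Hf Hg H. set (I := C_RInt f a b).
  assert (Hg0 : 0 <= RInt g a b).
  { apply RInt_ge_0; auto. intros x Hx. eapply Rle_trans; [apply Cmod_ge_0|apply H; lra]. }
  destruct (Req_dec (Cmod I) 0) as [E|E]; [rewrite E; auto|].
  assert (HI : 0 < Cmod I) by (generalize (Cmod_ge_0 I); lra).
  assert (E1 : Re (C_RInt (fun x => Cconj I * f x)%C a b) <= Cmod I * RInt g a b).
  { change (RInt (fun x => Re (Cconj I * f x)%C) a b <= Cmod I * RInt g a b).
    replace (Cmod I * RInt g a b) with (RInt (fun x => scal (Cmod I) (g x)) a b)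
     by (rewrite (RInt_scal (V := R_CompleteNormedModule)); auto).
    apply RInt_le; auto.
    - apply (ex_C_RInt_scal (Cconj I) f a b Hf).
    - apply (ex_RInt_scal (V := R_NormedModule)); auto.
    - intros x Hx. eapply Rle_trans; [apply Rle_abs|]. eapply Rle_trans; [apply re_le_Cmod|].
      rewrite Cmod_mult, Cmod_conj. apply Rmult_le_compat_l; [lra|apply H; lra]. }
  rewrite C_RInt_scal in E1 by auto. fold I in E1.
  rewrite Cmult_comm, <- Cmod2_conj in E1.
  change (Cmod I ^ 2 <= Cmod I * RInt g a b) in E1.
  apply (Rmult_le_reg_l (Cmod I)); auto. lra.
Qed.

Definition on_edges (a b c d : R) (w : C) : Prop :=
  (a <= Re w <= b /\ (Im w = c \/ Im w = d)) \/ (c <= Im w <= d /\ (Re w = a \/ Re w = b)).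

Definition cont_edges (F : C -> C) a b c d : Prop :=
  forall w, on_edges a b c d w -> continuous (F : C_UniformSpace -> C_UniformSpace) w.

(** The contour integral of F along the boundary of the rectangle [a,b] x [c,d], counterclockwise;
    on vertical sides dw = i dy. *)
Definition rect_int (F : C -> C) (a b c d : R) : C :=
  (C_RInt (fun x => F (x, c)) a b + Ci * C_RInt (fun y => F (b, y)) c d
   - C_RInt (fun x => F (x, d)) a b - Ci * C_RInt (fun y => F (a, y)) c d)%C.

Lemma continuous_hline (F : C -> C) (x y : R) : continuous (F : C_UniformSpace -> C_UniformSpace) (x, y) ->
  continuous ((fun t => F (t, y)) : R_UniformSpace -> C_UniformSpace) x.
Proof.
  intros H. apply (continuous_comp (U := R_UniformSpace) (V := C_UniformSpace) (W := C_UniformSpace) (fun t => (t, y)) F); auto.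
  intros P [e He]. exists e. intros t Ht. apply He. split; [exact Ht|apply ball_center].
Qed.

Lemma continuous_vline (F : C -> C) (x y : R) : continuous (F : C_UniformSpace -> C_UniformSpace) (x, y) ->
  continuous ((fun t => F (x, t)) : R_UniformSpace -> C_UniformSpace) y.
Proof.
  intros H. apply (continuous_comp (U := R_UniformSpace) (V := C_UniformSpace) (W := C_UniformSpace) (fun t => (x, t)) F); auto.
  intros P [e He]. exists e. intros t Ht. apply He. split; [apply ball_center|exact Ht].
Qed.

Lemma ex_edges F a b c d : a <= b -> c <= d -> cont_edges F a b c d ->
  ex_C_RInt (fun x => F (x, c)) a b /\ ex_C_RInt (fun x => F (x, d)) a b /\
  ex_C_RInt (fun y => F (a, y)) c d /\ ex_C_RInt (fun y => F (b, y)) c d.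
Proof.
  intros Hab Hcd H. refine (conj _ (conj _ (conj _ _))); apply ex_C_RInt_continuous; auto; intros x Hx.
  - apply continuous_hline, H. left; simpl; auto.
  - apply continuous_hline, H. left; simpl; auto.
  - apply continuous_vline, H. right; simpl; auto.
  - apply continuous_vline, H. right; simpl; auto.
Qed.

Lemma rect_int_ext F G a b c d : a <= b -> c <= d -> (forall w, on_edges a b c d w -> F w = G w) ->
  rect_int F a b c d = rect_int G a b c d.
Proof.
  intros Hab Hcd H. unfold rect_int.
  rewrite (C_RInt_ext (fun x => F (x, c)) (fun x => G (x, c))); auto. 2:{ intros; apply H; left; simpl; auto. }
  rewrite (C_RInt_ext (fun x => F (x, d)) (fun x => G (x, d))); auto. 2:{ intros; apply H; left; simpl; auto. }
  rewrite (C_RInt_ext (fun x => F (a, x)) (fun x => G (a, x))); auto. 2:{ intros; apply H; right; simpl; auto. }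
  rewrite (C_RInt_ext (fun x => F (b, x)) (fun x => G (b, x))); auto. intros; apply H; right; simpl; auto.
Qed.

Lemma rect_int_minus F G a b c d : a <= b -> c <= d -> cont_edges F a b c d -> cont_edges G a b c d ->
  rect_int (fun w => F w - G w)%C a b c d = (rect_int F a b c d - rect_int G a b c d)%C.
Proof.
  intros Hab Hcd HF HG. destruct (ex_edges _ _ _ _ _ Hab Hcd HF) as [F1 [F2 [F3 F4]]].
  destruct (ex_edges _ _ _ _ _ Hab Hcd HG) as [G1 [G2 [G3 G4]]].
  unfold rect_int.
  rewrite (C_RInt_minus (fun x => F (x, c)) (fun x => G (x, c))); auto.
  rewrite (C_RInt_minus (fun x => F (x, d)) (fun x => G (x, d))); auto.
  rewrite (C_RInt_minus (fun x => F (a, x)) (fun x => G (a, x))); auto.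
  rewrite (C_RInt_minus (fun x => F (b, x)) (fun x => G (b, x))); auto. ring.
Qed.

Lemma rect_int_scal k F a b c d : a <= b -> c <= d -> cont_edges F a b c d ->
  rect_int (fun w => k * F w)%C a b c d = (k * rect_int F a b c d)%C.
Proof.
  intros Hab Hcd HF. destruct (ex_edges _ _ _ _ _ Hab Hcd HF) as [F1 [F2 [F3 F4]]].
  unfold rect_int.
  rewrite (C_RInt_scal k (fun x => F (x, c))); auto.
  rewrite (C_RInt_scal k (fun x => F (x, d))); auto.
  rewrite (C_RInt_scal k (fun x => F (a, x))); auto.
  rewrite (C_RInt_scal k (fun x => F (b, x))); auto. ring.
Qed.

Lemma ex_RInt_cst (v a b : R) : ex_RInt (fun _ => v) a b.
Proof. apply (ex_RInt_const (V := R_NormedModule)). Qed.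

Lemma C_RInt_bound_const f M a b : a <= b -> ex_C_RInt f a b ->
  (forall x, a <= x <= b -> Cmod (f x) <= M) -> Cmod (C_RInt f a b) <= (b - a) * M.
Proof.
  intros Hab Hf H. replace ((b - a) * M) with (RInt (fun _ => M) a b).
  - apply C_RInt_bound; auto. apply ex_RInt_cst.
  - rewrite RInt_const. reflexivity.
Qed.

Lemma Cmod_edges_sum (p q r s : C) : Cmod (p + Ci * q - r - Ci * s) <= Cmod p + Cmod q + Cmod r + Cmod s.
Proof.
  eapply Rle_trans; [apply Cmod_minus_triangle|]. rewrite Cmod_mult, Cmod_Ci.
  assert (H := Cmod_minus_triangle (p + Ci * q) r). assert (H2 := Cmod_triangle p (Ci * q)).
  rewrite Cmod_mult, Cmod_Ci in H2. lra.
Qed.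

Lemma rect_int_bound F a b c d M : a <= b -> c <= d -> cont_edges F a b c d ->
  (forall w, on_edges a b c d w -> Cmod (F w) <= M) ->
  Cmod (rect_int F a b c d) <= 2 * M * ((b - a) + (d - c)).
Proof.
  intros Hab Hcd HF HM. destruct (ex_edges _ _ _ _ _ Hab Hcd HF) as [F1 [F2 [F3 F4]]].
  unfold rect_int. eapply Rle_trans; [apply Cmod_edges_sum|].
  assert (B1 := C_RInt_bound_const (fun x => F (x, c)) M a b Hab F1).
  assert (B2 := C_RInt_bound_const (fun x => F (x, d)) M a b Hab F2).
  assert (B3 := C_RInt_bound_const (fun x => F (a, x)) M c d Hcd F3).
  assert (B4 := C_RInt_bound_const (fun x => F (b, x)) M c d Hcd F4).
  lapply B1; [|intros; apply HM; left; simpl; auto].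
  lapply B2; [|intros; apply HM; left; simpl; auto].
  lapply B3; [|intros; apply HM; right; simpl; auto].
  lapply B4; [|intros; apply HM; right; simpl; auto]. lra.
Qed.

Lemma rect_int_split_x F a e b c d : a <= e <= b ->
  ex_C_RInt (fun x => F (x, c)) a b -> ex_C_RInt (fun x => F (x, d)) a b ->
  rect_int F a b c d = (rect_int F a e c d + rect_int F e b c d)%C.
Proof.
  intros He H1 H2. unfold rect_int.
  rewrite (C_RInt_Chasles (fun x => F (x, c)) a e b), (C_RInt_Chasles (fun x => F (x, d)) a e b) by auto. ring.
Qed.

Lemma rect_int_split_y F a b c e d : c <= e <= d ->
  ex_C_RInt (fun y => F (a, y)) c d -> ex_C_RInt (fun y => F (b, y)) c d ->
  rect_int F a b c d = (rect_int F a b c e + rect_int F a b e d)%C.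
Proof.
  intros He H1 H2. unfold rect_int.
  rewrite (C_RInt_Chasles (fun y => F (a, y)) c e d), (C_RInt_Chasles (fun y => F (b, y)) c e d) by auto. ring.
Qed.

Lemma cderiv_affine p q w : cderiv (fun v => p + q * v)%C w q.
Proof.
  eapply cderiv_eq; [|apply cderiv_plus; [apply cderiv_const|apply cderiv_scal, cderiv_id]]. ring.
Qed.

(** On opposite sides an affine function differs by a constant, so the four integrals pair up into
    two integrals of constants, which cancel. No primitive is involved. *)
Lemma rect_int_affine p q a b c d : a <= b -> c <= d -> rect_int (fun w => p + q * w)%C a b c d = 0.
Proof.
  intros Hab Hcd.
  assert (HF : cont_edges (fun w => p + q * w)%C a b c d).
  { intros w _. apply (cderiv_continuous _ _ q). apply cderiv_affine. }
  destruct (ex_edges _ _ _ _ _ Hab Hcd HF) as [F1 [F2 [F3 F4]]].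
  unfold rect_int.
  match goal with |- (?A + Ci * ?B - ?A' - Ci * ?B')%C = _ =>
    transitivity ((A - A') + Ci * (B - B'))%C; [ring|] end.
  rewrite <- !C_RInt_minus by auto.
  rewrite (C_RInt_ext _ (fun _ => q * (Ci * RtoC (c - d)))%C); auto.
  2:{ intros x _. replace ((x, c) : C) with (RtoC x + Ci * RtoC c)%C.
      replace ((x, d) : C) with (RtoC x + Ci * RtoC d)%C. rewrite RtoC_minus; ring.
      all: unfold Ci, RtoC, Cplus, Cmult; simpl; f_equal; ring. }
  rewrite (C_RInt_ext (fun x => _ - _)%C (fun _ => q * RtoC (b - a))%C); auto.
  2:{ intros x _. replace ((a, x) : C) with (RtoC a + Ci * RtoC x)%C.
      replace ((b, x) : C) with (RtoC b + Ci * RtoC x)%C. rewrite RtoC_minus; ring.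
      all: unfold Ci, RtoC, Cplus, Cmult; simpl; f_equal; ring. }
  rewrite !C_RInt_const. rewrite !RtoC_minus. ring.
Qed.

Definition holo_rect (F : C -> C) a b c d : Prop :=
  forall w, a <= Re w <= b -> c <= Im w <= d -> exists l, cderiv F w l.

Lemma holo_rect_sub F a b c d a' b' c' d' : a <= a' -> b' <= b -> c <= c' -> d' <= d ->
  holo_rect F a b c d -> holo_rect F a' b' c' d'.
Proof. intros A1 A2 A3 A4 H w H1 H2. apply H; lra. Qed.

Lemma holo_rect_cont F a b c d : a <= b -> c <= d -> holo_rect F a b c d -> cont_edges F a b c d.
Proof.
  intros Hab Hcd H w Hw. destruct (H w) as [l Hl].
  - destruct Hw as [[A [B|B]]|[A [B|B]]]; lra.
  - destruct Hw as [[A [B|B]]|[A [B|B]]]; lra.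
  - eapply cderiv_continuous, Hl.
Qed.

(** Applied to each coordinate of the corners in the quartering below; the common point of the
    nested intervals is the supremum of their left ends. *)
Lemma nested_dyadic (x : nat -> R) (W : R) :
  (forall n, x n <= x (S n)) -> (forall n, x (S n) + W / 2 ^ (S n) <= x n + W / 2 ^ n) -> 0 <= W ->
  exists l, forall n, x n <= l <= x n + W / 2 ^ n.
Proof.
  intros H1 H2 HW.
  assert (M1 : forall n m, (n <= m)%nat -> x n <= x m).
  { intros n m Hnm. induction Hnm; [lra|]. eapply Rle_trans; [apply IHHnm|apply H1]. }
  assert (M2 : forall n m, (n <= m)%nat -> x m + W / 2 ^ m <= x n + W / 2 ^ n).
  { intros n m Hnm. induction Hnm; [lra|]. eapply Rle_trans; [apply H2|apply IHHnm]. }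
  assert (P : forall n, 0 <= W / 2 ^ n).
  { intros n. apply Rdiv_le_0_compat; auto. apply pow_lt; lra. }
  assert (U : forall n m, x n <= x m + W / 2 ^ m).
  { intros n m. destruct (Nat.le_ge_cases n m) as [L|L].
    - generalize (M1 n m L) (P m); lra.
    - generalize (M2 m n L) (P n); lra. }
  destruct (completeness (fun y => exists n, y = x n)) as [l [Hl1 Hl2]].
  - exists (x 0%nat + W / 2 ^ 0). intros y [n ->]. apply U.
  - exists (x 0%nat). now exists 0%nat.
  - exists l. intros n. split.
    + apply Hl1. now exists n.
    + apply Hl2. intros y [m ->]. apply U.
Qed.

Lemma pow2_unbounded x : exists n, x < 2 ^ n.
Proof.
  destruct (Pow_x_infinity 2 ltac:(rewrite Rabs_pos_eq; lra) (x + 1)) as [n Hn]. exists n.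
  specialize (Hn n (Nat.le_refl n)). rewrite Rabs_pos_eq in Hn by (apply pow_le; lra). lra.
Qed.

(** * Goursat's theorem by repeated quartering *)

Section Goursat.
Variables (F : C -> C) (a c W H : R).
Hypotheses (HW : 0 < W) (HH : 0 < H) (HF : holo_rect F a (a + W) c (c + H)).

Let part (n : nat) (s : R * R) : C :=
  rect_int F (fst s) (fst s + W / 2 ^ n) (snd s) (snd s + H / 2 ^ n).

Let I := Cmod (rect_int F a (a + W) c (c + H)).

(** Lower left corners of the successive rectangles. Only three quarters are tested: when their
    integrals are all too small, the triangle inequality forces the fourth, taken by default, to be
    large. *)
Fixpoint quarters (n : nat) : R * R :=
  match n with
  | O => (a, c)
  | S m => let s := quarters m in
           let h := W / 2 ^ n in let k := H / 2 ^ n in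
           if Rle_dec (I / 4 ^ n) (Cmod (part n s)) then s
           else if Rle_dec (I / 4 ^ n) (Cmod (part n (fst s + h, snd s))) then (fst s + h, snd s)
           else if Rle_dec (I / 4 ^ n) (Cmod (part n (fst s, snd s + k))) then (fst s, snd s + k)
           else (fst s + h, snd s + k)
  end.

Lemma halve_pow n X : X / 2 ^ n = X / 2 ^ S n + X / 2 ^ S n.
Proof. simpl. field. apply pow_nonzero; lra. Qed.

Lemma div_pow_pos n X : 0 < X -> 0 < X / 2 ^ n.
Proof. intros. apply Rdiv_lt_0_compat; auto. apply pow_lt; lra. Qed.

Lemma quarters_spec n :
  a <= fst (quarters n) /\ fst (quarters n) + W / 2 ^ n <= a + W /\
  c <= snd (quarters n) /\ snd (quarters n) + H / 2 ^ n <= c + H /\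
  I / 4 ^ n <= Cmod (part n (quarters n)).
Proof.
  induction n as [|n [A1 [A2 [A3 [A4 A5]]]]].
  - simpl quarters. unfold part, I. simpl. rewrite !Rdiv_1_r. repeat split; lra.
  - set (s := quarters n) in *. set (h := W / 2 ^ S n). set (k := H / 2 ^ S n).
    assert (Eh : W / 2 ^ n = h + h) by apply halve_pow.
    assert (Ek : H / 2 ^ n = k + k) by apply halve_pow.
    assert (Ph : 0 < h) by now apply div_pow_pos. assert (Pk : 0 < k) by now apply div_pow_pos.
    assert (E : part n s = (part (S n) s + part (S n) (fst s + h, snd s)%R
       + part (S n) (fst s, snd s + k)%R + part (S n) (fst s + h, snd s + k)%R)%C).
    { unfold part. simpl fst; simpl snd. fold h k. rewrite Eh, Ek.
      replace (fst s + (h + h)) with (fst s + h + h) by ring.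
      replace (snd s + (k + k)) with (snd s + k + k) by ring.
      assert (Hs : holo_rect F (fst s) (fst s + h + h) (snd s) (snd s + k + k))
        by (eapply holo_rect_sub; [| | | |apply HF]; lra).
      assert (T : forall a' b' c' d', fst s <= a' -> a' <= b' -> b' <= fst s + h + h -> snd s <= c' -> c' <= d' -> d' <= snd s + k + k ->
        cont_edges F a' b' c' d').
      { intros. apply holo_rect_cont; auto. eapply holo_rect_sub; [| | | |apply Hs]; lra. }
      assert (C0 := T (fst s) (fst s + h + h) (snd s) (snd s + k + k) ltac:(lra) ltac:(lra) ltac:(lra) ltac:(lra) ltac:(lra) ltac:(lra)).
      apply ex_edges in C0; [|lra|lra]. destruct C0 as [D1 [D2 _]].
      rewrite (rect_int_split_x F (fst s) (fst s + h) (fst s + h + h)); auto; [|lra].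
      assert (C1 := T (fst s) (fst s + h) (snd s) (snd s + k + k) ltac:(lra) ltac:(lra) ltac:(lra) ltac:(lra) ltac:(lra) ltac:(lra)).
      apply ex_edges in C1; [|lra|lra]. destruct C1 as [_ [_ [D3 D4]]].
      assert (C2 := T (fst s + h) (fst s + h + h) (snd s) (snd s + k + k) ltac:(lra) ltac:(lra) ltac:(lra) ltac:(lra) ltac:(lra) ltac:(lra)).
      apply ex_edges in C2; [|lra|lra]. destruct C2 as [_ [_ [D5 D6]]].
      rewrite (rect_int_split_y F (fst s) (fst s + h) (snd s) (snd s + k)); auto; [|lra].
      rewrite (rect_int_split_y F (fst s + h) (fst s + h + h) (snd s) (snd s + k)); auto; [|lra].
      ring. }
    assert (E4 : I / 4 ^ n = 4 * (I / 4 ^ S n)) by (simpl; field; apply pow_nonzero; lra).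
    rewrite E in A5. rewrite E4 in A5.
    assert (B := Cmod_triangle (part (S n) s + part (S n) (fst s + h, snd s)%R + part (S n) (fst s, snd s + k)%R) (part (S n) (fst s + h, snd s + k)%R)).
    assert (B' := Cmod_triang3 (part (S n) s) (part (S n) (fst s + h, snd s)%R) (part (S n) (fst s, snd s + k)%R)).
    cbn [quarters]. fold s h k.
    destruct (Rle_dec (I / 4 ^ S n) (Cmod (part (S n) s))) as [Q1|Q1]; [simpl fst; simpl snd; fold h k; repeat split; auto; lra|].
    destruct (Rle_dec (I / 4 ^ S n) (Cmod (part (S n) (fst s + h, snd s)%R))) as [Q2|Q2]; [simpl fst; simpl snd; fold h k; repeat split; auto; lra|].
    destruct (Rle_dec (I / 4 ^ S n) (Cmod (part (S n) (fst s, snd s + k)%R))) as [Q3|Q3]; [simpl fst; simpl snd; fold h k; repeat split; auto; lra|].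
    simpl fst; simpl snd; repeat split; try lra.
Qed.

Lemma quarters_step n :
  (fst (quarters n) <= fst (quarters (S n)) /\
   fst (quarters (S n)) + W / 2 ^ S n <= fst (quarters n) + W / 2 ^ n) /\
  (snd (quarters n) <= snd (quarters (S n)) /\
   snd (quarters (S n)) + H / 2 ^ S n <= snd (quarters n) + H / 2 ^ n).
Proof.
  rewrite (halve_pow n W), (halve_pow n H).
  assert (Ph := div_pow_pos (S n) W HW). assert (Pk := div_pow_pos (S n) H HH).
  cbn [quarters]. destruct (quarters n) as [x y]. simpl fst; simpl snd.
  repeat destruct Rle_dec; simpl; simpl in Ph, Pk; repeat split; lra.
Qed.

(** At the common point of the rectangles F is affine up to a small multiple of the distance. Affine
    functions integrate to 0, so the n-th integral is a small multiple of 4^(-n), against its lower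
    bound I/4^n. *)
Lemma goursat_rect : rect_int F a (a + W) c (c + H) = 0.
Proof.
  destruct (nested_dyadic (fun n => fst (quarters n)) W) as [x Hx]; try lra; try (intros; apply quarters_step).
  destruct (nested_dyadic (fun n => snd (quarters n)) H) as [y Hy]; try lra; try (intros; apply quarters_step).
  destruct (HF (x, y)) as [l Hl].
  { simpl. specialize (Hx 0%nat). simpl in Hx. lra. }
  { simpl. specialize (Hy 0%nat). simpl in Hy. lra. }
  apply Cmod_eq_0. fold I. assert (HI : 0 <= I) by apply Cmod_ge_0.
  destruct (Req_dec I 0) as [|HI0]; auto. exfalso.
  set (D := W + H). assert (HD : 0 < D) by (unfold D; lra).
  (* Half-perimeter and distance are both at most D/2^n, so this accuracy bounds the n-th integral
     by half of I/4^n. *)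
  destruct (Hl (I / (4 * D * D))) as [del [Hdel Hv]]. { apply Rdiv_lt_0_compat; [lra|]. repeat apply Rmult_lt_0_compat; lra. }
  destruct (pow2_unbounded (D / del)) as [n Hn].
  destruct (quarters_spec n) as [A1 [A2 [A3 [A4 A5]]]].
  specialize (Hx n). specialize (Hy n).
  set (s := quarters n) in *. unfold part in A5.
  assert (Ph := div_pow_pos n W HW). assert (Pk := div_pow_pos n H HH).
  set (h := W / 2 ^ n) in *. set (k := H / 2 ^ n) in *.
  assert (P2 : 0 < 2 ^ n) by (apply pow_lt; lra).
  assert (Ehk : h + k = D / 2 ^ n) by (unfold h, k, D; field; lra).
  assert (Hhk : h + k < del).
  { rewrite Ehk. apply Rlt_div_l; auto. apply Rlt_div_l in Hn; lra. }
  set (p := (F (x, y) - l * (x, y))%C).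
  assert (Cs : cont_edges F (fst s) (fst s + h) (snd s) (snd s + k)).
  { apply holo_rect_cont; try lra. eapply holo_rect_sub; [| | | |apply HF]; lra. }
  assert (E : rect_int F (fst s) (fst s + h) (snd s) (snd s + k)
     = rect_int (fun w => F w - (p + l * w))%C (fst s) (fst s + h) (snd s) (snd s + k)).
  { rewrite rect_int_minus; try lra; auto.
    - rewrite rect_int_affine by lra. ring.
    - intros w _. apply (cderiv_continuous _ _ l), cderiv_affine. }
  rewrite E in A5.
  assert (B := rect_int_bound (fun w => F w - (p + l * w))%C (fst s) (fst s + h) (snd s) (snd s + k)
      (I / (4 * D * D) * (h + k)) ltac:(lra) ltac:(lra)).
  lapply B; [clear B; intros B|].
  - lapply B; [clear B; intros B|].
    + replace (4 ^ n) with (2 ^ n * 2 ^ n) in A5 by (rewrite <- Rpow_mult_distr; f_equal; lra).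
      replace (fst s + h - fst s + (snd s + k - snd s)) with (h + k) in B by ring.
      rewrite Ehk in B.
      replace (2 * (I / (4 * D * D) * (D / 2 ^ n)) * (D / 2 ^ n)) with (I / (2 ^ n * 2 ^ n) / 2) in B by (field; lra).
      assert (0 < I / (2 ^ n * 2 ^ n)). { apply Rdiv_lt_0_compat; [lra|]. now apply Rmult_lt_0_compat. }
      lra.
    + intros w Hw.
      assert (Hw2 : Cmod (w - (x, y)) <= h + k).
      { destruct w as [u v]. eapply Rle_trans; [apply Cmod_le_abs|]. simpl.
        assert (fst s <= u <= fst s + h /\ snd s <= v <= snd s + k) by (destruct Hw as [[? [?|?]]|[? [?|?]]]; simpl in *; lra).
        apply Rplus_le_compat; apply Rabs_le; lra. }
      replace (F w - (p + l * w))%C with (F w - F (x, y) - l * (w - (x, y)))%C by (unfold p; ring).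
      eapply Rle_trans; [apply Hv; lra|]. apply Rmult_le_compat_l; auto.
      left; apply Rdiv_lt_0_compat; [lra|]. repeat apply Rmult_lt_0_compat; lra.
  - intros w Hw. destruct (HF w) as [l' Hl'].
    + destruct Hw as [[? [?|?]]|[? [?|?]]]; lra.
    + destruct Hw as [[? [?|?]]|[? [?|?]]]; lra.
    + apply (cderiv_continuous _ _ (l' - l)). apply cderiv_minus; auto. apply cderiv_affine.
Qed.
End Goursat.

Lemma goursat F a b c d : a < b -> c < d -> holo_rect F a b c d -> rect_int F a b c d = 0.
Proof.
  intros Hab Hcd H. replace b with (a + (b - a)) by ring. replace d with (c + (d - c)) by ring.
  apply goursat_rect; try lra. 
  replace (a + (b - a)) with b by ring. now replace (c + (d - c)) with d by ring.
Qed.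

(** * Cauchy's formula *)

Lemma neq_off_edges a b c d (w0 w : C) : a < Re w0 < b -> c < Im w0 < d -> on_edges a b c d w -> (w - w0)%C <> RtoC 0.
Proof.
  intros H1 H2 Hw E. apply Ceq_minus in E. subst w0. 
  destruct Hw as [[? [?|?]]|[? [?|?]]]; lra.
Qed.

Lemma cderiv_sub_const w0 w : cderiv (fun v => v - w0)%C w 1.
Proof.
  eapply cderiv_eq; [|apply cderiv_minus; [apply cderiv_id|apply cderiv_const]]. ring.
Qed.

Lemma cderiv_quot F w0 w l : w <> w0 -> cderiv F w l -> exists l', cderiv (fun v => F v / (v - w0))%C w l'.
Proof.
  intros Hw HF. eexists. apply cderiv_div; [|apply HF|apply cderiv_sub_const].
  intros E. apply Hw. now apply Ceq_minus.
Qed.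

(* The four strips around a small square centred at [w0] contribute nothing, by Goursat. *)
Lemma rect_int_shrink F a b c d (w0 : C) s : 0 < s ->
  a < Re w0 - s -> Re w0 + s < b -> c < Im w0 - s -> Im w0 + s < d ->
  (forall w, a <= Re w <= b -> c <= Im w <= d -> w <> w0 -> exists l, cderiv F w l) ->
  rect_int F a b c d = rect_int F (Re w0 - s) (Re w0 + s) (Im w0 - s) (Im w0 + s).
Proof.
  intros Hs H1 H2 H3 H4 HF. destruct w0 as [x0 y0]; simpl in *.
  assert (Hol : forall a' b' c' d', a <= a' -> b' <= b -> c <= c' -> d' <= d ->
     (b' < x0 \/ x0 < a' \/ d' < y0 \/ y0 < c') -> holo_rect F a' b' c' d').
  { intros a' b' c' d' A1 A2 A3 A4 A5 w B1 B2. apply HF; try lra. intros ->. simpl in *. lra. }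
  assert (Hc : forall w, a <= Re w <= b -> c <= Im w <= d -> Re w <> x0 \/ Im w <> y0 ->
     continuous (F : C_UniformSpace -> C_UniformSpace) w).
  { intros w A1 A2 A3. destruct (HF w A1 A2) as [l Hl].
    - intros ->. simpl in A3. tauto.
    - eapply cderiv_continuous, Hl. }
  assert (Cx : forall u v y, a <= u -> u <= v -> v <= b -> c <= y <= d -> y <> y0 -> ex_C_RInt (fun x => F (x, y)) u v).
  { intros u v y A1 A2 A3 A4 A5. apply ex_C_RInt_continuous; auto. intros x Hx. apply continuous_hline, Hc; simpl; auto; lra. }
  assert (Cy : forall u v x, c <= u -> u <= v -> v <= d -> a <= x <= b -> x <> x0 -> ex_C_RInt (fun y => F (x, y)) u v).
  { intros u v x A1 A2 A3 A4 A5. apply ex_C_RInt_continuous; auto. intros y Hy. apply continuous_vline, Hc; simpl; auto; lra. }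
  rewrite (rect_int_split_x F a (x0 - s) b); try (apply Cx; lra); [|lra].
  rewrite (goursat F a (x0 - s) c d); try lra; [|apply Hol; lra].
  rewrite (rect_int_split_x F (x0 - s) (x0 + s) b); try (apply Cx; lra); [|lra].
  rewrite (goursat F (x0 + s) b c d); try lra; [|apply Hol; lra].
  rewrite (rect_int_split_y F (x0 - s) (x0 + s) c (y0 - s)); try (apply Cy; lra); [|lra].
  rewrite (goursat F (x0 - s) (x0 + s) c (y0 - s)); try lra; [|apply Hol; lra].
  rewrite (rect_int_split_y F (x0 - s) (x0 + s) (y0 - s) (y0 + s)); try (apply Cy; lra); [|lra].
  rewrite (goursat F (x0 - s) (x0 + s) (y0 + s) d); try lra; [|apply Hol; lra].
  ring.
Qed.

(** The difference quotient of F at w0 is bounded near w0, so its integral over a shrinking square,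
    hence over the rectangle, is 0. The winding integral stays as an unevaluated factor. *)
Lemma cauchy_formula F a b c d (w0 : C) : a < Re w0 < b -> c < Im w0 < d -> holo_rect F a b c d ->
  rect_int (fun w => F w / (w - w0))%C a b c d = (F w0 * rect_int (fun w => / (w - w0))%C a b c d)%C.
Proof.
  intros Hx Hy HF.
  assert (Hab : a <= b) by lra. assert (Hcd : c <= d) by lra.
  set (G := fun w => ((F w - F w0) / (w - w0))%C).
  assert (HG : forall w, a <= Re w <= b -> c <= Im w <= d -> w <> w0 -> exists l, cderiv G w l).
  { intros w A1 A2 A3. destruct (HF w A1 A2) as [l Hl].
    apply (cderiv_quot (fun v => F v - F w0)%C _ _ (l - 0)); auto.
    apply cderiv_minus; auto. apply cderiv_const. }
  assert (G0 : rect_int G a b c d = 0).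
  { apply Cmod_eq_0. 
    destruct (HF w0) as [l Hl]; try lra. destruct (cderiv_lipschitz _ _ _ Hl) as [del [Hdel Hv]].
    set (K := Cmod l + 1) in *. assert (HK : 0 < K) by (unfold K; generalize (Cmod_ge_0 l); lra).
    set (m := Rmin (Rmin (Re w0 - a) (b - Re w0)) (Rmin (Im w0 - c) (d - Im w0))).
    assert (Hm : 0 < m) by (unfold m; repeat apply Rmin_pos; lra).
    assert (M1 : m <= Re w0 - a) by (unfold m; eapply Rle_trans; [apply Rmin_l|apply Rmin_l]).
    assert (M2 : m <= b - Re w0) by (unfold m; eapply Rle_trans; [apply Rmin_l|apply Rmin_r]).
    assert (M3 : m <= Im w0 - c) by (unfold m; eapply Rle_trans; [apply Rmin_r|apply Rmin_l]).
    assert (M4 : m <= d - Im w0) by (unfold m; eapply Rle_trans; [apply Rmin_r|apply Rmin_r]).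
    assert (B : forall s, 0 < s -> s < m -> s < del / 2 -> Cmod (rect_int G a b c d) <= 8 * K * s).
    { intros s S1 S2 S3. rewrite (rect_int_shrink G a b c d w0 s) by (auto; lra).
      eapply Rle_trans; [apply (rect_int_bound _ _ _ _ _ K); try lra|].
      - intros w Hw. destruct (HG w) as [l' Hl'].
        + destruct Hw as [[? [?|?]]|[? [?|?]]]; lra.
        + destruct Hw as [[? [?|?]]|[? [?|?]]]; lra.
        + intros ->. destruct Hw as [[? [?|?]]|[? [?|?]]]; lra.
        + eapply cderiv_continuous, Hl'.
      - intros w Hw.
        assert (N : (w - w0)%C <> RtoC 0) by (eapply neq_off_edges; [| |apply Hw]; lra).
        unfold G. rewrite Cmod_div by auto. apply Rle_div_l; [now apply Cmod_gt_0|].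
        apply Hv.
        replace (w - w0)%C with ((Re w - Re w0, Im w - Im w0) : C) by (destruct w, w0; reflexivity).
        eapply Rle_lt_trans; [apply Cmod_le_abs|].
        assert (Rabs (Re w - Re w0) <= s) by (apply Rabs_le; destruct Hw as [[? [?|?]]|[? [?|?]]]; lra).
        assert (Rabs (Im w - Im w0) <= s) by (apply Rabs_le; destruct Hw as [[? [?|?]]|[? [?|?]]]; lra).
        lra.
      - right; ring. }
    destruct (Req_dec (Cmod (rect_int G a b c d)) 0) as [|N]; auto. exfalso.
    set (I := Cmod (rect_int G a b c d)) in *. assert (HI : 0 < I) by (generalize (Cmod_ge_0 (rect_int G a b c d)); fold I; lra).
    set (s := Rmin (Rmin m (del / 2)) (I / (8 * K)) / 2).
    assert (Hs : 0 < Rmin (Rmin m (del / 2)) (I / (8 * K))).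
    { repeat apply Rmin_pos; try lra. apply Rdiv_lt_0_compat; lra. }
    assert (S1 := Rmin_l (Rmin m (del / 2)) (I / (8 * K))). assert (S2 := Rmin_r (Rmin m (del / 2)) (I / (8 * K))).
    assert (S3 := Rmin_l m (del / 2)). assert (S4 := Rmin_r m (del / 2)).
    specialize (B s ltac:(unfold s; lra) ltac:(unfold s; lra) ltac:(unfold s; lra)).
    assert (8 * K * s <= 8 * K * (I / (8 * K) / 2)) by (apply Rmult_le_compat_l; unfold s; lra).
    replace (8 * K * (I / (8 * K) / 2)) with (I / 2) in H by (field; lra). lra. }
  assert (HQ : forall H, holo_rect H a b c d -> cont_edges (fun w => H w / (w - w0))%C a b c d).
  { intros H HH w Hw. assert (N := neq_off_edges _ _ _ _ _ _ Hx Hy Hw).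
    destruct (HH w) as [l Hl]; [destruct Hw as [[? [?|?]]|[? [?|?]]]; lra|destruct Hw as [[? [?|?]]|[? [?|?]]]; lra|].
    destruct (cderiv_quot H w0 w l) as [l' Hl']; auto.
    - intros ->. apply N; ring.
    - eapply cderiv_continuous, Hl'. }
  assert (H1 : cont_edges (fun w => / (w - w0))%C a b c d).
  { intros w Hw. assert (N := neq_off_edges _ _ _ _ _ _ Hx Hy Hw).
    eapply cderiv_continuous. apply cderiv_Cinv; auto. apply cderiv_sub_const. }
  assert (H2 : cont_edges (fun w => F w0 * / (w - w0))%C a b c d).
  { intros w Hw. assert (N := neq_off_edges _ _ _ _ _ _ Hx Hy Hw).
    eapply cderiv_continuous. apply cderiv_scal. apply (cderiv_Cinv (fun w => w - w0)%C); auto. apply cderiv_sub_const. }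
  apply Ceq_minus. rewrite <- rect_int_scal, <- rect_int_minus by auto.
  rewrite <- G0. apply rect_int_ext; auto. intros w _. unfold G, Cdiv. ring.
Qed.

Lemma ex_RInt_cont (f : R -> R) a b : a <= b -> (forall x, a <= x <= b -> continuous f x) -> ex_RInt f a b.
Proof.
  intros Hab H. apply (ex_RInt_continuous (V := R_CompleteNormedModule)).
  now rewrite Rmin_left, Rmax_right by auto.
Qed.

Lemma Re_inv_kernel u v : u * u + v * v <> 0 -> (/ ((u, v) : C))%C = (u / (u * u + v * v), - v / (u * u + v * v)) :> C.
Proof. intros H. unfold Cinv; simpl. f_equal; field; auto; replace (u * (u * 1) + v * (v * 1)) with (u * u + v * v) by ring; auto. Qed.

(** The true value is 2 PI. Each horizontal side contributes the integral of rho/((x-x0)^2 + rho^2),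
    which is at least 1 already over |x-x0| <= rho, where the integrand is at least 1/(2 rho). The
    vertical sides contribute nonnegative amounts. *)
Lemma Im_winding (x0 y0 L rho : R) : 0 < rho -> rho <= L ->
  2 <= Im (rect_int (fun w => / (w - (x0, y0)))%C (x0 - L) (x0 + L) (y0 - rho) (y0 + rho)).
Proof.
  intros Hr HL.
  set (g := fun x => rho / ((x - x0) * (x - x0) + rho * rho)).
  set (h := fun y => L / (L * L + (y - y0) * (y - y0))).
  assert (Pg : forall x, 0 < (x - x0) * (x - x0) + rho * rho).
  { intros x. assert (0 <= (x - x0) * (x - x0)) by apply Rle_0_sqr. assert (0 < rho * rho) by (apply Rmult_lt_0_compat; lra). lra. }
  assert (Ph : forall y, 0 < L * L + (y - y0) * (y - y0)).
  { intros y. assert (0 <= (y - y0) * (y - y0)) by apply Rle_0_sqr. assert (0 < L * L) by (apply Rmult_lt_0_compat; lra). lra. }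
  assert (Cg : forall x, continuous g x).
  { intros x. apply (ex_derive_continuous g). unfold g. auto_derive. generalize (Pg x); unfold Rminus; lra. }
  assert (Ch : forall x, continuous h x).
  { intros x. apply (ex_derive_continuous h). unfold h. auto_derive. generalize (Ph x); unfold Rminus; lra. }
  assert (G1 : 1 <= RInt g (x0 - L) (x0 + L)).
  { assert (Ex : forall u v, u <= v -> ex_RInt g u v) by (intros; apply ex_RInt_cont; auto).
    rewrite <- (RInt_Chasles g (x0 - L) (x0 - rho)); [|apply Ex; lra|apply Ex; lra].
    rewrite <- (RInt_Chasles g (x0 - rho) (x0 + rho)); [|apply Ex; lra|apply Ex; lra].
    unfold plus; simpl.
    assert (0 <= RInt g (x0 - L) (x0 - rho)). 
    { apply RInt_ge_0; [lra|apply Ex; lra|]. intros; left; apply Rdiv_lt_0_compat; auto. }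
    assert (0 <= RInt g (x0 + rho) (x0 + L)). 
    { apply RInt_ge_0; [lra|apply Ex; lra|]. intros; left; apply Rdiv_lt_0_compat; auto. }
    assert (1 <= RInt g (x0 - rho) (x0 + rho)); [|lra].
    replace 1 with (RInt (fun _ => / (2 * rho)) (x0 - rho) (x0 + rho)).
    2:{ rewrite RInt_const. unfold scal; simpl; unfold mult; simpl. field; lra. }
    apply RInt_le; [lra|apply ex_RInt_cst|apply Ex; lra|].
    intros x Hx. unfold g.
    assert ((x - x0) * (x - x0) <= rho * rho) by (apply Rsqr_le_abs_1; rewrite (Rabs_pos_eq rho) by lra; apply Rabs_le; lra).
    replace (/ (2 * rho)) with (rho / (2 * (rho * rho))) by (field; lra).
    apply Rmult_le_compat_l; [lra|]. apply Rinv_le_contravar; [apply Pg|lra]. }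
  assert (G2 : 0 <= RInt h (y0 - rho) (y0 + rho)).
  { apply RInt_ge_0; [lra|apply ex_RInt_cont; [lra|auto]|]. intros; left; apply Rdiv_lt_0_compat; auto; lra. }
  unfold rect_int. 
  assert (E1 : forall x, (/ ((x, (y0 - rho)%R) - (x0, y0)))%C = ((x - x0) / ((x - x0) * (x - x0) + rho * rho), g x) :> C).
  { intros x. replace (((x, (y0 - rho)%R) : C) - (x0, y0))%C with ((x - x0, - rho) : C) by (unfold Cminus, Cplus, Copp; simpl; f_equal; ring).
    assert (P := Pg x). rewrite Re_inv_kernel by lra. unfold g. f_equal; field; lra. }
  assert (E2 : forall x, (/ ((x, (y0 + rho)%R) - (x0, y0)))%C = ((x - x0) / ((x - x0) * (x - x0) + rho * rho), - g x) :> C).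
  { intros x. replace (((x, (y0 + rho)%R) : C) - (x0, y0))%C with ((x - x0, rho) : C) by (unfold Cminus, Cplus, Copp; simpl; f_equal; ring).
    assert (P := Pg x). rewrite Re_inv_kernel by lra. unfold g. f_equal; field; lra. }
  assert (E3 : forall y, (/ (((x0 - L)%R, y) - (x0, y0)))%C = (- h y, - (y - y0) / (L * L + (y - y0) * (y - y0))) :> C).
  { intros y. replace ((((x0 - L)%R, y) : C) - (x0, y0))%C with ((- L, y - y0) : C) by (unfold Cminus, Cplus, Copp; simpl; f_equal; ring).
    assert (P := Ph y). rewrite Re_inv_kernel by lra. unfold h. f_equal; field; lra. }
  assert (E4 : forall y, (/ (((x0 + L)%R, y) - (x0, y0)))%C = (h y, - (y - y0) / (L * L + (y - y0) * (y - y0))) :> C).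
  { intros y. replace ((((x0 + L)%R, y) : C) - (x0, y0))%C with ((L, y - y0) : C) by (unfold Cminus, Cplus, Copp; simpl; f_equal; ring).
    assert (P := Ph y). rewrite Re_inv_kernel by lra. unfold h. f_equal; field; lra. }
  assert (I1 : Im (C_RInt (fun x => / ((x, (y0 - rho)%R) - (x0, y0)))%C (x0 - L) (x0 + L)) = RInt g (x0 - L) (x0 + L)).
  { apply RInt_ext. intros x _. now rewrite E1. }
  assert (I2 : Im (C_RInt (fun x => / ((x, (y0 + rho)%R) - (x0, y0)))%C (x0 - L) (x0 + L)) = - RInt g (x0 - L) (x0 + L)).
  { transitivity (RInt (fun x => opp (g x)) (x0 - L) (x0 + L)).
    - apply RInt_ext. intros x _. now rewrite E2.
    - apply (RInt_opp g). apply ex_RInt_cont; [lra|auto]. }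
  assert (I3 : Re (C_RInt (fun y => / (((x0 - L)%R, y) - (x0, y0)))%C (y0 - rho) (y0 + rho)) = - RInt h (y0 - rho) (y0 + rho)).
  { transitivity (RInt (fun x => opp (h x)) (y0 - rho) (y0 + rho)).
    - apply RInt_ext. intros x _. now rewrite E3.
    - apply (RInt_opp h). apply ex_RInt_cont; [lra|auto]. }
  assert (I4 : Re (C_RInt (fun y => / (((x0 + L)%R, y) - (x0, y0)))%C (y0 - rho) (y0 + rho)) = RInt h (y0 - rho) (y0 + rho)).
  { apply RInt_ext. intros x _. now rewrite E4. }
  revert I1 I2 I3 I4.
  generalize (C_RInt (fun x => / ((x, (y0 - rho)%R) - (x0, y0)))%C (x0 - L) (x0 + L)) as p.
  generalize (C_RInt (fun x => / ((x, (y0 + rho)%R) - (x0, y0)))%C (x0 - L) (x0 + L)) as q.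
  generalize (C_RInt (fun y => / (((x0 - L)%R, y) - (x0, y0)))%C (y0 - rho) (y0 + rho)) as r.
  generalize (C_RInt (fun y => / (((x0 + L)%R, y) - (x0, y0)))%C (y0 - rho) (y0 + rho)) as s.
  intros [s1 s2] [r1 r2] [q1 q2] [p1 p2]. simpl. intros; lra.
Qed.

Lemma Cmod_winding (x0 y0 L rho : R) : 0 < rho -> rho <= L ->
  2 <= Cmod (rect_int (fun w => / (w - (x0, y0)))%C (x0 - L) (x0 + L) (y0 - rho) (y0 + rho)).
Proof.
  intros H1 H2. eapply Rle_trans; [apply (Im_winding x0 y0 L rho H1 H2)|].
  eapply Rle_trans; [apply Rle_abs|]. eapply Rle_trans; [|apply Rmax_Cmod]. apply Rmax_r.
Qed.

(** * Derivatives of holomorphic functions *)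

(** Differentiation under the integral sign. The quadratic bound on the Taylor remainder of the
    kernel is uniform on the edges, so the plain length estimate replaces any convergence
    theorem. *)
Lemma rect_int_deriv F K K' a b c d z kappa Bd M : a <= b -> c <= d -> 0 < kappa -> 0 <= Bd -> 0 <= M ->
  (forall v, Cmod (v - z) < kappa -> cont_edges (fun w => F w * K w v)%C a b c d) ->
  cont_edges (fun w => F w * K' w z)%C a b c d ->
  (forall w, on_edges a b c d w -> Cmod (F w) <= M) ->
  (forall v w, Cmod (v - z) < kappa -> on_edges a b c d w ->
     Cmod (K w v - K w z - (v - z) * K' w z) <= Bd * (Cmod (v - z) * Cmod (v - z))) ->
  cderiv (fun v => rect_int (fun w => F w * K w v)%C a b c d) z (rect_int (fun w => F w * K' w z)%C a b c d).
Proof.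
  intros Hab Hcd Hk HB HM HK HK' HF HT eps He.
  set (P := 2 * (M * Bd) * ((b - a) + (d - c)) + 1).
  assert (HP0 : 0 <= 2 * (M * Bd) * ((b - a) + (d - c))).
  { apply Rmult_le_pos; [|lra]. assert (0 <= M * Bd) by (apply Rmult_le_pos; lra). lra. }
  assert (HP : 0 < P) by (unfold P; lra).
  assert (HeP : 0 < eps / P) by (apply Rdiv_lt_0_compat; lra).
  exists (Rmin kappa (eps / P)). split; [apply Rmin_pos; auto|].
  intros v Hv. assert (V1 := Rlt_le_trans _ _ _ Hv (Rmin_l _ _)). assert (V2 := Rlt_le_trans _ _ _ Hv (Rmin_r _ _)).
  assert (Hz : Cmod (z - z) < kappa) by (replace (z - z)%C with (RtoC 0) by ring; rewrite Cmod_0; auto).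
  assert (C1 := HK v V1). assert (C2 := HK z Hz).
  assert (C3 : cont_edges (fun w => F w * K w v - F w * K w z)%C a b c d).
  { intros w Hw. apply (continuous_minus (U := C_UniformSpace) (K := R_AbsRing) (V := C_R_NormedModule) (fun w => F w * K w v)%C (fun w => F w * K w z)%C); [apply C1|apply C2]; auto. }
  assert (C4 : cont_edges (fun w => (v - z) * (F w * K' w z))%C a b c d).
  { intros w Hw. apply (continuous_scal_r (U := C_UniformSpace) (K := C_AbsRing) (V := C_NormedModule) (v - z)%C (fun w => F w * K' w z)%C). apply HK'; auto. }
  rewrite (Cmult_comm _ (v - z)), <- rect_int_scal, <- rect_int_minus, <- rect_int_minus by auto.
  set (x := Cmod (v - z)) in *. assert (Hx : 0 <= x) by apply Cmod_ge_0.
  eapply Rle_trans; [apply (rect_int_bound _ _ _ _ _ (M * (Bd * (x * x)))); auto|].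
  - intros w Hw. apply (continuous_minus (U := C_UniformSpace) (K := R_AbsRing) (V := C_R_NormedModule) (fun w => F w * K w v - F w * K w z)%C (fun w => (v - z) * (F w * K' w z))%C); [apply C3|apply C4]; auto.
  - intros w Hw. replace (F w * K w v - F w * K w z - (v - z) * (F w * K' w z))%C
      with (F w * (K w v - K w z - (v - z) * K' w z))%C by ring.
    rewrite Cmod_mult. apply Rmult_le_compat; auto; try apply Cmod_ge_0.
  - replace (2 * (M * (Bd * (x * x))) * (b - a + (d - c))) with ((P - 1) * x * x) by (unfold P; ring).
    apply Rmult_le_compat_r; auto. apply Rle_trans with (P * x).
    + apply Rmult_le_compat_r; lra.
    + apply (Rmult_lt_compat_l P) in V2; auto. replace (P * (eps / P)) with eps in V2 by (field; lra). lra.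
Qed.

(** The remainder is exactly (v-z)^2 / ((w-v)(w-z)^2). *)
Lemma kernel1_taylor (w v z : C) kappa : 0 < kappa -> kappa <= Cmod (w - v) -> kappa <= Cmod (w - z) ->
  Cmod (/ (w - v) - / (w - z) - (v - z) * / ((w - z) * (w - z)))
   <= / (kappa * kappa * kappa) * (Cmod (v - z) * Cmod (v - z)).
Proof.
  intros Hk H1 H2.
  assert (N1 : (w - v)%C <> RtoC 0) by (apply Cmod_gt_0; lra).
  assert (N2 : (w - z)%C <> RtoC 0) by (apply Cmod_gt_0; lra).
  replace (/ (w - v) - / (w - z) - (v - z) * / ((w - z) * (w - z)))%C
    with (((v - z) * (v - z)) / ((w - v) * (w - z) * (w - z)))%C by (field; auto).
  rewrite Cmod_div by (repeat apply Cmult_neq_0; auto). rewrite !Cmod_mult. 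
  unfold Rdiv. rewrite Rmult_comm. apply Rmult_le_compat_r.
  { apply Rmult_le_pos; apply Cmod_ge_0. }
  apply Rinv_le_contravar; [repeat apply Rmult_lt_0_compat; lra|].
  repeat apply Rmult_le_compat; try lra; apply Rmult_le_pos; lra.
Qed.

(** The remainder is (v-z)^2 / ((w-v)^2 (w-z)^2) times (3(w-z) - 2(v-z))/(w-z); the last hypothesis
    bounds this quotient by 5. *)
Lemma kernel2_taylor (w v z : C) kappa : 0 < kappa -> kappa <= Cmod (w - v) -> kappa <= Cmod (w - z) ->
  Cmod (v - z) <= Cmod (w - z) ->
  Cmod (/ ((w - v) * (w - v)) - / ((w - z) * (w - z)) - (v - z) * (2 / ((w - z) * (w - z) * (w - z))))
   <= 5 * / (kappa * kappa * (kappa * kappa)) * (Cmod (v - z) * Cmod (v - z)).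
Proof.
  intros Hk H1 H2 H3.
  assert (N1 : (w - v)%C <> RtoC 0) by (apply Cmod_gt_0; lra).
  assert (N2 : (w - z)%C <> RtoC 0) by (apply Cmod_gt_0; lra).
  replace (/ ((w - v) * (w - v)) - / ((w - z) * (w - z)) - (v - z) * (2 / ((w - z) * (w - z) * (w - z))))%C
    with (((3 * (w - z) - 2 * (v - z)) / (w - z)) * / ((w - v) * (w - v) * ((w - z) * (w - z))) * ((v - z) * (v - z)))%C.
  2:{ field. auto. }
  rewrite 2!Cmod_mult, Cmod_div, Cmod_inv, !Cmod_mult by (repeat apply Cmult_neq_0; auto).
  apply Rmult_le_compat_r. { apply Rmult_le_pos; apply Cmod_ge_0. }
  apply Rmult_le_compat.
  - apply Rdiv_le_0_compat; [apply Cmod_ge_0|lra].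
  - left; apply Rinv_0_lt_compat; repeat apply Rmult_lt_0_compat; lra.
  - apply Rle_div_l; [lra|]. eapply Rle_trans; [apply Cmod_minus_triangle|].
    rewrite !Cmod_mult, !Cmod_R, !Rabs_pos_eq by lra. lra.
  - apply Rinv_le_contravar; [repeat apply Rmult_lt_0_compat; lra|].
    repeat apply Rmult_le_compat; try lra; apply Rmult_le_pos; lra.
Qed.

Section Square.
Variables (x0 y0 rho : R).
Hypothesis Hrho : 0 < rho.

Definition sq (F : C -> C) : C := rect_int F (x0 - rho) (x0 + rho) (y0 - rho) (y0 + rho).
Definition sq_edges (w : C) : Prop := on_edges (x0 - rho) (x0 + rho) (y0 - rho) (y0 + rho) w.
(** The Cauchy transform of F along the square, without the factor 1/(2 PI i), followed by its first
    and second derivatives in v. *)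
Definition Phi1 (F : C -> C) (v : C) : C := sq (fun w => F w * / (w - v))%C.
Definition Phi2 (F : C -> C) (v : C) : C := sq (fun w => F w * / ((w - v) * (w - v)))%C.
Definition Phi3 (F : C -> C) (v : C) : C := sq (fun w => F w * (2 / ((w - v) * (w - v) * (w - v))))%C.

Lemma sq_edges_dist w : sq_edges w -> rho <= Cmod (w - (x0, y0)).
Proof.
  intros Hw. eapply Rle_trans; [|apply Rmax_Cmod]. destruct w as [x y]; simpl.
  destruct Hw as [[A [B|B]]|[A [B|B]]]; simpl in *; subst.
  - eapply Rle_trans; [|apply Rmax_r]. rewrite <- Rabs_Ropp. eapply Rle_trans; [|apply Rle_abs]. lra.
  - eapply Rle_trans; [|apply Rmax_r]. eapply Rle_trans; [|apply Rle_abs]. lra.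
  - eapply Rle_trans; [|apply Rmax_l]. rewrite <- Rabs_Ropp. eapply Rle_trans; [|apply Rle_abs]. lra.
  - eapply Rle_trans; [|apply Rmax_l]. eapply Rle_trans; [|apply Rle_abs]. lra.
Qed.

Lemma sq_edges_far w v r : sq_edges w -> Cmod (v - (x0, y0)) <= r -> rho - r <= Cmod (w - v).
Proof.
  intros Hw Hv. assert (H1 := sq_edges_dist w Hw).
  assert (H2 := Cmod_triangle_rev (w - (x0, y0)) ((x0, y0) - v)).
  replace (w - (x0, y0) + ((x0, y0) - v))%C with (w - v)%C in H2 by ring.
  rewrite (Cmod_minus_comm (x0, y0) v) in H2. lra.
Qed.

Lemma near_trans v z r s : Cmod (z - (x0, y0)) <= r -> Cmod (v - z) < s -> Cmod (v - (x0, y0)) <= r + s.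
Proof.
  intros H1 H2. replace (v - (x0, y0))%C with ((v - z) + (z - (x0, y0)))%C by ring.
  eapply Rle_trans; [apply Cmod_triangle|]. lra.
Qed.

Variables (F : C -> C) (M : R).
Hypothesis HF : forall w, sq_edges w -> exists l, cderiv F w l.
Hypothesis HM : forall w, sq_edges w -> Cmod (F w) <= M.
Hypothesis HM0 : 0 <= M.

Lemma cont_kernel v K : Cmod (v - (x0, y0)) < rho ->
  (forall w, (w - v)%C <> RtoC 0 -> exists l, cderiv K w l) ->
  cont_edges (fun w => F w * K w)%C (x0 - rho) (x0 + rho) (y0 - rho) (y0 + rho).
Proof.
  intros Hv HK w Hw. destruct (HF w Hw) as [l Hl]. 
  destruct (HK w) as [m Hm].
  { apply Cmod_gt_0. generalize (sq_edges_far w v _ Hw (Rle_refl _)). lra. }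
  eapply cderiv_continuous, cderiv_mult; [apply Hl|apply Hm].
Qed.

Lemma deriv_kernel1 v w : (w - v)%C <> RtoC 0 -> exists l, cderiv (fun w => / (w - v))%C w l.
Proof. intros N. eexists. apply (cderiv_Cinv (fun w => w - v)%C); auto. apply cderiv_sub_const. Qed.

Lemma deriv_kernel2 v w : (w - v)%C <> RtoC 0 -> exists l, cderiv (fun w => / ((w - v) * (w - v)))%C w l.
Proof.
  intros N. eexists. apply (cderiv_Cinv (fun w => (w - v) * (w - v))%C); [now apply Cmult_neq_0|]. 
  apply cderiv_mult; apply cderiv_sub_const.
Qed.

Lemma deriv_kernel3 v w : (w - v)%C <> RtoC 0 -> exists l, cderiv (fun w => 2 / ((w - v) * (w - v) * (w - v)))%C w l.
Proof.
  intros N. eexists. apply cderiv_scal. 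
  apply (cderiv_Cinv (fun w => (w - v) * (w - v) * (w - v))%C); [now repeat apply Cmult_neq_0|]. 
  apply cderiv_mult; [apply cderiv_mult|]; apply cderiv_sub_const.
Qed.

Lemma Phi1_deriv z : Cmod (z - (x0, y0)) <= rho / 2 -> cderiv (Phi1 F) z (Phi2 F z).
Proof.
  (* A point v within rho/4 of z is within 3 rho/4 of the centre, so the edges stay at distance at
     least rho/4 from both v and z. *)
  intros Hz. set (k := rho / 4).
  apply (rect_int_deriv F (fun w v => / (w - v))%C (fun w v => / ((w - v) * (w - v)))%C _ _ _ _ z k (/ (k * k * k)) M); unfold k; try lra; auto.
  - left. apply Rinv_0_lt_compat. repeat apply Rmult_lt_0_compat; lra.
  - intros v Hv. apply (cont_kernel v); [|apply deriv_kernel1]. generalize (near_trans _ _ _ _ Hz Hv); lra.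
  - apply (cont_kernel z); [|apply deriv_kernel2]. lra.
  - intros v w Hv Hw. apply kernel1_taylor; try lra.
    + generalize (sq_edges_far w v _ Hw (near_trans _ _ _ _ Hz Hv)); lra.
    + generalize (sq_edges_far w z _ Hw Hz); lra.
Qed.

Lemma Phi2_deriv z : Cmod (z - (x0, y0)) <= rho / 2 -> cderiv (Phi2 F) z (Phi3 F z).
Proof.
  intros Hz. set (k := rho / 4).
  apply (rect_int_deriv F (fun w v => / ((w - v) * (w - v)))%C (fun w v => 2 / ((w - v) * (w - v) * (w - v)))%C _ _ _ _ z k (5 * / (k * k * (k * k))) M); unfold k; try lra; auto.
  - apply Rmult_le_pos; [lra|]. left. apply Rinv_0_lt_compat. repeat apply Rmult_lt_0_compat; lra.
  - intros v Hv. apply (cont_kernel v); [|apply deriv_kernel2]. generalize (near_trans _ _ _ _ Hz Hv); lra.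
  - apply (cont_kernel z); [|apply deriv_kernel3]. lra.
  - intros v w Hv Hw. assert (T := sq_edges_far w z _ Hw Hz). apply kernel2_taylor; try lra.
    generalize (sq_edges_far w v _ Hw (near_trans _ _ _ _ Hz Hv)); lra.
Qed.

Lemma Phi2_bound : Cmod (Phi2 F (x0, y0)) <= 8 * M / rho.
Proof.
  unfold Phi2, sq. replace (8 * M / rho) with (2 * (M * / (rho * rho)) * (x0 + rho - (x0 - rho) + (y0 + rho - (y0 - rho)))) by (field; lra).
  apply rect_int_bound; try lra.
  - apply (cont_kernel (x0, y0)); [|apply deriv_kernel2]. replace ((x0, y0) - (x0, y0))%C with (RtoC 0) by (symmetry; now apply -> Ceq_minus).
    now rewrite Cmod_0.
  - intros w Hw. assert (D := sq_edges_dist w Hw).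
    assert (N : (w - (x0, y0))%C <> RtoC 0) by (apply Cmod_gt_0; lra).
    rewrite Cmod_mult, Cmod_inv, Cmod_mult by now apply Cmult_neq_0.
    apply Rmult_le_compat; auto; try apply Cmod_ge_0.
    + left. apply Rinv_0_lt_compat. apply Rmult_lt_0_compat; lra.
    + apply Rinv_le_contravar; [apply Rmult_lt_0_compat; lra|]. apply Rmult_le_compat; lra.
Qed.

End Square.

Lemma cderiv_one_edges (w : C) : exists l, cderiv (fun _ => RtoC 1) w l.
Proof. eexists; apply cderiv_const. Qed.

Section SquareHolo.
Variables (x0 y0 rho M : R) (F : C -> C).
Hypothesis Hrho : 0 < rho.
Hypothesis HF : holo_rect F (x0 - rho) (x0 + rho) (y0 - rho) (y0 + rho).
Hypothesis HM : forall w, sq_edges x0 y0 rho w -> Cmod (F w) <= M.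
Hypothesis HM0 : 0 <= M.

(** The winding integral as a function of the enclosed point. Instead of being shown constant, [W]
    is treated as a differentiable function, nonzero near the centre, by which one may divide. *)
Let W := Phi1 x0 y0 rho (fun _ => RtoC 1).
Let W2 := Phi2 x0 y0 rho (fun _ => RtoC 1).
Let W3 := Phi3 x0 y0 rho (fun _ => RtoC 1).
Let P1 := Phi1 x0 y0 rho F.
Let P2 := Phi2 x0 y0 rho F.
Let P3 := Phi3 x0 y0 rho F.

Lemma sq_holo w : sq_edges x0 y0 rho w -> exists l, cderiv F w l.
Proof. intros Hw. apply HF; destruct Hw as [[A [B|B]]|[A [B|B]]]; lra. Qed.

Lemma one_bound (w : C) : sq_edges x0 y0 rho w -> Cmod 1 <= 1.
Proof. intros _. rewrite Cmod_1; lra. Qed.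

Lemma W_repr z : Cmod (z - (x0, y0)) <= rho / 2 -> P1 z = (F z * W z)%C.
Proof.
  intros Hz. assert (T := Rmax_Cmod (z - (x0, y0))%C). destruct z as [x y]; simpl in T.
  assert (Tx := Rle_trans _ _ _ (Rmax_l _ _) (Rle_trans _ _ _ T Hz)).
  assert (Ty := Rle_trans _ _ _ (Rmax_r _ _) (Rle_trans _ _ _ T Hz)).
  apply Rabs_le_between in Tx. apply Rabs_le_between in Ty.
  unfold P1, W, Phi1, sq. rewrite (rect_int_ext (fun w => RtoC 1 * / (w - (x, y)))%C (fun w => / (w - (x, y)))%C); try lra.
  - apply cauchy_formula; simpl; try lra. exact HF.
  - intros; ring.
Qed.

Lemma W_center : 2 <= Cmod (W (x0, y0)).
Proof.
  unfold W, Phi1, sq. rewrite (rect_int_ext (fun w => RtoC 1 * / (w - (x0, y0)))%C (fun w => / (w - (x0, y0)))%C); try lra.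
  - apply Cmod_winding; lra.
  - intros; ring.
Qed.

Lemma W_deriv z : Cmod (z - (x0, y0)) <= rho / 2 -> cderiv W z (W2 z).
Proof. intros Hz. apply (Phi1_deriv x0 y0 rho Hrho (fun _ => RtoC 1) 1); auto; try lra. intros; apply cderiv_one_edges. apply one_bound. Qed.

Lemma W2_deriv z : Cmod (z - (x0, y0)) <= rho / 2 -> cderiv W2 z (W3 z).
Proof. intros Hz. apply (Phi2_deriv x0 y0 rho Hrho (fun _ => RtoC 1) 1); auto; try lra. intros; apply cderiv_one_edges. apply one_bound. Qed.

Lemma P1_deriv z : Cmod (z - (x0, y0)) <= rho / 2 -> cderiv P1 z (P2 z).
Proof. intros Hz. apply (Phi1_deriv x0 y0 rho Hrho F M); auto. apply sq_holo. Qed.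

Lemma P2_deriv z : Cmod (z - (x0, y0)) <= rho / 2 -> cderiv P2 z (P3 z).
Proof. intros Hz. apply (Phi2_deriv x0 y0 rho Hrho F M); auto. apply sq_holo. Qed.

Lemma center_near : Cmod ((x0, y0) - (x0, y0)) <= 0.
Proof. replace ((x0, y0) - (x0, y0))%C with (RtoC 0) by (symmetry; now apply -> Ceq_minus). rewrite Cmod_0; lra. Qed.

(** Near the centre F = P1/W, and numerator and denominator are Cauchy transforms, which can be
    differentiated twice; the quotient rule gives [D] and then its derivative. *)
Lemma square_derivative : exists (r : R) (D : C -> C), 0 < r /\
  (forall v, Cmod (v - (x0, y0)) < r -> cderiv F v (D v)) /\ exists l, cderiv D (x0, y0) l.
Proof.
  assert (C0 := center_near).
  destruct (cderiv_lipschitz _ _ _ (W_deriv (x0, y0) ltac:(lra))) as [del [Hdel HL]].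
  set (K := Cmod (W2 (x0, y0)) + 1) in *. assert (HK : 0 < K) by (unfold K; generalize (Cmod_ge_0 (W2 (x0, y0))); lra).
  (* Within this radius [W] moves by at most K r <= 1, while its modulus at the centre is at least
     2; so [W] does not vanish. *)
  set (r := Rmin (Rmin del (/ K)) (rho / 4)).
  assert (Hr : 0 < r) by (unfold r; repeat apply Rmin_pos; try lra; apply Rinv_0_lt_compat; auto).
  assert (R1 : r <= rho / 4) by apply Rmin_r.
  assert (R2 : r <= del) by (eapply Rle_trans; [apply Rmin_l|apply Rmin_l]).
  assert (R3 : r <= / K) by (eapply Rle_trans; [apply Rmin_l|apply Rmin_r]).
  assert (WN : forall v, Cmod (v - (x0, y0)) < r -> W v <> RtoC 0).
  { intros v Hv. specialize (HL v ltac:(lra)). apply Cmod_gt_0.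
    assert (T := Cmod_triangle_rev (W (x0, y0)) (W v - W (x0, y0))).
    replace (W (x0, y0) + (W v - W (x0, y0)))%C with (W v) in T by ring.
    assert (W0 := W_center).
    assert (K * Cmod (v - (x0, y0)) <= K * / K) by (apply Rmult_le_compat_l; lra).
    rewrite Rinv_r in H by lra. lra. }
  exists r, (fun v => (P2 v * W v - P1 v * W2 v) / (W v * W v))%C. split; [auto|split].
  - intros v Hv. apply (cderiv_ext_loc (fun v => P1 v / W v)%C _ _ _ (r - Cmod (v - (x0, y0)))); [lra| |].
    + intros u Hu. assert (Hu' : Cmod (u - (x0, y0)) < r).
      { replace (u - (x0, y0))%C with ((u - v) + (v - (x0, y0)))%C by ring. eapply Rle_lt_trans; [apply Cmod_triangle|]. lra. }
      rewrite W_repr by lra. field. auto.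
    + apply cderiv_div; [auto|apply P1_deriv; lra|apply W_deriv; lra].
  - assert (W0 := WN (x0, y0) ltac:(lra)).
    assert (E1 := P1_deriv (x0, y0) ltac:(lra)). assert (E2 := P2_deriv (x0, y0) ltac:(lra)).
    assert (E3 := W_deriv (x0, y0) ltac:(lra)). assert (E4 := W2_deriv (x0, y0) ltac:(lra)).
    eexists. apply (cderiv_div (fun v => P2 v * W v - P1 v * W2 v)%C (fun v => W v * W v)%C).
    + now apply Cmult_neq_0.
    + apply cderiv_minus; apply cderiv_mult; [exact E2|exact E3|exact E1|exact E4].
    + apply cderiv_mult; exact E3.
Qed.

(** Differentiating P1 = F W gives l W = P2 - F W2. Both terms on the right are at most 8M/rho, and
    |W| >= 2 at the centre absorbs the doubling. *)
Lemma square_estimate l : Cmod (F (x0, y0)) <= M -> cderiv F (x0, y0) l -> Cmod l <= 8 * M / rho.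
Proof.
  intros HFM Hl. assert (C0 := center_near).
  assert (E : (l * W (x0, y0) + F (x0, y0) * W2 (x0, y0) = P2 (x0, y0))%C).
  { apply (cderiv_unique P1 (x0, y0)); [|apply P1_deriv; lra].
    apply (cderiv_ext_loc (fun v => F v * W v)%C _ _ _ (rho / 2)); [lra| |].
    - intros v Hv. symmetry. apply W_repr. lra.
    - apply cderiv_mult; auto. apply W_deriv. lra. }
  assert (B1 : Cmod (P2 (x0, y0)) <= 8 * M / rho) by (apply Phi2_bound; auto; apply sq_holo).
  assert (B2 : Cmod (W2 (x0, y0)) <= 8 * 1 / rho).
  { apply Phi2_bound; try exact one_bound; try lra. intros; apply cderiv_one_edges. }
  assert (T : Cmod (l * W (x0, y0)) <= 8 * M / rho + M * (8 * 1 / rho)).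
  { replace (l * W (x0, y0))%C with (P2 (x0, y0) - F (x0, y0) * W2 (x0, y0))%C by (rewrite <- E; ring).
    eapply Rle_trans; [apply Cmod_minus_triangle|]. rewrite Cmod_mult.
    apply Rplus_le_compat; auto. apply Rmult_le_compat; auto; apply Cmod_ge_0. }
  rewrite Cmod_mult in T. assert (W0 := W_center).
  assert (Cmod l * 2 <= Cmod l * Cmod (W (x0, y0))) by (apply Rmult_le_compat_l; [apply Cmod_ge_0|auto]).
  replace (8 * M / rho + M * (8 * 1 / rho)) with (2 * (8 * M / rho)) in T by (field; lra). lra.
Qed.
End SquareHolo.

(** * Holomorphic functions on the surface of the logarithm *)

(** The square has to carry a bound for F. It comes from the Lipschitz property at the single point
    w0, on a square small enough to stay inside that neighbourhood. *)
Lemma derivative_holomorphic F (w0 : C) R0 : 0 < R0 ->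
  (forall w, Cmod (w - w0) < R0 -> exists l, cderiv F w l) ->
  exists (r : R) (D : C -> C), 0 < r /\
  (forall v, Cmod (v - w0) < r -> cderiv F v (D v)) /\ exists l, cderiv D w0 l.
Proof.
  intros HR HF. destruct (HF w0) as [l Hl]. { replace (w0 - w0)%C with (RtoC 0) by ring. now rewrite Cmod_0. }
  destruct (cderiv_lipschitz _ _ _ Hl) as [del [Hdel HL]].
  set (rho := Rmin del R0 / 4). assert (0 < Rmin del R0) by (apply Rmin_pos; auto).
  assert (R1 := Rmin_l del R0). assert (R2 := Rmin_r del R0).
  assert (N : forall w : C, Re w0 - rho <= Re w <= Re w0 + rho -> Im w0 - rho <= Im w <= Im w0 + rho -> Cmod (w - w0) <= 2 * rho).
  { intros w A1 A2. replace (w - w0)%C with ((Re w - Re w0, Im w - Im w0) : C) by (destruct w, w0; reflexivity).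
    eapply Rle_trans; [apply Cmod_le_abs|].
    assert (Rabs (Re w - Re w0) <= rho) by (apply Rabs_le; lra).
    assert (Rabs (Im w - Im w0) <= rho) by (apply Rabs_le; lra). lra. }
  replace w0 with ((Re w0, Im w0) : C) by (destruct w0; reflexivity).
  apply (square_derivative (Re w0) (Im w0) rho (Cmod (F w0) + (Cmod l + 1) * del)).
  - unfold rho; lra.
  - intros w A1 A2. apply HF. specialize (N w A1 A2). unfold rho in N; lra.
  - intros w Hw. assert (T : Cmod (w - w0) < del).
    { assert (Cmod (w - w0) <= 2 * rho) by (apply N; destruct Hw as [[A [B|B]]|[A [B|B]]]; lra). unfold rho in *; lra. }
    specialize (HL w T). assert (U := Cmod_triangle (F w0) (F w - F w0)).
    replace (F w0 + (F w - F w0))%C with (F w) in U by ring.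
    assert ((Cmod l + 1) * Cmod (w - w0) <= (Cmod l + 1) * del) by (apply Rmult_le_compat_l; generalize (Cmod_ge_0 l); lra). lra.
  - assert (0 <= (Cmod l + 1) * del) by (apply Rmult_le_pos; generalize (Cmod_ge_0 l); lra). generalize (Cmod_ge_0 (F w0)); lra.
Qed.

Definition lexp (w : C) : LogPoint := (exp (fst w), snd w).
Definition llog (z : LogPoint) : C := (ln (fst z), snd z).

Lemma proj_lexp w : proj (lexp w) = cexp w.
Proof. reflexivity. Qed.

Lemma lexp_llog z : on_surface z -> lexp (llog z) = z.
Proof. destruct z as [r t]. intros H. unfold lexp, llog; simpl. now rewrite exp_ln. Qed.

Lemma llog_lexp w : llog (lexp w) = w.
Proof. destruct w as [r t]. unfold lexp, llog; simpl. now rewrite ln_exp. Qed.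

Lemma on_surface_lexp w : on_surface (lexp w).
Proof. apply exp_pos. Qed.

Lemma is_log_derive_spec f z l : is_log_derive f z l <->
  forall eps, 0 < eps -> exists del, 0 < del /\ forall v : LogPoint,
    Rabs (fst v - fst z) < del -> Rabs (snd v - snd z) < del -> v <> z ->
    Cmod ((f v - f z) / (proj v - proj z) - l) < eps.
Proof.
  split.
  - intros H eps He. 
    assert (H2 : 0 < sqrt 2) by (apply sqrt_lt_R0; lra).
    assert (He2 : 0 < eps / sqrt 2) by now apply Rdiv_lt_0_compat.
    destruct (H (ball (l : C_UniformSpace) (mkposreal _ He2)) (locally_ball (l : C_UniformSpace) _)) as [d Hd].
    exists d. split; [apply cond_pos|]. intros v A1 A2 N.
    assert (B : ball (l : C_UniformSpace) (mkposreal _ He2) ((f v - f z) / (proj v - proj z))%C).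
    { apply Hd; [split; assumption|assumption]. }
    apply (C_NormedModule_mixin_compat2 l _ (mkposreal _ He2)) in B. simpl in B.
    replace (sqrt 2 * (eps / sqrt 2)) with eps in B by (field; lra). exact B.
  - intros H P [eps HP]. destruct (H eps (cond_pos eps)) as [d [Hd Hv]].
    exists (mkposreal d Hd). intros v [A1 A2] N. apply HP.
    apply C_NormedModule_mixin_compat1. apply Hv; auto.
Qed.

(** Quantitative local injectivity, from the nonvanishing derivative: it keeps the denominator of
    the difference quotient on the surface away from 0 and comparable with w - w0. *)
Lemma cexp_local_inverse (w0 : C) : exists del, 0 < del /\ forall w, Cmod (w - w0) < del ->
  Cmod (cexp w0) / 2 * Cmod (w - w0) <= Cmod (cexp w - cexp w0).
Proof.
  assert (P : 0 < Cmod (cexp w0)) by (apply Cmod_gt_0, cexp_neq_0).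
  destruct (cderiv_cexp w0 (Cmod (cexp w0) / 2)) as [d [Hd Hv]]; [lra|].
  exists d. split; auto. intros w Hw. specialize (Hv w Hw).
  assert (T := Cmod_triangle_rev (cexp w0 * (w - w0)) (cexp w - cexp w0 - cexp w0 * (w - w0))).
  replace (cexp w0 * (w - w0) + (cexp w - cexp w0 - cexp w0 * (w - w0)))%C with (cexp w - cexp w0)%C in T by ring.
  rewrite Cmod_mult in T. lra.
Qed.

Lemma continuity_pt_eps (f : R -> R) x : continuity_pt f x -> forall eps, 0 < eps -> exists del, 0 < del /\
  forall u, Rabs (u - x) < del -> Rabs (f u - f x) < eps.
Proof.
  intros H eps He. destruct (proj1 (continuity_pt_locally f x) H (mkposreal _ He)) as [d Hd].
  exists d. split; [apply cond_pos|]. intros u Hu. apply Hd. exact Hu.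
Qed.

(** The chain rule for z = exp w, whence the factor [proj z]. Together with its converse
    [cderiv_log_derive] it moves holomorphy between the surface and the plane. *)
Lemma log_derive_cderiv f z l : on_surface z -> is_log_derive f z l ->
  cderiv (fun w => f (lexp w)) (llog z) (l * proj z)%C.
Proof.
  intros Hz H. rewrite is_log_derive_spec in H. set (w0 := llog z).
  assert (Ez : lexp w0 = z) by now apply lexp_llog. intros eps He.
  assert (Ep : proj z = cexp w0) by (rewrite <- Ez; reflexivity).
  destruct (cexp_local_inverse w0) as [d1 [Hd1 H1]].
  set (K := Cmod (cexp w0) + 1). set (L := Cmod l + 1).
  assert (P : 0 < Cmod (cexp w0)) by (apply Cmod_gt_0, cexp_neq_0).
  assert (PL : 0 < L) by (unfold L; generalize (Cmod_ge_0 l); lra).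
  assert (PK : 0 < K) by (unfold K; lra).
  destruct (cderiv_lipschitz _ _ _ (cderiv_cexp w0)) as [d2 [Hd2 H2]]. fold K in H2.
  destruct (cderiv_cexp w0 (eps / 2 / L)) as [d3 [Hd3 H3]]; [repeat apply Rdiv_lt_0_compat; lra|].
  destruct (H (eps / 2 / K)) as [d4 [Hd4 H4]]; [repeat apply Rdiv_lt_0_compat; lra|].
  destruct (continuity_pt_eps exp (fst w0) (derivable_continuous_pt _ _ (derivable_pt_exp (fst w0))) d4 Hd4) as [d5 [Hd5 H5]].
  exists (Rmin (Rmin (Rmin d1 d2) (Rmin d3 d4)) d5). split; [repeat apply Rmin_pos; auto|].
  intros v Hvd.
  assert (A1 := Rlt_le_trans _ _ _ Hvd (Rmin_l _ _)). assert (B5 := Rlt_le_trans _ _ _ Hvd (Rmin_r _ _)).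
  assert (A2 := Rlt_le_trans _ _ _ A1 (Rmin_l _ _)). assert (A3 := Rlt_le_trans _ _ _ A1 (Rmin_r _ _)).
  assert (B1 := Rlt_le_trans _ _ _ A2 (Rmin_l _ _)). assert (B2 := Rlt_le_trans _ _ _ A2 (Rmin_r _ _)).
  assert (B3 := Rlt_le_trans _ _ _ A3 (Rmin_l _ _)). assert (B4 := Rlt_le_trans _ _ _ A3 (Rmin_r _ _)).
  rewrite Ez, Ep.
  set (x := Cmod (v - w0)) in *. assert (Hx : 0 <= x) by apply Cmod_ge_0.
  destruct (Req_dec x 0) as [E|N].
  { apply Cmod_eq_0 in E. apply Ceq_minus in E. rewrite E, Ez.
    replace (f z - f z - l * cexp w0 * (w0 - w0))%C with (RtoC 0) by ring. rewrite Cmod_0.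
    apply Rmult_le_pos; lra. }
  assert (Nv : v <> w0). { intros E; apply N. unfold x. rewrite E. replace (w0 - w0)%C with (RtoC 0) by ring. apply Cmod_0. }
  specialize (H1 v B1). fold x in H1.
  assert (Ne : (cexp v - cexp w0)%C <> RtoC 0).
  { apply Cmod_gt_0. eapply Rlt_le_trans; [|apply H1]. apply Rmult_lt_0_compat; lra. }
  assert (Rm := Rmax_Cmod (v - w0)%C). fold x in Rm.
  specialize (H4 (lexp v)). rewrite Ep in H4. change (proj (lexp v)) with (cexp v) in H4.
  lapply H4; [clear H4; intros H4|].
  2:{ rewrite <- Ez. simpl. apply H5. eapply Rle_lt_trans; [|apply B5]. eapply Rle_trans; [|apply Rm]. apply Rmax_l. }
  lapply H4; [clear H4; intros H4|].
  2:{ rewrite <- Ez. simpl. eapply Rle_lt_trans; [|apply B4]. eapply Rle_trans; [|apply Rm]. apply Rmax_r. }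
  lapply H4; [clear H4; intros H4|].
  2:{ intros E. apply Nv. rewrite <- (llog_lexp v), E. reflexivity. }
  specialize (H2 v B2). specialize (H3 v B3). fold x in H2, H3.
  replace (f (lexp v) - f z - l * cexp w0 * (v - w0))%C with
    (((f (lexp v) - f z) / (cexp v - cexp w0) - l) * (cexp v - cexp w0)
     + l * (cexp v - cexp w0 - cexp w0 * (v - w0)))%C by (field; auto).
  eapply Rle_trans; [apply Cmod_triangle|]. rewrite !Cmod_mult.
  assert (E1 : Cmod ((f (lexp v) - f z) / (cexp v - cexp w0) - l) * Cmod (cexp v - cexp w0) <= eps / 2 / K * (K * x)).
  { apply Rmult_le_compat; try apply Cmod_ge_0; lra. }
  replace (eps / 2 / K * (K * x)) with (eps / 2 * x) in E1 by (field; lra).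
  assert (E2 : Cmod l * Cmod (cexp v - cexp w0 - cexp w0 * (v - w0)) <= L * (eps / 2 / L * x)).
  { apply Rmult_le_compat; try apply Cmod_ge_0; unfold L; try lra. exact H3. }
  replace (L * (eps / 2 / L * x)) with (eps / 2 * x) in E2 by (field; lra). lra.
Qed.

Lemma cderiv_log_derive f z l : on_surface z -> cderiv (fun w => f (lexp w)) (llog z) (l * proj z)%C ->
  is_log_derive f z l.
Proof.
  intros Hz H. apply is_log_derive_spec. set (w0 := llog z) in *.
  assert (Ez : lexp w0 = z) by now apply lexp_llog. intros eps He.
  assert (Ep : proj z = cexp w0) by (rewrite <- Ez; reflexivity). rewrite Ep in *.
  destruct (cexp_local_inverse w0) as [d1 [Hd1 H1]].
  set (c := Cmod (cexp w0)) in *. set (L := Cmod l + 2).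
  assert (P : 0 < c) by (apply Cmod_gt_0, cexp_neq_0).
  assert (PL : 0 < L) by (unfold L; generalize (Cmod_ge_0 l); lra).
  (* The numerator will be at most (|l| + 1) e |w - w0|; taking L = |l| + 2 makes the final
     inequality strict. *)
  set (e := eps * c / 2 / L). assert (Pe : 0 < e).
  { unfold e. repeat apply Rdiv_lt_0_compat; try lra. apply Rmult_lt_0_compat; lra. }
  destruct (H e Pe) as [d2 [Hd2 H2]].
  destruct (cderiv_cexp w0 e Pe) as [d3 [Hd3 H3]].
  set (D := Rmin d1 (Rmin d2 d3)). assert (HD : 0 < D) by (unfold D; repeat apply Rmin_pos; auto).
  assert (D1 : D <= d1) by apply Rmin_l. assert (D2 : D <= d2) by (eapply Rle_trans; [apply Rmin_r|apply Rmin_l]).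
  assert (D3 : D <= d3) by (eapply Rle_trans; [apply Rmin_r|apply Rmin_r]).
  destruct (continuity_pt_eps ln (fst z) (derivable_continuous_pt _ _ (exist _ _ (derivable_pt_lim_ln (fst z) Hz))) (D / 2) ltac:(lra)) as [d5 [Hd5 H5]].
  exists (Rmin (Rmin d5 (D / 2)) (fst z)). split; [repeat apply Rmin_pos; auto; lra|].
  intros v V1 V2 Nv.
  assert (A1 := Rlt_le_trans _ _ _ V1 (Rmin_l _ _)). assert (A2 := Rlt_le_trans _ _ _ V1 (Rmin_r _ _)).
  assert (A3 := Rlt_le_trans _ _ _ V2 (Rmin_l _ _)).
  assert (B1 := Rlt_le_trans _ _ _ A1 (Rmin_l _ _)). assert (B2 := Rlt_le_trans _ _ _ A3 (Rmin_r _ _)).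
  assert (Sv : on_surface v). { unfold on_surface, modulus. apply Rabs_def2 in A2. lra. }
  set (w := llog v). assert (Ev : lexp w = v) by now apply lexp_llog.
  assert (Hw : Cmod (w - w0) < D).
  { replace (w - w0)%C with ((ln (fst v) - ln (fst z), snd v - snd z) : C) by reflexivity.
    eapply Rle_lt_trans; [apply Cmod_le_abs|]. specialize (H5 _ B1). lra. }
  assert (Nw : w <> w0). { intros E. apply Nv. rewrite <- Ev, E. exact Ez. }
  assert (Nx : 0 < Cmod (w - w0)). { apply Cmod_gt_0. intros E. apply Nw. now apply Ceq_minus. }
  specialize (H1 w ltac:(lra)). specialize (H2 w ltac:(lra)). specialize (H3 w ltac:(lra)).
  rewrite Ev, Ez in H2. 
  assert (Ew : proj v = cexp w) by (rewrite <- Ev; reflexivity). rewrite Ew.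
  assert (Px : 0 < c / 2 * Cmod (w - w0)) by (apply Rmult_lt_0_compat; lra).
  assert (Ne : (cexp w - cexp w0)%C <> RtoC 0) by (apply Cmod_gt_0; lra).
  replace ((f v - f z) / (cexp w - cexp w0) - l)%C with
    (((f v - f z - l * cexp w0 * (w - w0)) - l * (cexp w - cexp w0 - cexp w0 * (w - w0))) / (cexp w - cexp w0))%C by (field; auto).
  rewrite Cmod_div by auto. apply Rlt_div_l; [lra|].
  eapply Rle_lt_trans; [apply Cmod_minus_triangle|]. rewrite Cmod_mult.
  assert (E2 : Cmod l * Cmod (cexp w - cexp w0 - cexp w0 * (w - w0)) <= Cmod l * (e * Cmod (w - w0))).
  { apply Rmult_le_compat_l; [apply Cmod_ge_0|auto]. }
  assert (E3 : eps * (c / 2 * Cmod (w - w0)) = L * e * Cmod (w - w0)) by (unfold e; field; lra).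
  assert (E4 : eps * (c / 2 * Cmod (w - w0)) <= eps * Cmod (cexp w - cexp w0)) by (apply Rmult_le_compat_l; lra).
  assert (0 < e * Cmod (w - w0)) by (apply Rmult_lt_0_compat; lra).
  unfold L in E3. lra.
Qed.

Lemma exp_monotone x y : x <= y -> exp x <= exp y.
Proof. intros [H| ->]; [left; now apply exp_increasing|lra]. Qed.

Lemma sector_lexp gamma w : sector gamma (lexp w) <-> Rabs (Im w) < gamma * PI / 2.
Proof. unfold sector. split; [now intros [_ H]|]. intros H; split; [apply on_surface_lexp|exact H]. Qed.

Lemma sector_near gamma w0 : Rabs (Im w0) < gamma * PI / 2 -> exists r, 0 < r /\
  forall w, Cmod (w - w0) < r -> sector gamma (lexp w).
Proof.
  intros H. exists (gamma * PI / 2 - Rabs (Im w0)). split; [lra|]. intros w Hw. apply sector_lexp.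
  assert (T := Rmax_Cmod (w - w0)%C). assert (T2 := Rle_trans _ _ _ (Rmax_r _ _) T).
  change (Rabs (Im w - Im w0) <= Cmod (w - w0)) in T2.
  replace (Im w) with ((Im w - Im w0) + Im w0) by ring. eapply Rle_lt_trans; [apply Rabs_triang|]. lra.
Qed.

Lemma holomorphic_cderiv gamma f w : holomorphic (sector gamma) f -> sector gamma (lexp w) ->
  exists l, cderiv (fun v => f (lexp v)) w l.
Proof.
  intros Hf Hw. destruct (Hf _ Hw) as [l Hl]. exists (l * proj (lexp w))%C.
  rewrite <- (llog_lexp w) at 1. apply log_derive_cderiv; auto. apply on_surface_lexp.
Qed.

(** A choice of derivative at each point, with an arbitrary value where none exists; this makes it a
    total function that can be iterated. *)
Definition log_deriv (f : LogPoint -> C) (z : LogPoint) : C :=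
  epsilon (inhabits (RtoC 0)) (is_log_derive f z).

Lemma log_deriv_spec gamma f z : holomorphic (sector gamma) f -> sector gamma z ->
  is_log_derive f z (log_deriv f z).
Proof. intros Hf Hz. exact (epsilon_spec (inhabits (RtoC 0)) _ (Hf z Hz)). Qed.

Lemma log_deriv_cderiv gamma f w : holomorphic (sector gamma) f -> sector gamma (lexp w) ->
  cderiv (fun v => f (lexp v)) w (log_deriv f (lexp w) * cexp w)%C.
Proof.
  intros Hf Hw. rewrite <- (llog_lexp w) at 1. rewrite <- proj_lexp.
  apply log_derive_cderiv; [apply on_surface_lexp|]. eapply log_deriv_spec; eauto.
Qed.

(** In the coordinate w the function v -> f(exp v) has derivative f'(exp v) exp v. This is again
    differentiable by [derivative_holomorphic], and dividing by exp v recovers f'. *)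
Lemma log_deriv_holomorphic gamma f : holomorphic (sector gamma) f -> holomorphic (sector gamma) (log_deriv f).
Proof.
  intros Hf z Hz. set (w0 := llog z). assert (Ez : lexp w0 = z) by (apply lexp_llog, Hz).
  destruct (sector_near gamma w0) as [R0 [HR0 Hs]]; [apply Hz|].
  destruct (derivative_holomorphic (fun v => f (lexp v)) w0 R0 HR0) as [r [D [Hr [HD [l Hl]]]]].
  { intros w Hw. eapply holomorphic_cderiv; eauto. }
  assert (HL : exists m, cderiv (fun v => log_deriv f (lexp v)) w0 m).
  { eexists. apply (cderiv_ext_loc (fun v => D v / cexp v)%C _ _ _ (Rmin r R0)); [apply Rmin_pos; auto| |].
    - intros v Hv. assert (V1 := Rlt_le_trans _ _ _ Hv (Rmin_l _ _)). assert (V2 := Rlt_le_trans _ _ _ Hv (Rmin_r _ _)).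
      rewrite (cderiv_unique _ _ _ _ (HD v V1) (log_deriv_cderiv gamma f v Hf (Hs v V2))). field. apply cexp_neq_0.
    - apply cderiv_div; [apply cexp_neq_0|apply Hl|apply cderiv_cexp]. }
  destruct HL as [m Hm]. exists (m / proj z)%C. apply cderiv_log_derive; [apply Hz|].
  fold w0. eapply cderiv_eq; [|apply Hm]. assert (proj z <> RtoC 0) by (rewrite <- Ez, proj_lexp; apply cexp_neq_0). field; auto.
Qed.

(** * Iterated Cauchy estimates: from the uniform class to the class with bounded derivatives *)

Fixpoint log_deriv_n (n : nat) (f : LogPoint -> C) : LogPoint -> C :=
  match n with O => f | S m => log_deriv (log_deriv_n m f) end.

Lemma log_deriv_n_holomorphic gamma f n : holomorphic (sector gamma) f -> holomorphic (sector gamma) (log_deriv_n n f).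
Proof. intros Hf. induction n; simpl; auto. now apply log_deriv_holomorphic. Qed.

(** Coefficients of the formal derivative of the series. *)
Definition dshift (a : nat -> C) (j : nat) : C := (INR (S j) * a (S j))%C.

Fixpoint dshift_n (n : nat) (a : nat -> C) : nat -> C :=
  match n with O => a | S m => dshift (dshift_n m a) end.

Lemma partial_sum_deriv a p z : cderiv (partial_sum a (S p)) z (partial_sum (dshift a) p z).
Proof.
  induction p as [|p IH].
  - apply (cderiv_ext (fun _ => a 0%nat)). { intros; simpl; ring. } apply cderiv_const.
  - apply (cderiv_ext (fun v => partial_sum a (S p) v + a (S p) * v ^ S p)%C). { reflexivity. }
    eapply cderiv_eq; [|apply cderiv_plus; [apply IH|apply cderiv_scal, cderiv_pow, cderiv_id]].
    cbn [partial_sum]. unfold dshift. ring.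
Qed.

(** n^n/n! is a single term of the exponential series at n. This converts the n^n produced by n
    Cauchy estimates into n!. *)
Lemma pow_n_fact n : INR n ^ n <= exp (INR n) * INR (fact n).
Proof.
  assert (F : 0 < INR (fact n)) by apply INR_fact_lt_0.
  apply Rle_div_l; auto.
  eapply Rle_trans; [|apply (exp_ge_taylor (INR n) n), pos_INR].
  assert (N : forall m, 0 <= INR n ^ m / INR (fact m)).
  { intros m. apply Rdiv_le_0_compat; [apply pow_le, pos_INR|apply INR_fact_lt_0]. }
  set (u := fun m => INR n ^ m / INR (fact m)).
  assert (G : forall m, u m <= sum_f_R0 u m).
  { intros [|m]; simpl; [lra|]. assert (0 <= sum_f_R0 u m) by (apply cond_pos_sum; apply N). lra. }
  apply (G n).
Qed.

(** The hypothesis says that [G (S j)] is the z-derivative of [G j] for z = exp w. Each of the n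
    differentiations uses squares of half-side 1/n, so after j of them a square of half-side 1 - j/n
    is left. Each costs 8n for Cauchy's estimate and exp(-Re w) <= exp(1 - Re w0) for the change of
    variable. *)
Lemma iterated_estimate (G : nat -> C -> C) (w0 : C) n B : 0 <= B -> (0 < n)%nat ->
  (forall j w, (j < n)%nat -> Re w0 - 1 <= Re w <= Re w0 + 1 -> Im w0 - 1 <= Im w <= Im w0 + 1 ->
     cderiv (G j) w (G (S j) w * cexp w)) ->
  (forall w, Re w0 - 1 <= Re w <= Re w0 + 1 -> Im w0 - 1 <= Im w <= Im w0 + 1 -> Cmod (G O w) <= B) ->
  Cmod (G n w0) <= (8 * INR n * exp (1 - Re w0)) ^ n * B.
Proof.
  intros HB Hn HG HG0. set (Q := 8 * INR n * exp (1 - Re w0)).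
  assert (Pn : 0 < INR n) by (apply lt_0_INR; auto).
  assert (HQ : 0 < Q) by (unfold Q; repeat apply Rmult_lt_0_compat; try lra; apply exp_pos).
  assert (Key : forall j, (j <= n)%nat -> forall w, 
    Re w0 - (1 - INR j / INR n) <= Re w <= Re w0 + (1 - INR j / INR n) ->
    Im w0 - (1 - INR j / INR n) <= Im w <= Im w0 + (1 - INR j / INR n) -> Cmod (G j w) <= Q ^ j * B).
  { induction j as [|j IH]; intros Hj w Hx Hy.
    - simpl INR in *. rewrite Rdiv_0_l in *. simpl. rewrite Rmult_1_l. apply HG0; lra.
    - assert (E : INR (S j) / INR n = INR j / INR n + / INR n) by (rewrite S_INR; field; lra).
      rewrite E in *. assert (Pin : 0 < / INR n) by now apply Rinv_0_lt_compat.
      assert (Pj : 0 <= INR j / INR n) by (apply Rdiv_le_0_compat; auto; apply pos_INR).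
      assert (Hw : cderiv (G j) (Re w, Im w) (G (S j) w * cexp w)%C).
      { replace ((Re w, Im w) : C) with w by (destruct w; reflexivity). apply HG; try lia; lra. }
      assert (T := square_estimate (Re w) (Im w) (/ INR n) (Q ^ j * B) (G j) Pin).
      specialize (T ltac:(intros v V1 V2; eexists; apply HG; [lia|lra|lra])).
      specialize (T ltac:(intros v Hv; apply IH; [lia| |]; destruct Hv as [[? [?|?]]|[? [?|?]]]; lra)).
      specialize (T ltac:(apply Rmult_le_pos; auto; apply pow_le; lra) (G (S j) w * cexp w)%C).
      specialize (T ltac:(apply IH; [lia| |]; simpl; lra) Hw).
      rewrite Cmod_mult, Cmod_cexp in T.
      replace (8 * (Q ^ j * B) / / INR n) with (8 * INR n * (Q ^ j * B)) in T by (field; lra).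
      assert (Pe : 0 < exp (Re w)) by apply exp_pos.
      apply (Rmult_le_reg_r (exp (Re w))); auto. eapply Rle_trans; [apply T|].
      simpl pow.
      assert (E1 : 1 <= exp (1 - Re w0) * exp (Re w)).
      { rewrite <- exp_plus. rewrite <- exp_0 at 1. apply exp_monotone. lra. }
      replace (Q * Q ^ j * B * exp (Re w)) with (8 * INR n * (Q ^ j * B) * (exp (1 - Re w0) * exp (Re w))) by (unfold Q at 2; ring).
      rewrite <- (Rmult_1_r (8 * INR n * (Q ^ j * B))) at 1. apply Rmult_le_compat_l; auto.
      repeat apply Rmult_le_pos; try lra. apply pow_le; lra. }
  assert (E0 : 1 - INR n / INR n = 0) by (field; lra).
  apply Key; auto; rewrite E0; lra.
Qed.

(** In the coordinate w the neighbourhood is a square of half-side 1, whatever z is. Widening the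
    opening by 1 adds PI/2 > 1 to the half-angle, which leaves room for that square. *)
Lemma Atu_A_class M gamma f : (forall p, 0 < M p) -> Atu M (gamma + 1) f -> A_class M gamma f.
Proof.
  intros HM [Hf [a [K [A [HK [HA HE]]]]]].
  assert (Hsub : forall z, sector gamma z -> sector (gamma + 1) z).
  { intros z [H1 H2]. split; auto. generalize PI2_1; lra. }
  split; [intros z Hz; apply Hf, Hsub, Hz|].
  exists (fun n => log_deriv_n n f). split.
  { split; [reflexivity|]. intros n z Hz. simpl. apply (log_deriv_spec (gamma + 1)).
    - now apply log_deriv_n_holomorphic.
    - now apply Hsub. }
  (* 8 is the constant of Cauchy's estimate. The three factors exp 1 come from |z| growing by at
     most e on the square, from the change of variable, and from n^n <= e^n n!. *)
  exists (8 * exp 1 * exp 1 * exp 1 * A), K.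
  assert (Pe := exp_pos 1).
  assert (PA : 0 < 8 * exp 1 * exp 1 * exp 1 * A) by (repeat apply Rmult_lt_0_compat; lra).
  split; [exact PA|]. intros z n Hz.
  assert (PD : 0 < (8 * exp 1 * exp 1 * exp 1 * A) ^ n * INR (fact n) * M n).
  { repeat apply Rmult_lt_0_compat; auto. now apply pow_lt. apply INR_fact_lt_0. }
  apply Rle_div_l; auto.
  set (w0 := llog z). assert (Ez : lexp w0 = z) by (apply lexp_llog, Hz).
  assert (Hw0 : Rabs (Im w0) < gamma * PI / 2) by apply Hz.
  assert (Hsq : forall w, Im w0 - 1 <= Im w <= Im w0 + 1 -> sector (gamma + 1) (lexp w)).
  { intros w Hw. apply sector_lexp. replace (Im w) with ((Im w - Im w0) + Im w0) by ring.
    eapply Rle_lt_trans; [apply Rabs_triang|]. assert (Rabs (Im w - Im w0) <= 1) by (apply Rabs_le; lra). generalize PI2_1; lra. }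
  destruct n as [|n].
  { simpl. assert (T := HE z 0%nat (Hsub _ Hz)). simpl in T. replace (f z - 0)%C with (f z) in T by ring. lra. }
  set (N := S n) in *.
  (* The j-th derivative of f minus its N-th partial sum. Each differentiation removes one term, so
     the polynomial is empty at j = N and only the N-th derivative of f remains. *)
  set (G := fun j w => (log_deriv_n j f (lexp w) - partial_sum (dshift_n j a) (N - j) (cexp w))%C).
  assert (T := iterated_estimate G w0 N (K * A ^ N * M N * (exp 1 * exp (Re w0)) ^ N)).
  assert (P1 : 0 <= K * A ^ N * M N).
  { left. apply Rmult_lt_0_compat; [apply Rmult_lt_0_compat; [auto|now apply pow_lt]|apply HM]. }
  lapply T; [clear T; intros T|apply Rmult_le_pos; [exact P1|]; apply pow_le, Rmult_le_pos; left; apply exp_pos].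
  lapply T; [clear T; intros T|unfold N; lia].
  lapply T; [clear T; intros T|].
  2:{ intros j w Hj _ Hw. unfold G. 
      eapply cderiv_eq; [|apply cderiv_minus; [apply (log_deriv_cderiv (gamma + 1)); [now apply log_deriv_n_holomorphic|now apply Hsq]|]].
      2:{ replace (N - j)%nat with (S (N - S j)) by lia. apply (cderiv_comp (partial_sum (dshift_n j a) (S (N - S j))) cexp).
          - apply partial_sum_deriv. - apply cderiv_cexp. }
      cbn [log_deriv_n dshift_n]. ring. }
  lapply T; [clear T; intros T|].
  2:{ intros w Hx Hw. unfold G. cbn [log_deriv_n dshift_n]. rewrite Nat.sub_0_r.
      assert (U := HE (lexp w) N (Hsq w Hw)). rewrite proj_lexp in U. eapply Rle_trans; [apply U|].
      apply Rmult_le_compat_l.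
      - exact P1.
      - apply pow_incr. split; [left; apply exp_pos|]. unfold modulus; simpl. rewrite <- exp_plus. apply exp_monotone. change (Re w <= 1 + Re w0). lra. }
  unfold G in T. rewrite Nat.sub_diag in T. cbn [partial_sum] in T. rewrite Ez in T.
  match type of T with Cmod ?x <= _ => replace x with (log_deriv_n N f z) in T by ring end.
  eapply Rle_trans; [apply T|].
  replace ((8 * INR N * exp (1 - Re w0)) ^ N * (K * A ^ N * M N * (exp 1 * exp (Re w0)) ^ N))
   with (K * M N * (INR N ^ N * (8 * exp 1 * exp 1 * A) ^ N)).
  2:{ transitivity (K * M N * ((8 * INR N * exp (1 - Re w0)) * A * (exp 1 * exp (Re w0))) ^ N).
      - f_equal. rewrite <- Rpow_mult_distr. f_equal. unfold Rminus. rewrite exp_plus, exp_Ropp.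
        field. apply Rgt_not_eq, exp_pos.
      - rewrite !Rpow_mult_distr. ring. }
  assert (F := pow_n_fact N).
  replace (exp (INR N)) with (exp 1 ^ N) in F by (rewrite <- (Rmult_1_r (INR N)), <- Rpower_pow by apply exp_pos; unfold Rpower; now rewrite ln_exp).
  replace (K * ((8 * exp 1 * exp 1 * exp 1 * A) ^ N * INR (fact N) * M N))
    with (K * M N * (exp 1 ^ N * INR (fact N) * (8 * exp 1 * exp 1 * A) ^ N)) by (rewrite !Rpow_mult_distr; ring).
  apply Rmult_le_compat_l; [apply Rmult_le_pos; [lra|left; apply HM]|].
  apply Rmult_le_compat_r; auto. apply pow_le. repeat apply Rmult_le_pos; lra.
Qed.

(** * Uniform bounds from surjectivity *)

Lemma partial_sum_ext a b p z : (forall j, (j < p)%nat -> a j = b j) -> partial_sum a p z = partial_sum b p z.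
Proof. induction p as [|p IH]; intros H; simpl; auto. rewrite IH, H; auto. Qed.

Lemma partial_sum_minus a b p z : partial_sum (fun j => a j - b j)%C p z = (partial_sum a p z - partial_sum b p z)%C.
Proof. induction p as [|p IH]; simpl; [|rewrite IH]; ring. Qed.

Lemma partial_sum_zero p z : partial_sum (fun _ => RtoC 0) p z = 0.
Proof. induction p as [|p IH]; simpl; [|rewrite IH]; ring. Qed.

(** By strong induction: when all earlier coefficients vanish, the partial sum with q+1 terms is c_q
    x^q, which is O(x^(q+1)) only if c_q = 0. *)
Lemma coef_zero (c : nat -> C) :
  (forall p, exists K, 0 <= K /\ forall x, 0 < x < 1 -> Cmod (partial_sum c p (RtoC x)) <= K * x ^ p) ->
  forall q, c q = 0.
Proof.
  intros H q. induction q as [q IH] using (well_founded_induction Wf_nat.lt_wf).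
  destruct (H (S q)) as [K [HK HB]]. apply Cmod_eq_0.
  destruct (Req_dec (Cmod (c q)) 0) as [|N]; auto. exfalso.
  assert (P : 0 < Cmod (c q)) by (generalize (Cmod_ge_0 (c q)); lra).
  set (x := Rmin 1 (Cmod (c q) / (K + 1)) / 2).
  assert (Px : 0 < Rmin 1 (Cmod (c q) / (K + 1))) by (apply Rmin_pos; [lra|apply Rdiv_lt_0_compat; lra]).
  assert (X1 := Rmin_l 1 (Cmod (c q) / (K + 1))). assert (X2 := Rmin_r 1 (Cmod (c q) / (K + 1))).
  assert (Hx : 0 < x < 1) by (unfold x; lra). specialize (HB x Hx).
  cbn [partial_sum] in HB. rewrite (partial_sum_ext c (fun _ => RtoC 0)), partial_sum_zero in HB by (intros; apply IH; auto).
  replace (0 + c q * RtoC x ^ q)%C with (c q * RtoC x ^ q)%C in HB by ring.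
  rewrite Cmod_mult, Cmod_pow, Cmod_R, Rabs_pos_eq in HB by lra.
  assert (Pq : 0 < x ^ q) by (apply pow_lt; lra). simpl in HB.
  assert (B2 : Cmod (c q) <= K * x). { apply (Rmult_le_reg_r (x ^ q)); auto. lra. }
  assert (B3 : (K + 1) * x <= Cmod (c q) / 2).
  { replace (Cmod (c q) / 2) with ((K + 1) * (Cmod (c q) / (K + 1) / 2)) by (field; lra).
    apply Rmult_le_compat_l; unfold x; lra. }
  lra.
Qed.

Lemma half_subsector alpha : 0 < alpha -> proper_subsector (bounded_sector 0 (alpha / 2) 1) alpha.
Proof.
  intros Ha. assert (HP := PI_RGT_0). split.
  - exists 0, (alpha / 2), 1. split; [lra|]. split; [lra|]. reflexivity.
  - intros z [Hz Hc]. split; auto. apply Rnot_le_lt. intros Hle. apply Hc.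
    assert (Hap := Rmult_lt_0_compat _ _ Ha HP). assert (Hd : 0 < alpha * PI / 4) by lra.
    exists (mkposreal _ Hd). intros [w1 w2] [_ Hw] [_ [Hw2 _]].
    change (Rabs (w2 - snd z) < alpha * PI / 4) in Hw. unfold arg in *. simpl snd in Hw2.
    assert (T := Rabs_triang (w2 - 0) (- (w2 - snd z))). rewrite Rabs_Ropp in T.
    replace (w2 - 0 + - (w2 - snd z)) with (snd z) in T by ring. lra.
Qed.

(** Membership in [Atu] yields uniform bounds for some sequence a', while surjectivity prescribes a
    only through proper subsectors. Comparing both on the interval (0,1) of the positive axis
    transfers the uniform bounds to the prescribed a. *)
Lemma expansion_unique M alpha f a a' : 0 < alpha -> (forall p, 0 < M p) ->
  expansion_bound M (sector alpha) f a' -> asymptotic_expansion M alpha f a -> forall j, a j = a' j.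
Proof.
  intros Ha HM [K' [A' [HK' [HA' H']]]] H.
  destruct (H _ (half_subsector alpha Ha)) as [K [A [HK [HA HE]]]]. 
  intros j. apply Ceq_minus. revert j. apply (coef_zero (fun j => a j - a' j)%C).
  intros p. exists (K' * A' ^ p * M p + K * A ^ p * M p). split.
  { assert (0 < A ^ p) by now apply pow_lt. assert (0 < A' ^ p) by now apply pow_lt.
    specialize (HM p). apply Rplus_le_le_0_compat; repeat apply Rmult_le_pos; lra. }
  intros x Hx. set (z := (x, 0) : LogPoint).
  assert (Ez : proj z = RtoC x).
  { unfold proj, z, modulus, arg; simpl. rewrite cos_0, sin_0. unfold RtoC. f_equal; ring. }
  assert (HP := PI_RGT_0). assert (Hp : 0 < alpha * PI) by now apply Rmult_lt_0_compat.
  assert (E1 := H' z p). lapply E1; [clear E1; intros E1|split; [apply Hx|unfold z, arg; simpl; rewrite Rabs_R0; lra]].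
  assert (E2 := HE z p). lapply E2; [clear E2; intros E2|].
  2:{ split; [apply Hx|]. split; [unfold z, arg; simpl|unfold z; simpl; lra]. rewrite Rminus_0_r, Rabs_R0. lra. }
  rewrite Ez in *. change (modulus z) with x in *. rewrite partial_sum_minus.
  replace (partial_sum a p x - partial_sum a' p x)%C with ((f z - partial_sum a' p x) - (f z - partial_sum a p x))%C by ring.
  eapply Rle_trans; [apply Cmod_minus_triangle|]. lra.
Qed.

(** * From surjectivity to one constant for all truncated monomials *)

Section Uniform.
Variables (M : nat -> R) (alpha : R).
Hypotheses (Halpha : 0 < alpha) (HM : forall p, 0 < M p).

(** A single integer serves as both constants K and A of [expansion_bound], so the uniform class
    becomes a countable increasing union of balls, over which the gliding hump runs. *)
Definition in_ball (n : nat) (f : LogPoint -> C) (a : nat -> C) : Prop :=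
  holomorphic (sector alpha) f /\
  forall z p, sector alpha z ->
    Cmod (f z - partial_sum a p (proj z)) <= INR n * INR n ^ p * M p * modulus z ^ p.

Definition unit_coef (p j : nat) : C := if Nat.eqb j p then RtoC (M p) else RtoC 0.

Lemma in_ball_ext n f a b : (forall j, a j = b j) -> in_ball n f a -> in_ball n f b.
Proof.
  intros E [H1 H2]. split; auto. intros z p Hz. rewrite <- (partial_sum_ext a b); auto.
Qed.

Lemma in_ball_combine n m f g a b (s : C) : Cmod s = 1 -> in_ball n f a -> in_ball m g b ->
  in_ball (n + m) (fun z => f z + s * g z)%C (fun j => a j + s * b j)%C.
Proof.
  intros Hs [F1 F2] [G1 G2]. split.
  - intros z Hz. destruct (F1 z Hz) as [l Hl]. destruct (G1 z Hz) as [l' Hl'].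
    exists (l + s * l')%C. unfold is_log_derive in *.
    apply (filterlim_ext (fun w => plus ((f w - f z) / (proj w - proj z))%C (scal s ((g w - g z) / (proj w - proj z))%C))).
    { intros w. unfold plus, scal; simpl. unfold mult; simpl. unfold Cdiv. ring. }
    eapply filterlim_comp_2; [apply Hl|eapply filterlim_comp; [apply Hl'|]|].
    + apply (filterlim_scal_r (V := C_NormedModule) s l').
    + apply (filterlim_plus (V := C_NormedModule) l (scal s l')).
  - intros z p Hz. specialize (F2 z p Hz). specialize (G2 z p Hz).
    replace (partial_sum (fun j => a j + s * b j)%C p (proj z)) with
      (partial_sum a p (proj z) + s * partial_sum b p (proj z))%C.
    2:{ clear. induction p as [|p IH]; simpl; [|rewrite <- IH]; ring. }
    replace (f z + s * g z - (partial_sum a p (proj z) + s * partial_sum b p (proj z)))%C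
      with ((f z - partial_sum a p (proj z)) + s * (g z - partial_sum b p (proj z)))%C by ring.
    eapply Rle_trans; [apply Cmod_triangle|]. rewrite Cmod_mult, Hs, Rmult_1_l.
    assert (X : 0 <= M p * modulus z ^ p).
    { apply Rmult_le_pos; [left; apply HM|apply pow_le; left; apply Hz]. }
    assert (Nn := pos_INR n). assert (Nm := pos_INR m). rewrite plus_INR.
    assert (A1 : INR n ^ p <= (INR n + INR m) ^ p) by (apply pow_incr; lra).
    assert (A2 : INR m ^ p <= (INR n + INR m) ^ p) by (apply pow_incr; lra).
    assert (B1 : INR n * INR n ^ p <= INR n * (INR n + INR m) ^ p) by (apply Rmult_le_compat_l; auto).
    assert (B2 : INR m * INR m ^ p <= INR m * (INR n + INR m) ^ p) by (apply Rmult_le_compat_l; auto).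
    assert (D1 := Rmult_le_compat_r _ _ _ X B1). assert (D2 := Rmult_le_compat_r _ _ _ X B2).
    lra.
Qed.

Lemma in_ball_mono n m f a : (n <= m)%nat -> in_ball n f a -> in_ball m f a.
Proof.
  intros Hnm [H1 H2]. split; auto. intros z p Hz. eapply Rle_trans; [apply H2; auto|].
  apply le_INR in Hnm. assert (N := pos_INR n).
  apply Rmult_le_compat_r; [apply pow_le; left; apply Hz|]. apply Rmult_le_compat_r; [left; apply HM|].
  apply Rmult_le_compat; auto. apply pow_le; auto. apply pow_incr; auto.
Qed.

Lemma in_ball_zero : in_ball 0 (fun _ => RtoC 0) (fun _ => RtoC 0).
Proof.
  split.
  - intros z Hz. exists (RtoC 0). unfold is_log_derive.
    apply (filterlim_ext (fun _ => RtoC 0)); [intros; unfold Cdiv; ring|]. apply filterlim_const.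
  - intros z p Hz. rewrite partial_sum_zero. replace (0 - 0)%C with (RtoC 0) by ring. rewrite Cmod_0.
    simpl. right. ring.
Qed.

Hypothesis Hsurj : Borel_surjective Atu M alpha.

Lemma surjective_in_ball a : formal_class M a -> exists n f, in_ball n f a.
Proof.
  intros Ha. destruct (Hsurj a Ha) as [f [[Hf [a' Ha']] Has]].
  assert (E := expansion_unique M alpha f a a' Halpha HM Ha' Has).
  destruct Ha' as [K [A [HK [HA H]]]].
  destruct (INR_unbounded (Rmax K A)) as [n Hn]. exists n, f. split; auto.
  assert (K1 := Rmax_l K A). assert (A1 := Rmax_r K A).
  intros z p Hz. rewrite (partial_sum_ext a a') by auto. eapply Rle_trans; [apply H; auto|].
  apply Rmult_le_compat_r; [apply pow_le; left; apply Hz|]. apply Rmult_le_compat_r; [left; apply HM|].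
  apply Rmult_le_compat; try lra. apply pow_le; lra. apply pow_incr; lra.
Qed.

Lemma indicator_formal (a : nat -> C) : (forall j, a j = RtoC 0 \/ a j = RtoC (M j)) -> formal_class M a.
Proof.
  intros Ha. exists 1, 1. split; [lra|]. intros p. rewrite pow1, Rmult_1_l. specialize (HM p).
  apply Rle_div_l; auto. destruct (Ha p) as [-> | ->]; [rewrite Cmod_0; lra|].
  rewrite Cmod_R, Rabs_pos_eq; lra.
Qed.

(* Gliding hump on lacunary 0/1 sequences: if the bounds were not uniform, a sequence
   with one entry [M p_k] for each [k], the gaps growing fast enough, would have no preimage. *)
Lemma uniform_monomials : exists n, forall p N, exists f a, in_ball n f a /\
  forall j, (j < N)%nat -> a j = unit_coef p j.
Proof.
  apply NNPP. intros Hno.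
  assert (H1 : forall n, exists pN : nat * nat, forall f a, in_ball n f a ->
     ~ (forall j, (j < snd pN)%nat -> a j = unit_coef (fst pN) j)).
  { intros n. apply NNPP. intros Hn. apply Hno. exists n. intros p N. apply NNPP. intros Hf. apply Hn.
    exists (p, N). simpl. intros f a Hb He. apply Hf. exists f, a. auto. }
  apply choice in H1. destruct H1 as [PN HPN].
  assert (H2 : forall p, exists n, exists f, in_ball n f (unit_coef p)).
  { intros p. apply surjective_in_ball, indicator_formal. intros j. unfold unit_coef.
    destruct (Nat.eqb_spec j p); subst; auto. }
  apply choice in H2. destruct H2 as [L HL].
  (* [Lam T] adds up the radii [L p] of preimages of the single monomials with p < T, hence is a
     sufficient radius for any selection of these monomials. *)
  set (Lam := fix Lam (T : nat) : nat := match T with O => O | S q => (Lam q + L q)%nat end).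
  assert (HLam : forall p T, (p < T)%nat -> (L p <= Lam T)%nat).
  { intros p T. induction T as [|T IH]; intros HT; [lia|]. simpl.
    destruct (Nat.eq_dec p T); [subst; lia|]. specialize (IH ltac:(lia)). lia. }
  (* [t k] is the cut before the k-th hump. The hump is the monomial that ball number k +
     [Lam (t k)] fails to reach; the next cut lies beyond both its exponent and the order at which
     the failure shows. *)
  set (t := fix t (k : nat) : nat := match k with O => O 
     | S q => let n := (q + Lam (t q))%nat in Nat.max (snd (PN n)) (S (fst (PN n))) end).
  set (n_ := fun k => (k + Lam (t k))%nat). set (p_ := fun k => fst (PN (n_ k))).
  assert (Ht : forall k, t (S k) = Nat.max (snd (PN (n_ k))) (S (p_ k))) by reflexivity.
  (* A monomial with exponent below [t k] has a preimage of radius at most [Lam (t k)], so it cannot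
     be the one missed by ball number [n_ k]. *)
  assert (Hp : forall k, (t k <= p_ k)%nat).
  { intros k. destruct (Nat.le_gt_cases (t k) (p_ k)) as [|Hlt]; auto. exfalso.
    destruct (HL (p_ k)) as [f Hf]. apply (HPN (n_ k) f (unit_coef (p_ k))); [|reflexivity].
    apply (in_ball_mono (L (p_ k))); auto. specialize (HLam _ _ Hlt). unfold n_. lia. }
  assert (Htm : forall k m, (k <= m)%nat -> (t k <= t m)%nat).
  { intros k m Hkm. induction Hkm as [|m Hkm IH]; auto. rewrite Ht. specialize (Hp m). lia. }
  set (a := fun j => if excluded_middle_informative (exists k, p_ k = j) then RtoC (M j) else RtoC 0).
  assert (Ha : formal_class M a).
  { apply indicator_formal. intros j. unfold a. destruct excluded_middle_informative; auto. }
  assert (Hcut : forall T, exists g, in_ball (Lam T) g (fun j => if Nat.ltb j T then a j else RtoC 0)).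
  { induction T as [|T [g Hg]].
    - exists (fun _ => RtoC 0). apply (in_ball_ext 0 _ (fun _ => RtoC 0)); [reflexivity|apply in_ball_zero].
    - simpl Lam. unfold a. destruct (excluded_middle_informative (exists k, p_ k = T)) as [HT|HT].
      + destruct (HL T) as [h Hh]. exists (fun z => g z + 1 * h z)%C.
        eapply in_ball_ext; [|apply in_ball_combine; [apply Cmod_1|apply Hg|apply Hh]].
        intros j. cbv beta. fold a. unfold unit_coef. destruct (Nat.eqb_spec j T) as [->|Nj].
        * rewrite Nat.ltb_irrefl. replace (Nat.ltb T (S T)) with true by (symmetry; apply Nat.ltb_lt; lia).
          destruct excluded_middle_informative; [ring|tauto].
        * destruct (Nat.ltb_spec j T), (Nat.ltb_spec j (S T)); try lia; fold (a j); ring.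
      + exists g. apply (in_ball_mono (Lam T)); [lia|]. eapply in_ball_ext; [|apply Hg].
        intros j. cbv beta. destruct (Nat.eq_dec j T) as [->|Nj].
        * rewrite Nat.ltb_irrefl. destruct excluded_middle_informative; [tauto|]. now destruct Nat.ltb.
        * destruct (Nat.ltb_spec j T), (Nat.ltb_spec j (S T)); try lia; auto. }
  (* The radius m of this preimage is also used as the index of a hump. Subtracting a preimage of
     the entries below [t m] gives radius m + [Lam (t m)] = [n_ m], and up to the critical order
     only the m-th hump is left: a contradiction. *)
  destruct (surjective_in_ball a Ha) as [m [f Hf]].
  destruct (Hcut (t m)) as [g Hg].
  assert (Hs : Cmod (- (1)) = 1) by apply Cmod_m1.
  apply (HPN (n_ m) _ _ (in_ball_combine _ _ _ _ _ _ _ Hs Hf Hg)).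
  intros j Hj. fold (p_ m).
  assert (Hj2 : (j < t (S m))%nat) by (rewrite Ht; lia).
  specialize (Hp m) as Hpm. unfold unit_coef.
  destruct (Nat.ltb_spec j (t m)) as [Hlt|Hge].
  - destruct (Nat.eqb_spec j (p_ m)); [lia|]. ring.
  - replace (a j + - (1) * 0)%C with (a j) by ring. unfold a.
    destruct (Nat.eqb_spec j (p_ m)) as [E|E]; destruct excluded_middle_informative as [[k Hk]|Hk]; auto.
    + now rewrite E.
    + exfalso; apply Hk; exists m; auto.
    + exfalso. destruct (Nat.lt_trichotomy k m) as [Hkm|[Hkm|Hkm]]; [|subst; tauto|].
      * assert (p_ k < t m)%nat; [|lia]. eapply Nat.lt_le_trans; [|apply (Htm (S k) m); lia]. rewrite Ht. lia.
      * assert (t (S m) <= p_ k)%nat; [|lia]. etransitivity; [apply (Htm (S m) k); lia|apply Hp].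
Qed.
End Uniform.

(** * The contour estimate *)

Lemma RInt_cauchy_le_PI u0 L : 0 <= L -> 
  ex_RInt (fun x => / (1 + (x - u0) * (x - u0))) (u0 - L) (u0 + L) /\
  RInt (fun x => / (1 + (x - u0) * (x - u0))) (u0 - L) (u0 + L) <= PI.
Proof.
  intros HL. assert (P : forall x, 0 < 1 + (x - u0) * (x - u0)).
  { intros x. generalize (Rle_0_sqr (x - u0)); unfold Rsqr; lra. }
  assert (H : is_RInt (fun x => / (1 + (x - u0) * (x - u0))) (u0 - L) (u0 + L)
     (minus (atan (u0 + L - u0)) (atan (u0 - L - u0)))).
  { apply (is_RInt_derive (V := R_CompleteNormedModule) (fun x => atan (x - u0)) (fun x => / (1 + (x - u0) * (x - u0)))).
    - intros x _. auto_derive; auto. unfold Rsqr. field. generalize (P x); lra.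
    - intros x _. apply (ex_derive_continuous (fun x => / (1 + (x - u0) * (x - u0)))). auto_derive. generalize (P x); unfold Rminus; lra. }
  split; [eexists; exact H|]. rewrite (is_RInt_unique _ _ _ _ H).
  unfold minus, plus, opp; simpl. generalize (atan_bound (u0 + L - u0)), (atan_bound (u0 - L - u0)); lra.
Qed.

Lemma Cmod_gauss (x y : R) : Cmod (cexp (- (((x, y) : C) * (x, y)))) = exp (y * y - x * x).
Proof. rewrite Cmod_cexp. f_equal. simpl. ring. Qed.

(** Comparison with 1/(1+x^2), whose integral is at most PI by the arctangent, bounds the horizontal
    sides independently of the length of the rectangle. *)
Lemma gauss_le (x y theta : R) : Rabs y <= theta -> exp (y * y - x * x) <= exp (theta * theta) * / (1 + x * x).
Proof.
  intros Hy. unfold Rminus. rewrite exp_plus, exp_Ropp.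
  assert (P : 0 < 1 + x * x) by (generalize (Rle_0_sqr x); unfold Rsqr; lra).
  apply Rmult_le_compat; try (left; apply exp_pos).
  - left. apply Rinv_0_lt_compat, exp_pos.
  - apply exp_monotone. apply Rsqr_le_abs_1. rewrite (Rabs_pos_eq theta); auto.
    eapply Rle_trans; [apply Rabs_pos|apply Hy].
  - apply Rinv_le_contravar; auto. apply exp_ineq1_le.
Qed.

(* A Phragmen-Lindelof bound, up to a constant: Cauchy's formula on long rectangles, with a Gaussian weight. *)
Lemma strip_estimate G u0 theta Bh Bv : 0 < theta -> 0 <= Bh -> 0 <= Bv ->
  (forall w, - theta <= Im w <= theta -> exists l, cderiv G w l) ->
  (forall w, - theta <= Im w <= theta -> Cmod (G w) <= Bv) ->
  (forall w, Im w = theta \/ Im w = - theta -> Cmod (G w) <= Bh) ->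
  Cmod (G (u0, 0)) <= exp (theta * theta) * PI / theta * Bh.
Proof.
  intros Hth HBh HBv Hhol Hv Hh. set (w0 := (u0, 0) : C).
  (* The weight equals 1 at w0, so Q and G agree there, and it decays along the strip. *)
  set (Q := fun w => (G w * cexp (- ((w - w0) * (w - w0))))%C).
  set (e := exp (theta * theta)). assert (Pe : 0 < e) by apply exp_pos.
  assert (HQ : forall w, - theta <= Im w <= theta -> exists l, cderiv Q w l).
  { intros w Hw. destruct (Hhol w Hw) as [l Hl]. eexists. apply cderiv_mult; [apply Hl|].
    apply cderiv_Cexp, cderiv_opp, cderiv_mult; apply cderiv_sub_const. }
  assert (Qw : forall x y, Rabs y <= theta -> Cmod (Q (x, y)) <= Cmod (G (x, y)) * (e * / (1 + (x - u0) * (x - u0)))).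
  { intros x y Hy. unfold Q. rewrite Cmod_mult. apply Rmult_le_compat_l; [apply Cmod_ge_0|].
    replace (((x, y) : C) - w0)%C with ((x - u0, y) : C) by (unfold w0, Cminus, Cplus, Copp; simpl; f_equal; ring).
    rewrite Cmod_gauss. now apply gauss_le. }
  assert (Key : forall L, theta <= L -> 1 <= L -> 
     2 * Cmod (G w0) <= 2 * (e * PI / theta * Bh) + 4 * theta * e * Bv * / L).
  { intros L HL1 HL2.
    assert (HR : holo_rect Q (u0 - L) (u0 + L) (0 - theta) (0 + theta)).
    { intros w _ Hw. apply HQ; lra. }
    assert (CF := cauchy_formula Q (u0 - L) (u0 + L) (0 - theta) (0 + theta) w0 ltac:(simpl; lra) ltac:(simpl; lra) HR).
    assert (Q0 : Q w0 = G w0).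
    { unfold Q. replace (- ((w0 - w0) * (w0 - w0)))%C with (RtoC 0) by ring. rewrite cexp_0. ring. }
    rewrite Q0 in CF.
    assert (W := Cmod_winding u0 0 L theta Hth HL1). fold w0 in W.
    apply Rle_trans with (Cmod (G w0 * rect_int (fun w => / (w - w0))%C (u0 - L) (u0 + L) (0 - theta) (0 + theta))).
    { rewrite Cmod_mult, Rmult_comm. apply Rmult_le_compat_l; [apply Cmod_ge_0|auto]. }
    rewrite <- CF. clear CF W.
    assert (CE : cont_edges (fun w => Q w / (w - w0))%C (u0 - L) (u0 + L) (0 - theta) (0 + theta)).
    { intros w Hw. assert (N : (w - w0)%C <> RtoC 0) by (eapply neq_off_edges; [| |apply Hw]; simpl; lra).
      destruct (HQ w) as [l Hl]. { destruct Hw as [[A [B|B]]|[A [B|B]]]; lra. }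
      destruct (cderiv_quot Q w0 w l) as [l' Hl']; auto. { intros ->. apply N. ring. }
      eapply cderiv_continuous, Hl'. }
    apply ex_edges in CE; [|lra|lra]. destruct CE as [E1 [E2 [E3 E4]]].
    destruct (RInt_cauchy_le_PI u0 L ltac:(lra)) as [J1 J2].
    set (g := fun x => / (1 + (x - u0) * (x - u0))) in *.
    assert (Pg : forall x, 0 < 1 + (x - u0) * (x - u0)). { intros x. generalize (Rle_0_sqr (x - u0)); unfold Rsqr; lra. }
    assert (Hor : forall y, y = theta \/ y = - theta ->
       ex_C_RInt (fun x => Q (x, y) / ((x, y) - w0))%C (u0 - L) (u0 + L) ->
       Cmod (C_RInt (fun x => Q (x, y) / ((x, y) - w0))%C (u0 - L) (u0 + L)) <= e * PI / theta * Bh).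
    { intros y Hy Ex.
      assert (Ay : Rabs y = theta) by (destruct Hy as [-> | ->]; [|rewrite Rabs_Ropp]; apply Rabs_pos_eq; lra).
      eapply Rle_trans; [apply (C_RInt_bound _ (fun x => scal (e * Bh / theta) (g x))); auto; try lra|].
      - apply (ex_RInt_scal (V := R_NormedModule)); auto.
      - intros x _. unfold scal; simpl; unfold mult; simpl.
        assert (D : theta <= Cmod ((x, y) - w0)).
        { eapply Rle_trans; [|apply Rmax_Cmod]. eapply Rle_trans; [|apply Rmax_r]. simpl. 
          rewrite Ropp_0, Rplus_0_r, Ay. lra. }
        assert (N : ((x, y) - w0)%C <> RtoC 0) by (apply Cmod_gt_0; lra).
        rewrite Cmod_div by auto. unfold Rdiv.
        replace (e * Bh * / theta * g x) with ((Bh * (e * g x)) * / theta) by ring.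
        apply Rmult_le_compat; [apply Cmod_ge_0|left; apply Rinv_0_lt_compat; lra| |apply Rinv_le_contravar; auto].
        eapply Rle_trans; [apply Qw; lra|]. apply Rmult_le_compat_r; [|apply Hh; simpl; tauto].
        apply Rmult_le_pos; [lra|left; apply Rinv_0_lt_compat, Pg].
      - rewrite (RInt_scal (V := R_CompleteNormedModule)) by auto. unfold scal; simpl; unfold mult; simpl.
        replace (e * PI / theta * Bh) with (e * Bh / theta * PI) by (field; lra).
        apply Rmult_le_compat_l; auto. apply Rdiv_le_0_compat; auto. apply Rmult_le_pos; lra. }
    assert (Ver : forall x, x = u0 + L \/ x = u0 - L ->
       ex_C_RInt (fun y => Q (x, y) / ((x, y) - w0))%C (0 - theta) (0 + theta) ->
       Cmod (C_RInt (fun y => Q (x, y) / ((x, y) - w0))%C (0 - theta) (0 + theta)) <= 2 * theta * e * Bv * / L).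
    { intros x Hx Ex.
      assert (Ax : Rabs (x - u0) = L) by (destruct Hx as [-> | ->]; [replace (u0 + L - u0) with L by ring|replace (u0 - L - u0) with (- L) by ring; rewrite Rabs_Ropp]; apply Rabs_pos_eq; lra).
      eapply Rle_trans; [apply (C_RInt_bound_const _ (e * Bv * / L)); auto; try lra|].
      - intros y Hy.
        assert (D : L <= Cmod ((x, y) - w0)).
        { eapply Rle_trans; [|apply Rmax_Cmod]. eapply Rle_trans; [|apply Rmax_l]. simpl. 
          change (x + - u0) with (x - u0). rewrite Ax. lra. }
        assert (N : ((x, y) - w0)%C <> RtoC 0) by (apply Cmod_gt_0; lra).
        rewrite Cmod_div by auto. unfold Rdiv.
        apply Rmult_le_compat; [apply Cmod_ge_0|left; apply Rinv_0_lt_compat; lra| |apply Rinv_le_contravar; lra].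
        eapply Rle_trans; [apply Qw; apply Rabs_le; lra|].
        rewrite (Rmult_comm e Bv). apply Rmult_le_compat; [apply Cmod_ge_0| |apply Hv; simpl; lra|].
        + apply Rmult_le_pos; [lra|left; apply Rinv_0_lt_compat, Pg].
        + rewrite <- (Rmult_1_r e) at 2. apply Rmult_le_compat_l; [lra|].
          rewrite <- Rinv_1. apply Rinv_le_contravar; [lra|]. generalize (Rle_0_sqr (x - u0)); unfold Rsqr; lra.
      - right; ring. }
    unfold rect_int. eapply Rle_trans; [apply Cmod_edges_sum|].
    assert (T1 := Hor (0 - theta) ltac:(right; ring) E1). assert (T2 := Hor (0 + theta) ltac:(left; ring) E2).
    assert (T3 := Ver (u0 - L) ltac:(right; ring) E3). assert (T4 := Ver (u0 + L) ltac:(left; ring) E4). lra. }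
  apply Rnot_lt_le. intros Hlt.
  set (X := e * PI / theta * Bh) in *. set (Y := 4 * theta * e * Bv) in *.
  assert (HY : 0 <= Y) by (unfold Y; repeat apply Rmult_le_pos; lra).
  set (d := Cmod (G w0) - X). assert (Hd : 0 < d) by (unfold d; lra).
  (* With d the supposed excess, [Key] gives 2d <= Y/L, whereas this length makes Y/L <= d. *)
  set (L := Rmax (Rmax theta 1) (Y / d)).
  assert (L1 : theta <= L) by (eapply Rle_trans; [apply Rmax_l|apply Rmax_l]).
  assert (L2 : 1 <= L) by (eapply Rle_trans; [apply Rmax_r|apply Rmax_l]).
  assert (L3 : Y / d <= L) by apply Rmax_r.
  specialize (Key L L1 L2). apply Rle_div_l in L3; auto.
  assert (Y * / L <= d). { apply Rle_div_l; lra. }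
  unfold d in *. lra.
Qed.

(** On the imaginary axis Re phi(iy) = (3 - y^2) / (2 (1+y^2)^2), negative for |y| >= 2; this is why
    [phi_bound_far] starts at modulus 2. Nearby rays only add an error proportional to s. *)
Definition phi (z : C) : C := (/ (1 + z) * / (1 + z) + RtoC (/ 2) * / (1 + z))%C.

Lemma one_plus_ne (z : C) : 0 <= Re z -> (1 + z)%C <> RtoC 0.
Proof. intros H E. apply (f_equal Re) in E. simpl in E. unfold Re in H. lra. Qed.

Lemma phi_bound (z : C) : 0 <= Re z -> Re (phi z) <= 3 / 2.
Proof.
  intros H. assert (N := one_plus_ne z H).
  assert (B : 1 <= Cmod (1 + z)).
  { eapply Rle_trans; [|apply re_le_Cmod]. simpl. unfold Re in H. rewrite Rabs_pos_eq; lra. }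
  assert (I : Cmod (/ (1 + z)) <= 1). { rewrite Cmod_inv by auto. apply (Rle_trans _ (/ 1)); [apply Rinv_le_contravar; lra|rewrite Rinv_1; lra]. }
  assert (I0 := Cmod_ge_0 (/ (1 + z))).
  eapply Rle_trans; [apply Rle_abs|]. eapply Rle_trans; [apply re_le_Cmod|]. unfold phi.
  eapply Rle_trans; [apply Cmod_triangle|]. rewrite !Cmod_mult, Cmod_R, Rabs_pos_eq by lra.
  assert (Cmod (/ (1 + z)) * Cmod (/ (1 + z)) <= 1 * 1) by (apply Rmult_le_compat; lra). lra.
Qed.

Lemma Re_phi a b : 0 <= a ->
  Re (phi (a, b)) = ((1 + a) * (1 + a) - b * b) / (((1 + a) * (1 + a) + b * b) * ((1 + a) * (1 + a) + b * b))
    + / 2 * ((1 + a) / ((1 + a) * (1 + a) + b * b)).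
Proof.
  intros H. assert (0 < (1 + a) * (1 + a)) by (apply Rmult_lt_0_compat; lra).
  assert (0 <= b * b) by apply Rle_0_sqr.
  unfold phi. replace (1 + (a, b))%C with ((1 + a, b) : C) by (unfold Cplus; simpl; f_equal; ring).
  rewrite Re_inv_kernel by lra. simpl. field. lra.
Qed.

(* The point has modulus [y] and lies on a ray [arg z = +-(PI/2 - eta)] with [s = sin eta]. *)
Lemma phi_bound_far s y b : 0 <= s <= 1 -> 2 <= y -> (y * s) * (y * s) + b * b = y * y -> Re (phi (y * s, b)) <= 10 * s.
Proof.
  intros Hs Hy E. set (a := y * s) in *. assert (Ha : 0 <= a) by (apply Rmult_le_pos; lra).
  rewrite Re_phi by auto. set (D := (1 + a) * (1 + a) + b * b).
  assert (ED : D = 1 + 2 * a + y * y) by (unfold D; rewrite <- E; ring).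
  assert (Hyy : 2 * y <= y * y) by (apply Rmult_le_compat_r; lra).
  assert (HD : 4 <= D) by lra.
  replace (((1 + a) * (1 + a) - b * b) / (D * D) + / 2 * ((1 + a) / D))
   with (((1 + a) * (1 + a) - b * b + / 2 * (1 + a) * D) / (D * D)) by (field; lra).
  assert (PD : 0 < D * D) by (apply Rmult_lt_0_compat; lra).
  apply Rle_div_l; auto.
  assert (Ebb : b * b = y * y - a * a) by lra. rewrite Ebb.
  assert (Hay : a <= y) by (unfold a; rewrite <- (Rmult_1_r y) at 2; apply Rmult_le_compat_l; lra).
  assert (HyD : y <= D) by lra.
  assert (S1 : 4 * D <= D * D) by (apply Rmult_le_compat_r; lra).
  assert (S2 : a <= s * D) by (unfold a; rewrite Rmult_comm; apply Rmult_le_compat_l; lra).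
  assert (S3 : a * a <= s * D * D) by (apply Rmult_le_compat; lra).
  assert (S4 : a * D <= s * D * D) by (apply Rmult_le_compat_r; lra).
  assert (S5 : s * (4 * D) <= s * (D * D)) by (apply Rmult_le_compat_l; lra).
  assert (0 <= s * (D * D)) by (apply Rmult_le_pos; lra).
  lra.
Qed.

Lemma phi_real x : 0 <= x -> / 2 * / (1 + x) <= Re (phi (x, 0)).
Proof.
  intros H. rewrite Re_phi by auto.
  replace ((1 + x) * (1 + x) + 0 * 0) with ((1 + x) * (1 + x)) by ring.
  replace ((1 + x) / ((1 + x) * (1 + x))) with (/ (1 + x)) by (field; lra).
  assert (0 <= ((1 + x) * (1 + x) - 0 * 0) / ((1 + x) * (1 + x) * ((1 + x) * (1 + x)))); [|lra].
  replace (_ / _) with (/ ((1 + x) * (1 + x))) by (field; lra).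
  left. apply Rinv_0_lt_compat, Rmult_lt_0_compat; lra.
Qed.

Lemma phi_deriv z : 0 <= Re z -> exists l, cderiv phi z l.
Proof.
  intros H. assert (N := one_plus_ne z H). 
  assert (D : cderiv (fun v => 1 + v)%C z (0 + 1)%C) by (apply cderiv_plus; [apply cderiv_const|apply cderiv_id]).
  assert (D2 := cderiv_Cinv (fun v => 1 + v)%C z _ N D).
  eexists. unfold phi. apply cderiv_plus; [apply cderiv_mult|apply cderiv_scal]; exact D2.
Qed.

Fixpoint rsum (u : nat -> R) (n : nat) : R := match n with O => 0 | S m => rsum u m + u m end.
Fixpoint rprod (u : nat -> R) (n : nat) : R := match n with O => 1 | S m => rprod u m * u m end.
Fixpoint csum (u : nat -> C) (n : nat) : C := match n with O => RtoC 0 | S m => (csum u m + u m)%C end.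

Lemma rsum_le u v n : (forall i, (i < n)%nat -> u i <= v i) -> rsum u n <= rsum v n.
Proof. induction n as [|n IH]; intros H; simpl; [lra|]. apply Rplus_le_compat; [apply IH; intros|]; apply H; lia. Qed.

Lemma rsum_scal c u n : rsum (fun i => c * u i) n = c * rsum u n.
Proof. induction n as [|n IH]; simpl; [|rewrite IH]; ring. Qed.

Lemma rprod_le u v n : (forall i, (i < n)%nat -> 0 <= u i <= v i) -> 0 <= rprod u n <= rprod v n.
Proof.
  induction n as [|n IH]; intros H; simpl; [lra|]. 
  destruct IH as [I1 I2]; [intros; apply H; lia|]. destruct (H n) as [J1 J2]; [lia|].
  split; [now apply Rmult_le_pos|]. now apply Rmult_le_compat.
Qed.

Lemma rprod_pos u n : (forall i, 0 < u i) -> 0 < rprod u n.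
Proof. intros H. induction n; simpl; [lra|]. now apply Rmult_lt_0_compat. Qed.

Lemma rprod_const c n : rprod (fun _ => c) n = c ^ n.
Proof. induction n as [|n IH]; simpl; [|rewrite IH]; ring. Qed.

Lemma rprod_mult u v n : rprod (fun i => u i * v i) n = rprod u n * rprod v n.
Proof. induction n as [|n IH]; simpl; [|rewrite IH]; ring. Qed.

Lemma rprod_exp u n : rprod (fun i => exp (u i)) n = exp (rsum u n).
Proof. induction n as [|n IH]; simpl; [now rewrite exp_0|]. now rewrite IH, exp_plus. Qed.

Lemma Cmod_cexp_csum u n : Cmod (cexp (csum u n)) = rprod (fun i => exp (Re (u i))) n.
Proof.
  induction n as [|n IH]; simpl; [rewrite cexp_0; apply Cmod_1|].
  rewrite cexp_plus, Cmod_mult, IH, Cmod_cexp. reflexivity.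
Qed.

Lemma csum_deriv (u : nat -> C -> C) w n : (forall i, exists l, cderiv (u i) w l) ->
  exists l, cderiv (fun v => csum (fun i => u i v) n) w l.
Proof.
  intros H. induction n as [|n [l IH]].
  - exists (RtoC 0). exact (cderiv_const (RtoC 0) w).
  - destruct (H n) as [m Hm]. exists (l + m)%C. exact (cderiv_plus _ _ _ _ _ IH Hm).
Qed.

(** As x is increasing, the indices below the threshold form an initial segment, and r is its
    length. There x_i v_i is bounded; beyond it v_i alone is. *)
Lemma threshold_product (x v : nat -> R) e T n : 1 <= e -> (forall i, 0 < x i) -> (forall i, 0 < v i) ->
  (forall i j, (i <= j)%nat -> x i <= x j) ->
  (forall i, x i < T -> x i * v i <= e) -> (forall i, T <= x i -> v i <= e) ->
  exists r, (r <= n)%nat /\ rprod x r * rprod v n <= e ^ n.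
Proof.
  intros He Hx Hv Hm Hlt Hge. induction n as [|n [r [Hr IH]]].
  - exists 0%nat. simpl. split; [lia|lra].
  - destruct (Rlt_le_dec (x n) T) as [L|L].
    + exists (S n). split; [lia|]. rewrite <- rprod_mult, <- rprod_const. apply rprod_le.
      intros i Hi. split; [left; apply Rmult_lt_0_compat; auto|]. apply Hlt. eapply Rle_lt_trans; [apply (Hm i n); lia|auto].
    + exists r. split; [lia|]. simpl. rewrite (Rmult_comm e), <- Rmult_assoc.
      apply Rmult_le_compat; auto.
      * left. apply Rmult_lt_0_compat; apply rprod_pos; auto.
      * left; auto.
Qed.

Lemma exp_pow_INR x n : exp x ^ n = exp (INR n * x).
Proof.
  induction n as [|n IH]; [simpl; rewrite Rmult_0_l, exp_0; auto|].
  rewrite S_INR. simpl pow. rewrite IH, <- exp_plus. f_equal. ring.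
Qed.

Lemma Rpower_pos x y : 0 < Rpower x y.
Proof. apply exp_pos. Qed.

Lemma Rpower_1_l y : Rpower 1 y = 1.
Proof. unfold Rpower. rewrite ln_1, Rmult_0_r. apply exp_0. Qed.

Lemma Rpower_exp x y : Rpower (exp x) y = exp (y * x).
Proof. unfold Rpower. now rewrite ln_exp. Qed.

Lemma scaled_cexp c b u v :
  (RtoC c * cexp (RtoC b * (u, v)))%C = (c * exp (b * u) * cos (b * v), c * exp (b * u) * sin (b * v)).
Proof.
  unfold cexp. simpl. replace (b * u - 0 * v) with (b * u) by ring. replace (b * v + 0 * u) with (b * v) by ring.
  unfold Cmult, RtoC; simpl. f_equal; ring.
Qed.

Lemma Rmult_ge_1 x y : 1 <= x -> 1 <= y -> 1 <= x * y.
Proof. intros H1 H2. rewrite <- (Rmult_1_r 1). apply Rmult_le_compat; lra. Qed.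

(** * The comparison at x0 and the resulting bound for sums of quotients *)

Section Main.
Variables (M : nat -> R) (alpha : R) (n : nat).
Hypotheses (Halpha : 0 < alpha) (HM : forall p, 0 < M p)
  (Hlc : forall p, M (S p) ^ 2 <= M p * M (S (S p))) (Hn : (1 <= n)%nat).
Notation m := (quot M).
Notation A := (INR n).

Lemma quot_pos p : 0 < m p.
Proof. apply Rdiv_lt_0_compat; auto. Qed.

Lemma quot_incr p q : (p <= q)%nat -> m p <= m q.
Proof.
  intros H. induction H as [|q H IH]; [lra|]. eapply Rle_trans; [apply IH|].
  unfold quot. apply (Rle_div_l _ _ _ (HM q)). specialize (Hlc q). simpl in Hlc.
  replace (M (S (S q)) / M (S q) * M q) with (M q * M (S (S q)) / M (S q)) by (field; apply Rgt_not_eq, HM).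
  apply (Rle_div_r _ _ _ (HM (S q))). lra.
Qed.

Lemma M_prod p r : M (p + r) = M p * rprod (fun i => m (p + i)) r.
Proof.
  induction r as [|r IH]; [rewrite Nat.add_0_r; simpl; ring|].
  simpl. rewrite <- Rmult_assoc, <- IH, Nat.add_succ_r. unfold quot. field. apply Rgt_not_eq, HM.
Qed.

Lemma A_ge_1 : 1 <= A.
Proof. apply (le_INR 1). exact Hn. Qed.

Lemma partial_sum_unit (a : nat -> C) p q z : (forall j, (j < q)%nat -> a j = unit_coef M p j) ->
  partial_sum a q z = if Nat.ltb p q then (RtoC (M p) * z ^ p)%C else RtoC 0.
Proof.
  induction q as [|q IH]; intros H; [reflexivity|].
  cbn [partial_sum]. rewrite IH by (intros; apply H; lia). rewrite H by lia. unfold unit_coef.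
  destruct (Nat.eqb_spec q p) as [->|N].
  - rewrite Nat.ltb_irrefl. replace (Nat.ltb p (S p)) with true by (symmetry; apply Nat.ltb_lt; lia). ring.
  - destruct (Nat.ltb_spec p q), (Nat.ltb_spec p (S q)); try lia; ring.
Qed.

(** The remainder of order p + r, divided by M_p z^p, with M_(p+r)/M_p written as a product of
    quotients. For r >= 1 the partial sum is the monomial itself. For r = 0 it is still empty, so
    the term -1 is estimated separately; this explains the factor 2. *)
Lemma remainder_bound f a p N w r : in_ball M alpha n f a ->
  (forall j, (j < p + N)%nat -> a j = unit_coef M p j) -> sector alpha (lexp w) -> (r <= N)%nat ->
  Cmod (f (lexp w) / (RtoC (M p) * cexp w ^ p) - 1)
    <= 2 * A ^ S p * rprod (fun i => A * m (p + i) * exp (Re w)) r.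
Proof.
  intros [_ Hf] Ha Hw Hr. assert (HA := A_ge_1).
  assert (Pz : cexp w <> RtoC 0) by apply cexp_neq_0.
  assert (PM := HM p).
  assert (PMC : RtoC (M p) <> RtoC 0) by (intros E; apply RtoC_inj in E; lra).
  assert (Pd : (RtoC (M p) * cexp w ^ p)%C <> RtoC 0) by (apply Cmult_neq_0; auto; now apply Cpow_nz).
  assert (Ed : Cmod (RtoC (M p) * cexp w ^ p) = M p * exp (Re w) ^ p).
  { rewrite Cmod_mult, Cmod_R, Cmod_pow, Cmod_cexp, Rabs_pos_eq; lra. }
  assert (Pe : 0 < exp (Re w)) by apply exp_pos.
  assert (Pep : 0 < exp (Re w) ^ p) by now apply pow_lt.
  assert (PAp : 1 <= A ^ S p) by (apply pow_R1_Rle; auto).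
  assert (PD : 0 < M p * exp (Re w) ^ p) by now apply Rmult_lt_0_compat.
  destruct r as [|r].
  - assert (B := Hf (lexp w) p Hw). rewrite (partial_sum_unit a p p), Nat.ltb_irrefl in B by (intros; apply Ha; lia).
    replace (f (lexp w) - 0)%C with (f (lexp w)) in B by ring. change (modulus (lexp w)) with (exp (Re w)) in B.
    simpl rprod. eapply Rle_trans; [apply Cmod_minus_triangle|]. rewrite Cmod_1, Cmod_div, Ed by auto.
    assert (Cmod (f (lexp w)) / (M p * exp (Re w) ^ p) <= A ^ S p). { apply Rle_div_l; auto. simpl. lra. }
    lra.
  - assert (B := Hf (lexp w) (p + S r)%nat Hw). rewrite (partial_sum_unit a p) in B by (intros; apply Ha; lia).
    replace (Nat.ltb p (p + S r)) with true in B by (symmetry; apply Nat.ltb_lt; lia).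
    rewrite proj_lexp in B. change (modulus (lexp w)) with (exp (Re w)) in B.
    replace (f (lexp w) / (RtoC (M p) * cexp w ^ p) - 1)%C
      with ((f (lexp w) - RtoC (M p) * cexp w ^ p) / (RtoC (M p) * cexp w ^ p))%C by (field; split; [now apply Cpow_nz|auto]).
    rewrite Cmod_div, Ed by auto.
    rewrite 2!rprod_mult, !rprod_const. rewrite M_prod, !pow_add in B.
    apply Rle_div_l; auto. eapply Rle_trans; [apply B|].
    assert (X : 0 <= A ^ S p * (A ^ S r * rprod (fun i => m (p + i)) (S r) * exp (Re w) ^ S r) * (M p * exp (Re w) ^ p)).
    { assert (0 < A ^ S r) by (apply pow_lt; lra). assert (0 < exp (Re w) ^ S r) by now apply pow_lt.
      assert (0 < rprod (fun i => m (p + i)) (S r)) by (apply rprod_pos; intros; apply quot_pos).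
      left. apply Rmult_lt_0_compat; auto. apply Rmult_lt_0_compat; [lra|]. apply Rmult_lt_0_compat; auto. now apply Rmult_lt_0_compat. }
    revert X. generalize (rprod (fun i => m (p + i)) (S r)). intros.
    simpl pow in *. lra.
Qed.

Hypothesis Hball : forall p N, exists f a, in_ball M alpha n f a /\
  forall j, (j < N)%nat -> a j = unit_coef M p j.

(** On the right, 4 is the 2 of [remainder_bound] times the 2 from |g| >= 1/2 at x0; the next factor
    bounds exp(theta^2) PI/theta for alpha PI/4 <= theta < alpha PI/2; exp 1 is the loss from moving
    the contour inside the sector. *)
Lemma core_estimate k N : (1 <= k)%nat ->
  exp (rsum (fun i => / 2 * / (1 + 2 * Rpower (exp (3 / 2) * A * m (2 * k + i) * (2 * A * A / m k)) (/ alpha))) N)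
   <= 4 * (exp ((alpha * PI / 2) * (alpha * PI / 2)) * (4 / alpha)) * A ^ S (2 * k) * exp 1.
Proof.
  intros Hk. assert (HA := A_ge_1). set (p := (2 * k)%nat).
  assert (Pi := PI_RGT_0). assert (Pia : 0 < / alpha) by now apply Rinv_0_lt_compat.
  destruct (Hball p (p + N)) as [f [a [Hb Ha]]].
  set (x0 := 2 * A * A / m k). assert (Pmk := quot_pos k).
  assert (Px0 : 0 < x0). { apply Rdiv_lt_0_compat; auto. repeat apply Rmult_lt_0_compat; lra. }
  set (u0 := ln x0).
  (* The angle between contour and boundary. Each of the N factors may exceed 1 by exp(10 sin eta)
     there, so eta of size 1/(10(N+1)) keeps the total loss below e. *)
  set (eta := Rmin (PI / 4) (/ (10 * (INR N + 1)))).
  assert (PN := pos_INR N).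
  assert (Peta : 0 < eta) by (apply Rmin_pos; [lra|apply Rinv_0_lt_compat; lra]).
  assert (E1 : eta <= PI / 4) by apply Rmin_l. assert (E2 : eta <= / (10 * (INR N + 1))) by apply Rmin_r.
  set (theta := alpha * (PI / 2 - eta)).
  assert (Th1 : alpha * (PI / 4) <= theta) by (apply Rmult_le_compat_l; lra).
  assert (Th2 : theta < alpha * PI / 2).
  { unfold theta. replace (alpha * PI / 2) with (alpha * (PI / 2)) by field. apply Rmult_lt_compat_l; lra. }
  assert (Pth0 : 0 < alpha * (PI / 4)) by (apply Rmult_lt_0_compat; lra).
  assert (Pth : 0 < theta) by lra.
  assert (Eth : / alpha * theta = PI / 2 - eta) by (unfold theta; field; lra).
  set (s := cos (/ alpha * theta)).
  assert (Hs : 0 <= s <= 1). { split; [left; apply cos_gt_0; rewrite Eth; lra|apply COS_bound]. }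
  assert (Hs2 : s <= eta). { unfold s. rewrite Eth, cos_shift. left. apply sin_lt_x. auto. }
  assert (HsN : INR N * (10 * s) <= 1).
  { apply Rle_trans with (INR N * (10 * / (10 * (INR N + 1)))); [apply Rmult_le_compat_l; lra|].
    replace (INR N * (10 * / (10 * (INR N + 1)))) with (INR N / (INR N + 1)) by (field; lra). apply Rle_div_l; lra. }
  (* Chosen so that c_i |zeta| >= 2, the range of [phi_bound_far], as soon as x_i >= exp(-3/2);
     below that threshold the bound exp(3/2) on the exponential still gives x_i times it at most
     1. *)
  set (c := fun i => 2 * Rpower (exp (3 / 2) * A * m (p + i)) (/ alpha)).
  assert (Pc : forall i, 0 < c i). { intros; apply Rmult_lt_0_compat; [lra|apply Rpower_pos]. }
  set (zeta := fun i w => (RtoC (c i) * cexp (RtoC (/ alpha) * w))%C).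
  set (x := fun u i => A * m (p + i) * exp u).
  assert (Px : forall u i, 0 < x u i).
  { intros u i. unfold x. apply Rmult_lt_0_compat; [|apply exp_pos]. apply Rmult_lt_0_compat; [lra|apply quot_pos]. }
  assert (Ey : forall u i, c i * exp (/ alpha * u) = 2 * Rpower (exp (3 / 2) * x u i) (/ alpha)).
  { intros u i. unfold c, x. rewrite <- Rpower_exp, Rmult_assoc, Rpower_mult_distr; [f_equal; f_equal; ring| |apply exp_pos].
    apply Rmult_lt_0_compat; [|apply quot_pos]. apply Rmult_lt_0_compat; [apply exp_pos|lra]. }
  assert (Hcos : forall v, - theta <= v <= theta -> 0 < cos (/ alpha * v)).
  { intros v Hv. assert (/ alpha * v <= / alpha * theta) by (apply Rmult_le_compat_l; lra).
    assert (/ alpha * (- theta) <= / alpha * v) by (apply Rmult_le_compat_l; lra). apply cos_gt_0; lra. }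
  assert (Hzeta : forall i w, - theta <= Im w <= theta -> 0 <= Re (zeta i w)).
  { intros i [u v] Hw. unfold zeta. rewrite scaled_cexp. simpl in Hw |- *. left.
    apply Rmult_lt_0_compat; [apply Rmult_lt_0_compat; [auto|apply exp_pos]|auto]. }
  assert (Hsec : forall w, - theta <= Im w <= theta -> sector alpha (lexp w)).
  { intros w Hw. apply sector_lexp. apply Rle_lt_trans with theta; auto. now apply Rabs_le. }
  set (H := fun w => (f (lexp w) / (RtoC (M p) * cexp w ^ p) - 1)%C).
  set (E := fun w => cexp (csum (fun i => phi (zeta i w)) N)).
  set (K0 := 2 * A ^ S p). 
  assert (PK0 : 0 < K0) by (apply Rmult_lt_0_compat; [lra|apply pow_lt; lra]).
  assert (PMC : RtoC (M p) <> RtoC 0) by (intros Z; apply RtoC_inj in Z; generalize (HM p); lra).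
  (* The second bound, exponential in N, is crude; it enters only through the vertical sides and is
     absent from the conclusion. *)
  assert (S1 := strip_estimate (fun w => H w * E w)%C u0 theta (K0 * exp 1) (K0 * exp (3 / 2) ^ N) Pth).
  lapply S1; [clear S1; intros S1|left; apply Rmult_lt_0_compat; [auto|apply exp_pos]].
  lapply S1; [clear S1; intros S1|left; apply Rmult_lt_0_compat; [auto|apply pow_lt, exp_pos]].
  lapply S1; [clear S1; intros S1|].
  2:{ intros w Hw. destruct Hb as [Hhol _].
      assert (D1 : exists l, cderiv H w l).
      { destruct (holomorphic_cderiv alpha f w Hhol (Hsec w Hw)) as [l Hl].
        eexists. apply cderiv_minus; [|apply cderiv_const].
        apply cderiv_div; [apply Cmult_neq_0; auto; apply Cpow_nz, cexp_neq_0|apply Hl|].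
        apply cderiv_scal. unfold p. replace (2 * k)%nat with (S (2 * k - 1)) by lia. apply cderiv_pow, cderiv_cexp. }
      destruct D1 as [l1 D1].
      destruct (csum_deriv (fun i w => phi (zeta i w)) w N) as [l2 D2].
      { intros i. destruct (phi_deriv (zeta i w) (Hzeta i w Hw)) as [l Hl]. eexists.
        apply (cderiv_comp phi (zeta i)); [apply Hl|]. apply cderiv_scal, cderiv_Cexp, cderiv_scal, cderiv_id. }
      eexists. apply cderiv_mult; [apply D1|]. apply cderiv_Cexp, D2. }
  lapply S1; [clear S1; intros S1|].
  2:{ intros w Hw. rewrite Cmod_mult. apply Rmult_le_compat; try apply Cmod_ge_0.
      - rewrite <- (Rmult_1_r K0). apply (remainder_bound f a p N w 0 Hb Ha (Hsec w Hw)). lia.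
      - unfold E. rewrite Cmod_cexp_csum, <- rprod_const. apply rprod_le. intros i _.
        split; [left; apply exp_pos|]. apply exp_monotone, phi_bound, Hzeta, Hw. }
  lapply S1; [clear S1; intros S1|].
  2:{ intros [u v] Hv. simpl in Hv.
      assert (Hw : - theta <= Im (u, v) <= theta) by (simpl; destruct Hv as [-> | ->]; lra).
      assert (Hcv : cos (/ alpha * v) = s).
      { destruct Hv as [-> | ->]; auto. rewrite Ropp_mult_distr_r_reverse, cos_neg. reflexivity. }
      destruct (threshold_product (x u) (fun i => exp (Re (phi (zeta i (u, v))))) (exp (10 * s)) (exp (- (3 / 2))) N) as [r [Hr Hprod]].
      - rewrite <- exp_0. apply exp_monotone. lra.
      - auto.
      - intros; apply exp_pos.
      - intros i j Hij. unfold x. apply Rmult_le_compat_r; [left; apply exp_pos|]. apply Rmult_le_compat_l; [lra|]. apply quot_incr. lia.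
      - intros i Hi. apply Rle_trans with (exp (- (3 / 2)) * exp (3 / 2)).
        + apply Rmult_le_compat; [left; apply Px|left; apply exp_pos|lra|apply exp_monotone, phi_bound, Hzeta, Hw].
        + rewrite <- exp_plus. apply exp_monotone. lra.
      - intros i Hi. apply exp_monotone. unfold zeta. rewrite scaled_cexp, Hcv.
        apply phi_bound_far; auto.
        + rewrite Ey. rewrite <- (Rmult_1_r 2) at 1. apply Rmult_le_compat_l; [lra|].
          rewrite <- (Rpower_1_l (/ alpha)). apply Rle_Rpower_l; [lra|]. split; [lra|].
          apply Rle_trans with (exp (3 / 2) * exp (- (3 / 2))).
          * rewrite <- exp_plus, <- exp_0. apply exp_monotone. lra.
          * apply Rmult_le_compat_l; auto. left; apply exp_pos.
        + rewrite <- Hcv. set (y := c i * exp (/ alpha * u)).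
          replace (y * cos (/ alpha * v) * (y * cos (/ alpha * v)) + y * sin (/ alpha * v) * (y * sin (/ alpha * v)))
            with (y * y * (Rsqr (sin (/ alpha * v)) + Rsqr (cos (/ alpha * v)))) by (unfold Rsqr; ring).
          rewrite sin2_cos2. ring.
      - rewrite Cmod_mult. unfold E. rewrite Cmod_cexp_csum.
        eapply Rle_trans; [apply Rmult_le_compat_r; [|apply (remainder_bound f a p N (u, v) r Hb Ha (Hsec _ Hw) Hr)]|].
        + left. apply rprod_pos. intros; apply exp_pos.
        + fold K0. simpl Re. change (fun i => A * m (p + i) * exp u) with (x u). rewrite Rmult_assoc.
          apply Rmult_le_compat_l; [lra|]. eapply Rle_trans; [apply Hprod|].
          rewrite exp_pow_INR. apply exp_monotone. auto. }
  rewrite Cmod_mult in S1.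
  assert (Hw0 : - theta <= Im (u0, 0) <= theta) by (simpl; lra).
  (* At order k < p the partial sum is empty, so |f| <= A^(k+1) M_k x0^k. Since M_(2k) >= M_k m_k^k
     and m_k x0 = 2A^2, dividing by M_p x0^p leaves at most A^(k+1)/(2A^2)^k <= 1/2. *)
  assert (LH : / 2 <= Cmod (H (u0, 0))).
  { assert (Ex : exp u0 = x0) by (unfold u0; now rewrite exp_ln).
    destruct Hb as [_ Hb]. assert (B := Hb (lexp (u0, 0)) k (Hsec _ Hw0)).
    rewrite (partial_sum_unit a p k) in B by (intros; apply Ha; lia).
    replace (Nat.ltb p k) with false in B by (symmetry; apply Nat.ltb_ge; lia).
    replace (f (lexp (u0, 0)) - 0)%C with (f (lexp (u0, 0))) in B by ring.
    change (modulus (lexp (u0, 0))) with (exp u0) in B. rewrite Ex in B.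
    assert (T := Cmod_triangle_rev 1 (- (f (lexp (u0, 0)) / (RtoC (M p) * cexp (u0, 0) ^ p)))).
    rewrite Cmod_opp, Cmod_1 in T.
    replace (1 + - (f (lexp (u0, 0)) / (RtoC (M p) * cexp (u0, 0) ^ p)))%C with (- H (u0, 0))%C in T by (unfold H; ring).
    rewrite Cmod_opp in T.
    assert (Q : Cmod (f (lexp (u0, 0)) / (RtoC (M p) * cexp (u0, 0) ^ p)) <= / 2); [|lra].
    rewrite Cmod_div by (apply Cmult_neq_0; auto; apply Cpow_nz, cexp_neq_0).
    rewrite Cmod_mult, Cmod_R, Cmod_pow, Cmod_cexp. change (Re (u0, 0)) with u0. rewrite Ex, Rabs_pos_eq by (left; apply HM).
    assert (Pxk : 0 < x0 ^ k) by now apply pow_lt. assert (Pxp : 0 < x0 ^ p) by now apply pow_lt.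
    apply Rle_div_l; [apply Rmult_lt_0_compat; auto|].
    eapply Rle_trans; [apply B|].
    assert (Ep : p = (k + k)%nat) by (unfold p; lia). rewrite Ep, M_prod, pow_add.
    assert (Pr : m k ^ k <= rprod (fun i => m (k + i)) k).
    { rewrite <- rprod_const. apply rprod_le. intros i _. split; [lra|]. apply quot_incr. lia. }
    assert (Emx : m k ^ k * x0 ^ k = (2 * A * A) ^ k).
    { rewrite <- Rpow_mult_distr. f_equal. unfold x0. field. lra. }
    assert (Z : A * A ^ k <= / 2 * (2 * A * A) ^ k).
    { rewrite !Rpow_mult_distr. destruct k as [|k']; [lia|].
      assert (A <= A ^ S k'). { rewrite <- (pow_1 A) at 1. apply Rle_pow; [auto|lia]. }
      assert (1 <= 2 ^ k') by (apply pow_R1_Rle; lra).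
      assert (X1 : A * A ^ S k' <= A ^ S k' * A ^ S k') by (apply Rmult_le_compat_r; lra).
      assert (X2 : 1 * (A ^ S k' * A ^ S k') <= 2 ^ k' * (A ^ S k' * A ^ S k')).
      { apply Rmult_le_compat_r; auto. apply Rmult_le_pos; lra. }
      change (2 ^ S k') with (2 * 2 ^ k'). lra. }
    assert (PMk := HM k).
    apply Rle_trans with (/ 2 * (2 * A * A) ^ k * (M k * x0 ^ k)).
    - rewrite Rmult_assoc. apply Rmult_le_compat_r; auto. left; now apply Rmult_lt_0_compat.
    - rewrite <- Emx. 
      replace (/ 2 * (m k ^ k * x0 ^ k) * (M k * x0 ^ k)) with (m k ^ k * (/ 2 * (M k * (x0 ^ k * x0 ^ k)))) by ring.
      replace (/ 2 * (M k * rprod (fun i => m (k + i)) k * (x0 ^ k * x0 ^ k)))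
        with (rprod (fun i => m (k + i)) k * (/ 2 * (M k * (x0 ^ k * x0 ^ k)))) by ring.
      apply Rmult_le_compat_r; auto. repeat apply Rmult_le_pos; lra. }
  assert (LE : exp (rsum (fun i => / 2 * / (1 + 2 * Rpower (exp (3 / 2) * A * m (p + i) * x0) (/ alpha))) N) <= Cmod (E (u0, 0))).
  { unfold E. rewrite Cmod_cexp_csum, rprod_exp. apply exp_monotone, rsum_le. intros i _.
    unfold zeta. rewrite scaled_cexp, Rmult_0_r, cos_0, sin_0, Rmult_1_r, Rmult_0_r.
    rewrite Ey. unfold x. replace (exp u0) with x0 by (unfold u0; now rewrite exp_ln).
    replace (exp (3 / 2) * (A * m (p + i) * x0)) with (exp (3 / 2) * A * m (p + i) * x0) by ring.
    apply phi_real. assert (T := Rpower_pos (exp (3 / 2) * A * m (p + i) * x0) (/ alpha)). lra. }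
  set (X := exp (rsum _ N)) in *. assert (PX : 0 < X) by apply exp_pos.
  assert (L : / 2 * X <= Cmod (H (u0, 0)) * Cmod (E (u0, 0))) by (apply Rmult_le_compat; lra).
  assert (U : exp (theta * theta) * PI / theta <= exp (alpha * PI / 2 * (alpha * PI / 2)) * (4 / alpha)).
  { unfold Rdiv at 1. rewrite Rmult_assoc. apply Rmult_le_compat.
    - left; apply exp_pos.
    - left; apply Rdiv_lt_0_compat; lra.
    - apply exp_monotone, Rmult_le_compat; lra.
    - replace (4 / alpha) with (PI * / (alpha * (PI / 4))) by (field; lra).
      apply Rmult_le_compat_l; [lra|]. apply Rinv_le_contravar; auto. }
  assert (Pe1 := exp_pos 1).
  apply (Rmult_le_compat_r (K0 * exp 1)) in U; [|apply Rmult_le_pos; lra].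
  set (V := exp (alpha * PI / 2 * (alpha * PI / 2)) * (4 / alpha)) in *.
  apply Rle_trans with (2 * (V * (K0 * exp 1))); [lra|]. right. unfold K0. ring.
Qed.

(** The logarithm of [core_estimate]. With rho_i the summand here, each term there is 1/(2(1 +
    c/rho_i)), at least rho_i/(4c) because c/rho_i >= 1. *)
Lemma sum_estimate : exists C0, 0 < C0 /\ forall k N, (1 <= k)%nat ->
  rsum (fun i => Rpower (m k / m (2 * k + i)) (/ alpha)) N <= C0 * INR k.
Proof.
  assert (HA := A_ge_1). assert (Pia : 0 < / alpha) by now apply Rinv_0_lt_compat.
  set (V := 4 * (exp ((alpha * PI / 2) * (alpha * PI / 2)) * (4 / alpha)) * exp 1).
  (* Collects all constants: V A^(2k+1) <= Lam^(3k), because 2k+1 <= 3k for k >= 1. *)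
  set (Lam := Rmax 1 V * A).
  assert (HV : 1 <= Rmax 1 V) by apply Rmax_l.
  assert (HL : 1 <= Lam) by now apply Rmult_ge_1.
  set (b := exp (3 / 2) * A * (2 * A * A)).
  assert (Pe : 1 <= exp (3 / 2)) by (rewrite <- exp_0; apply exp_monotone; lra).
  assert (Hb : 1 <= b).
  { unfold b. apply Rmult_ge_1; [now apply Rmult_ge_1|]. rewrite Rmult_assoc. assert (1 <= A * A) by now apply Rmult_ge_1. lra. }
  set (c := 2 * Rpower b (/ alpha)).
  assert (Hc : 2 <= c).
  { unfold c. assert (1 <= Rpower b (/ alpha)); [|lra]. rewrite <- (Rpower_1_l (/ alpha)). apply Rle_Rpower_l; lra. }
  exists (12 * c * ln Lam + 1). assert (HlnL : 0 <= ln Lam).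
  { rewrite <- ln_1. apply ln_le; lra. }
  split. { assert (0 <= c * ln Lam) by (apply Rmult_le_pos; lra). lra. }
  intros k N Hk. assert (T := core_estimate k N Hk).
  set (rho := fun i => Rpower (m k / m (2 * k + i)) (/ alpha)).
  assert (Pmk := quot_pos k).
  assert (Hrho : forall i, 0 < rho i <= 1).
  { intros i. split; [apply Rpower_pos|]. unfold rho. rewrite <- (Rpower_1_l (/ alpha)). apply Rle_Rpower_l; [lra|].
    assert (P := quot_pos (2 * k + i)). split; [now apply Rdiv_lt_0_compat|].
    apply Rle_div_l; auto. rewrite Rmult_1_l. apply quot_incr. lia. }
  assert (T2 : exp (/ (4 * c) * rsum rho N) <= Lam ^ (3 * k)).
  { eapply Rle_trans; [apply exp_monotone|eapply Rle_trans; [apply T|]].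
    - rewrite <- rsum_scal. apply rsum_le. intros i _. destruct (Hrho i) as [R1 R2].
      assert (P := quot_pos (2 * k + i)).
      replace (exp (3 / 2) * A * m (2 * k + i) * (2 * A * A / m k)) with (b * / (m k / m (2 * k + i))) by (unfold b; field; lra).
      rewrite <- Rpower_mult_distr; [|lra|apply Rinv_0_lt_compat; now apply Rdiv_lt_0_compat].
      replace (Rpower (/ (m k / m (2 * k + i))) (/ alpha)) with (/ rho i).
      2:{ unfold rho. rewrite <- Rpower_Ropp. unfold Rpower. f_equal. rewrite ln_Rinv by (now apply Rdiv_lt_0_compat). ring. }
      rewrite <- Rmult_assoc. fold c.
      assert (I1 : 1 <= / rho i) by (rewrite <- Rinv_1; apply Rinv_le_contravar; lra).
      replace (/ (4 * c) * rho i) with (/ 2 * / (2 * (c * / rho i))) by (field; lra).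
      apply Rmult_le_compat_l; [lra|]. apply Rinv_le_contravar.
      + assert (0 < c * / rho i) by (apply Rmult_lt_0_compat; lra). lra.
      + assert (1 * 1 <= c * / rho i) by (apply Rmult_le_compat; lra). lra.
    - replace (4 * (exp (alpha * PI / 2 * (alpha * PI / 2)) * (4 / alpha)) * A ^ S (2 * k) * exp 1)
        with (V * A ^ S (2 * k)) by (unfold V; ring).
      unfold Lam. rewrite Rpow_mult_distr. apply Rmult_le_compat.
      + unfold V. assert (0 < exp (alpha * PI / 2 * (alpha * PI / 2))) by apply exp_pos.
        assert (0 < 4 / alpha) by (apply Rdiv_lt_0_compat; lra). assert (0 < exp 1) by apply exp_pos.
        repeat apply Rmult_le_pos; lra.
      + apply pow_le; lra.
      + eapply Rle_trans; [apply (Rmax_r 1)|]. rewrite <- (pow_1 (Rmax 1 V)) at 1. apply Rle_pow; [auto|lia].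
      + apply Rle_pow; [auto|lia]. }
  assert (T3 : / (4 * c) * rsum rho N <= INR (3 * k) * ln Lam).
  { rewrite <- ln_pow by lra. rewrite <- (ln_exp (/ (4 * c) * rsum rho N)). apply ln_le; auto. apply exp_pos. }
  assert (Pk := pos_INR k). rewrite mult_INR in T3. replace (INR 3) with 3 in T3 by (simpl; ring).
  apply (Rmult_le_compat_l (4 * c)) in T3; [|lra].
  replace (4 * c * (/ (4 * c) * rsum rho N)) with (rsum rho N) in T3 by (field; lra).
  lra.
Qed.
End Main.

(** * Growth of the quotients *)

Lemma rsum_app u a b : rsum u (a + b) = rsum u a + rsum (fun i => u (a + i)%nat) b.
Proof.
  induction b as [|b IH]; [rewrite Nat.add_0_r; simpl; ring|]. rewrite Nat.add_succ_r. simpl. rewrite IH. ring.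
Qed.

Lemma rsum_const c n : rsum (fun _ => c) n = INR n * c.
Proof. induction n as [|n IH]; [simpl; ring|]. rewrite S_INR. simpl. rewrite IH. ring. Qed.

Lemma rsum_ext u v n : (forall i, u i = v i) -> rsum u n = rsum v n.
Proof. intros H. induction n; simpl; congruence. Qed.

Lemma rsum_head u n : rsum u (S n) = u 0%nat + rsum (fun i => u (S i)) n.
Proof. induction n as [|n IH]; [simpl; ring|]. simpl in *. rewrite IH. ring. Qed.

(** If S_i is the tail sum from i, then S_i <= K b_i gives S_(i+1) = S_i - b_i <= (1 - 1/K) S_i.
    Finite truncations stand in for the tails; each step shortens the truncation by one term. *)
Lemma tail_sums_decay (b : nat -> R) (K : R) : 1 < K ->
  (forall i J, rsum (fun l => b (i + l)%nat) J <= K * b i) ->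
  forall J, b J <= (1 - / K) ^ J * (K * b 0%nat).
Proof.
  intros HK H.
  assert (Hr : 0 < 1 - / K). { assert (/ K < / 1) by (apply Rinv_lt_contravar; lra). rewrite Rinv_1 in H0. lra. }
  set (S_ := fun i J => rsum (fun l => b (i + l)%nat) J).
  assert (Step : forall i J, S_ (S i) J <= (1 - / K) * S_ i (S J)).
  { intros i J. assert (E : S_ i (S J) = b i + S_ (S i) J).
    { unfold S_. rewrite rsum_head, Nat.add_0_r. f_equal. apply rsum_ext. intros l. f_equal. lia. }
    assert (T := H i (S J)). fold (S_ i (S J)) in T.
    assert (/ K * S_ i (S J) <= b i).
    { apply (Rmult_le_reg_l K); [lra|]. rewrite <- Rmult_assoc, Rinv_r by lra. lra. }
    lra. }
  assert (G : forall J i, S_ (i + J)%nat 1%nat <= (1 - / K) ^ J * S_ i (S J)).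
  { induction J as [|J IH]; intros i; [rewrite Nat.add_0_r; simpl pow; lra|].
    rewrite Nat.add_succ_r, <- Nat.add_succ_l. eapply Rle_trans; [apply IH|].
    simpl pow. rewrite (Rmult_comm (1 - / K)), Rmult_assoc. apply Rmult_le_compat_l; [apply pow_le; lra|]. apply Step. }
  intros J. assert (T := G J 0%nat). assert (E : S_ (0 + J)%nat 1%nat = b J).
  { unfold S_. simpl. rewrite Nat.add_0_r. ring. }
  rewrite E in T. eapply Rle_trans; [apply T|]. apply Rmult_le_compat_l; [apply pow_le; lra|]. apply H.
Qed.

Lemma dyadic_bracket p q n : (1 <= p <= q)%nat -> (q < 2 ^ n * p)%nat ->
  exists J, (2 ^ J * p <= q < 2 ^ S J * p)%nat.
Proof.
  intros Hpq. induction n as [|n IH]; intros H; [simpl in H; lia|].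
  destruct (Nat.lt_ge_cases q (2 ^ n * p)) as [L|L]; auto. exists n. lia.
Qed.

Section Growth.
Variables (mu : nat -> R) (C0 : R).
Hypotheses (Hmu : forall i, 0 < mu i) (Hmon : forall i j, (i <= j)%nat -> mu i <= mu j) (HC0 : 0 < C0).
Hypothesis Hsum : forall k N, (1 <= k)%nat -> rsum (fun i => mu k / mu (2 * k + i)) N <= C0 * INR k.

(** Cauchy condensation: by monotonicity the term at 2^(l+1) k is at most twice the sum of 1/mu over
    the block from 2^l k to 2^(l+1) k. As [Hsum] starts at 2k, the terms l = 0 and l = 1 are set
    apart and contribute 1 + 2 = 3. *)
Lemma dyadic_blocks k J : (1 <= k)%nat ->
  rsum (fun l => 2 ^ l * (INR k / mu (2 ^ l * k))) (J + 2) <= (2 * C0 + 3) * (INR k / mu k).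
Proof.
  intros Hk. assert (Pk : 1 <= INR k) by (apply (le_INR 1); auto).
  assert (B : rsum (fun l => 2 ^ l * (INR k / mu (2 ^ l * k))) (J + 2) - INR k / mu (2 ^ 0 * k) - 2 * (INR k / mu (2 ^ 1 * k))
     <= 2 * rsum (fun i => / mu (2 * k + i)%nat) (2 ^ S J * k - 2 * k)).
  { induction J as [|J IH].
    - replace (2 ^ 1 * k - 2 * k)%nat with 0%nat by (simpl; lia). simpl. lra.
    - change (S J + 2)%nat with (S (J + 2)). cbn [rsum].
      replace (2 ^ S (S J) * k - 2 * k)%nat with ((2 ^ S J * k - 2 * k) + 2 ^ S J * k)%nat.
      2:{ simpl. assert (1 <= 2 ^ J)%nat by (apply Nat.neq_0_lt_0, Nat.pow_nonzero; lia). nia. }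
      rewrite (rsum_app (fun i => / mu (2 * k + i)%nat)).
      assert (T : INR (2 ^ S J * k) * / mu (2 ^ (J + 2) * k)%nat <= rsum (fun i => / mu (2 * k + (2 ^ S J * k - 2 * k + i))%nat) (2 ^ S J * k)).
      { rewrite <- rsum_const. apply rsum_le. intros i Hi. apply Rinv_le_contravar; auto. apply Hmon.
        replace (J + 2)%nat with (S (S J)) by lia. simpl in *. assert (1 <= 2 ^ J)%nat by (apply Nat.neq_0_lt_0, Nat.pow_nonzero; lia). nia. }
      rewrite mult_INR, pow_INR in T. replace (INR 2) with 2 in T by (simpl; ring).
      replace (2 ^ (J + 2) * (INR k / mu (2 ^ (J + 2) * k)%nat)) with (2 * (2 ^ S J * INR k * / mu (2 ^ (J + 2) * k)%nat)).
      2:{ rewrite pow_add. simpl. field. apply Rgt_not_eq, Hmu. }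
      lra. }
  assert (T := Hsum k (2 ^ S J * k - 2 * k) Hk). unfold Rdiv in T. rewrite rsum_scal in T.
  assert (Pm := Hmu k).
  assert (T2 : rsum (fun i => / mu (2 * k + i)%nat) (2 ^ S J * k - 2 * k) <= C0 * (INR k / mu k)).
  { apply (Rmult_le_reg_l (mu k)); auto. replace (mu k * (C0 * (INR k / mu k))) with (C0 * INR k) by (field; lra). exact T. }
  replace (2 ^ 0 * k)%nat with k in B by (simpl; lia).
  assert (T3 : INR k / mu (2 ^ 1 * k)%nat <= INR k / mu k).
  { apply Rmult_le_compat_l; [lra|]. apply Rinv_le_contravar; auto. apply Hmon. simpl; lia. }
  lra.
Qed.

(** The condensed terms 2^l p / mu(2^l p) decay geometrically with ratio r < 1, so mu gains a factor
    2/r, more than 2, at each doubling. This excess makes the exponent exceed 1 strictly. *)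
Lemma power_growth : exists delta a, 1 < delta /\ 1 <= a /\ forall p q, (1 <= p <= q)%nat ->
  Rpower (INR q / INR p) delta * mu p <= a * mu q.
Proof.
  set (K := 2 * C0 + 3). assert (HK : 3 < K) by (unfold K; lra).
  assert (HKi : 0 < / K < / 3) by (split; [apply Rinv_0_lt_compat; lra|apply Rinv_lt_contravar; lra]).
  set (r := 1 - / K). assert (Hr : 0 < r < 1) by (unfold r; lra).
  (* Defined by 2^delta = 2/r, so that (2^J)^delta = (2/r)^J. *)
  set (delta := ln (2 / r) / ln 2).
  assert (Pl2 : 0 < ln 2) by (rewrite <- ln_1; apply ln_increasing; lra).
  assert (Hdel : 1 < delta).
  { apply Rlt_div_r; auto. rewrite Rmult_1_l. apply ln_increasing; [lra|]. apply Rlt_div_r; lra. }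
  exists delta, (Rpower 2 delta * K). split; [auto|split].
  { apply Rmult_ge_1; [|lra]. rewrite <- (Rpower_1_l delta). apply Rle_Rpower_l; lra. }
  assert (D : forall p J, (1 <= p)%nat -> Rpower (2 ^ J) delta * mu p <= K * mu (2 ^ J * p)%nat).
  { intros p J Hp. 
    assert (T := tail_sums_decay (fun l => 2 ^ l * (INR p / mu (2 ^ l * p)%nat)) K ltac:(lra)).
    lapply T; [clear T; intros T|].
    - specialize (T J). cbv beta in T. replace (2 ^ 0 * p)%nat with p in T by (simpl; lia). fold r in T. simpl (2 ^ 0)%R in T.
      assert (E : Rpower (2 ^ J) delta = 2 ^ J / r ^ J).
      { transitivity ((2 / r) ^ J).
        - rewrite <- (Rpower_pow J (2 / r)) by (apply Rdiv_lt_0_compat; lra). unfold Rpower. rewrite ln_pow by lra.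
          f_equal. unfold delta. field. lra.
        - unfold Rdiv. now rewrite Rpow_mult_distr, pow_inv. }
      rewrite E. assert (PJ : 0 < 2 ^ J) by (apply pow_lt; lra). assert (Pr : 0 < r ^ J) by (apply pow_lt; lra).
      assert (P1 := Hmu p). assert (P2 := Hmu (2 ^ J * p)%nat). assert (Pp : 0 < INR p) by (apply lt_0_INR; lia).
      assert (T2 := Rmult_le_compat_r (mu p * mu (2 ^ J * p)%nat / (INR p * r ^ J)) _ _ ltac:(left; apply Rdiv_lt_0_compat; now apply Rmult_lt_0_compat) T).
      replace (2 ^ J * (INR p / mu (2 ^ J * p)%nat) * (mu p * mu (2 ^ J * p)%nat / (INR p * r ^ J))) with (2 ^ J / r ^ J * mu p) in T2 by (field; lra).
      replace (r ^ J * (K * (1 * (INR p / mu p))) * (mu p * mu (2 ^ J * p)%nat / (INR p * r ^ J))) with (K * mu (2 ^ J * p)%nat) in T2 by (field; lra).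
      exact T2.
    - intros i N. assert (Hi : (1 <= 2 ^ i * p)%nat). { assert (1 <= 2 ^ i)%nat by (apply Nat.neq_0_lt_0, Nat.pow_nonzero; lia). nia. }
      assert (Bk := dyadic_blocks (2 ^ i * p) N Hi). fold K in Bk.
      rewrite mult_INR, pow_INR in Bk. replace (INR 2) with 2 in Bk by (simpl; ring).
      rewrite rsum_app in Bk.
      assert (E : rsum (fun l => 2 ^ l * (2 ^ i * INR p / mu (2 ^ l * (2 ^ i * p))%nat)) N = rsum (fun l => 2 ^ (i + l) * (INR p / mu (2 ^ (i + l) * p)%nat)) N).
      { apply rsum_ext. intros l. rewrite pow_add, Nat.pow_add_r. replace (2 ^ l * (2 ^ i * p))%nat with (2 ^ i * 2 ^ l * p)%nat by ring.
        field. apply Rgt_not_eq, Hmu. }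
      rewrite E in Bk.
      assert (0 <= rsum (fun i0 => 2 ^ (N + i0) * (2 ^ i * INR p / mu (2 ^ (N + i0) * (2 ^ i * p))%nat)) 2).
      { rewrite <- (Rmult_0_r (INR 2)), <- rsum_const. apply rsum_le. intros l _.
        apply Rmult_le_pos; [apply pow_le; lra|]. apply Rdiv_le_0_compat; auto. apply Rmult_le_pos; [apply pow_le; lra|apply pos_INR]. }
      replace (K * (2 ^ i * (INR p / mu (2 ^ i * p)%nat))) with (K * (2 ^ i * INR p / mu (2 ^ i * p)%nat)) by (field; apply Rgt_not_eq, Hmu).
      lra. }
  intros p q Hpq.
  destruct (dyadic_bracket p q q) as [J [J1 J2]]; auto.
  { assert (q < 2 ^ q)%nat by (apply Nat.pow_gt_lin_r; lia). nia. }
  assert (Pp : 0 < INR p) by (apply lt_0_INR; lia). assert (Pq : 0 < INR q) by (apply lt_0_INR; lia).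
  assert (PJ : 0 < 2 ^ J) by (apply pow_lt; lra).
  apply Rle_trans with (Rpower 2 delta * (Rpower (2 ^ J) delta * mu p)).
  - rewrite <- Rmult_assoc, Rpower_mult_distr by lra. apply Rmult_le_compat_r; [left; auto|].
    apply Rle_Rpower_l; [lra|]. split; [now apply Rdiv_lt_0_compat|]. apply Rle_div_l; auto.
    apply lt_INR in J2. rewrite mult_INR, pow_INR in J2. replace (INR 2) with 2 in J2 by (simpl; ring). simpl pow in J2. lra.
  - rewrite Rmult_assoc. apply Rmult_le_compat_l; [left; apply Rpower_pos|].
    eapply Rle_trans; [apply D; lia|]. apply Rmult_le_compat_l; [lra|]. now apply Hmon.
Qed.
End Growth.

(** * From growth of the quotients to the index *)

Fixpoint running_max (u : nat -> R) (p : nat) : R :=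
  match p with O => u O | S q => Rmax (running_max u q) (u (S q)) end.

Lemma running_max_ge u p : u p <= running_max u p.
Proof. destruct p; simpl; [lra|apply Rmax_r]. Qed.

Lemma running_max_le u p X : (forall q, (q <= p)%nat -> u q <= X) -> running_max u p <= X.
Proof.
  induction p as [|p IH]; intros H; simpl; [apply H; lia|]. apply Rmax_lub; [apply IH; intros|]; apply H; lia.
Qed.

(** The sequence m'_p = (p+1)^g max over q <= p of m_q (q+1)^(-g) becomes increasing after division
    by (p+1)^g by construction, and the growth hypothesis bounds that maximum by a times its last
    term. *)
Lemma P_gamma_of_growth M g a : 1 <= a -> (forall p, 0 < quot M p) ->
  (forall p q, (p <= q)%nat -> Rpower (INR (S q) / INR (S p)) g * quot M p <= a * quot M q) -> P_gamma M g.
Proof.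
  intros Ha HM H. set (u := fun p => quot M p * Rpower (INR (S p)) (- g)).
  exists (fun p => Rpower (INR (S p)) g * running_max u p), a. split; [auto|split].
  - intros p _. assert (Pm := HM p).
    assert (E : Rpower (INR (S p)) g * Rpower (INR (S p)) (- g) = 1).
    { rewrite <- Rpower_plus, Rplus_opp_r, Rpower_O; auto. apply lt_0_INR; lia. }
    assert (PR := Rpower_pos (INR (S p)) g). split.
    + apply Rle_trans with (Rpower (INR (S p)) g * u p).
      * unfold u. replace (Rpower (INR (S p)) g * (quot M p * Rpower (INR (S p)) (- g))) with (1 * quot M p) by (rewrite <- E; ring).
        apply Rmult_le_compat_r; [lra|]. rewrite <- Rinv_1. apply Rinv_le_contravar; lra.
      * apply Rmult_le_compat_l; [lra|]. apply running_max_ge.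
    + rewrite Rmult_comm. apply Rle_div_r; auto. apply running_max_le. intros q Hq.
      apply (Rle_div_r _ _ _ PR). unfold u. rewrite Rmult_assoc, (Rmult_comm (Rpower _ (- g))), Rpower_Ropp.
      eapply Rle_trans; [|apply (H q p Hq)]. right. rewrite Rmult_comm. f_equal.
      assert (Pq : 0 < INR (S q)) by (apply lt_0_INR; lia). assert (Pp : 0 < INR (S p)) by (apply lt_0_INR; lia).
      unfold Rdiv. rewrite <- Rpower_mult_distr; [|auto|now apply Rinv_0_lt_compat]. f_equal.
      rewrite <- Rpower_Ropp. unfold Rpower. rewrite ln_Rinv by auto. f_equal. ring.
  - intros p. assert (E : forall q, Rpower (INR (S q)) (- g) * (Rpower (INR (S q)) g * running_max u q) = running_max u q).
    { intros q. rewrite <- Rmult_assoc, <- Rpower_plus, Rplus_opp_l, Rpower_O; [ring|]. apply lt_0_INR; lia. }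
    rewrite !E. simpl. apply Rmax_l.
Qed.

(** The growth exponent delta > 1 of m^(1/alpha) becomes delta alpha > alpha for m; belonging to the
    set at this larger value gives strictness for the supremum. *)
Lemma surjective_gamma_index M alpha : weight_sequence M -> 0 < alpha -> Borel_surjective Atu M alpha ->
  Rbar_lt alpha (gamma_index M).
Proof.
  intros [HM [_ [Hlc _]]] Ha Hs.
  destruct (uniform_monomials M alpha Ha HM Hs) as [n0 Hn0].
  (* The radius is raised by one so that the constant A is at least 1. *)
  assert (Hball : forall p N, exists f a, in_ball M alpha (S n0) f a /\ forall j, (j < N)%nat -> a j = unit_coef M p j).
  { intros p N. destruct (Hn0 p N) as [f [a [H1 H2]]]. exists f, a. split; auto.
    apply (in_ball_mono M alpha HM n0); auto. }
  destruct (sum_estimate M alpha (S n0) Ha HM Hlc ltac:(lia) Hball) as [C0 [HC0 Hsum]].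
  assert (Pm := quot_pos M HM). assert (Im := quot_incr M HM Hlc).
  assert (Pia : 0 < / alpha) by now apply Rinv_0_lt_compat.
  set (mu := fun i => Rpower (quot M i) (/ alpha)).
  assert (Emu : forall i, Rpower (mu i) alpha = quot M i).
  { intros i. unfold mu. rewrite Rpower_mult, Rinv_l, Rpower_1; auto. lra. }
  destruct (power_growth mu C0) as [delta [a [Hd [Ha1 Hg]]]]; auto.
  { intros; apply Rpower_pos. }
  { intros i j Hij. apply Rle_Rpower_l; [lra|]. split; auto. }
  { intros k N Hk. eapply Rle_trans; [|apply (Hsum k N Hk)]. right. apply rsum_ext. intros i. unfold mu, Rdiv.
    rewrite <- Rpower_mult_distr; [|auto|now apply Rinv_0_lt_compat]. f_equal.
    rewrite <- Rpower_Ropp. unfold Rpower. rewrite ln_Rinv by auto. f_equal. ring. }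
  set (g := delta * alpha). assert (Hga : alpha < g).
  { unfold g. rewrite <- (Rmult_1_l alpha) at 1. apply Rmult_lt_compat_r; auto. }
  set (b := Rpower a alpha). assert (Hb : 1 <= b). { unfold b. rewrite <- (Rpower_1_l alpha). apply Rle_Rpower_l; lra. }
  set (c := Rpower 2 g). assert (Hc : 1 <= c). { unfold c. rewrite <- (Rpower_1_l g). apply Rle_Rpower_l; lra. }
  (* Replacing q/p by (q+1)/(p+1) is free, the latter being smaller for p <= q. *)
  assert (Gr : forall p q, (1 <= p <= q)%nat -> Rpower (INR (S q) / INR (S p)) g * quot M p <= b * quot M q).
  { intros p q Hpq. specialize (Hg p q Hpq).
    assert (Pp : 0 < INR p) by (apply lt_0_INR; lia). assert (Pq : 0 < INR q) by (apply lt_0_INR; lia).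
    assert (T : Rpower (Rpower (INR q / INR p) delta * mu p) alpha <= Rpower (a * mu q) alpha).
    { apply Rle_Rpower_l; [lra|]. split; auto. apply Rmult_lt_0_compat; apply Rpower_pos. }
    rewrite <- !Rpower_mult_distr, !Emu, Rpower_mult in T; try apply Rpower_pos; [|lra]. fold g b in T.
    eapply Rle_trans; [|apply T]. apply Rmult_le_compat_r; [left; auto|]. apply Rle_Rpower_l; [lra|].
    rewrite !S_INR. split; [apply Rdiv_lt_0_compat; lra|].
    assert (INR p <= INR q) by (apply le_INR; lia).
    assert (1 <= INR q / INR p) by (apply (Rle_div_r _ _ _ Pp); lra).
    apply Rle_div_l; [lra|]. replace (INR q / INR p * (INR p + 1)) with (INR q + INR q / INR p) by (field; lra). lra. }
  assert (PG : P_gamma M g).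
  { apply (P_gamma_of_growth M g (c * b)); auto; [now apply Rmult_ge_1|].
    intros p q Hpq. assert (Pq := Pm q).
    (* The growth estimate starts at index 1. For p = 0 the inequality m_0 <= m_1 is used, and
       comparing q+1 with (q+1)/2 costs the factor c = 2^g. *)
    destruct (Nat.eq_dec p 0) as [->|Np].
    - destruct (Nat.eq_dec q 0) as [->|Nq].
      + replace (INR 1 / INR 1) with 1 by (simpl; field). rewrite Rpower_1_l.
        apply Rmult_le_compat_r; [lra|]. now apply Rmult_ge_1.
      + specialize (Gr 1%nat q ltac:(lia)). assert (Pq1 : 0 < INR (S q)) by (apply lt_0_INR; lia).
        replace (INR (S q) / INR 1) with (2 * (INR (S q) / INR 2)) by (simpl; field).
        rewrite <- Rpower_mult_distr; [|lra|apply Rdiv_lt_0_compat; [auto|simpl; lra]]. fold c. rewrite !Rmult_assoc.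
        apply Rmult_le_compat_l; [lra|]. eapply Rle_trans; [|apply Gr]. apply Rmult_le_compat_l; [left; apply Rpower_pos|].
        apply Im. lia.
    - eapply Rle_trans; [apply Gr; lia|]. apply Rmult_le_compat_r; [lra|]. rewrite <- (Rmult_1_l b) at 1. apply Rmult_le_compat_r; lra. }
  apply (Rbar_lt_le_trans _ (Finite g)); [exact Hga|].
  apply (proj1 (Lub_Rbar_correct (P_gamma M)) g PG).
Qed.

Lemma Borel_surjective_A_class M gamma : (forall p, 0 < M p) ->
  Borel_surjective Atu M (gamma + 1) -> Borel_surjective A_class M gamma.
Proof.
  intros HM Hs a Ha. destruct (Hs a Ha) as [f [Hf Hfa]]. exists f. split; [now apply Atu_A_class|].
  intros T [HT1 HT2]. apply Hfa. split; auto. intros z Hz. destruct (HT2 z Hz) as [Z1 Z2]. split; auto.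
  generalize PI_RGT_0; lra.
Qed.

Theorem theorem4p14 :
  forall M : nat -> R, weight_sequence M -> dc M ->
  (forall alpha : R, 0 < alpha -> Borel_surjective Atu M alpha ->
     Rbar_lt (Finite (IZR (Int_part alpha))) (gamma_index M)) /\
  ((forall gamma : R, Stu_int M gamma <-> 0 < gamma) ->
     (forall gamma : R, S_int M gamma <-> 0 < gamma) /\
     (forall gamma : R, Stu_int M gamma <-> 0 < gamma) /\
     (forall gamma : R, St_int M gamma <-> 0 < gamma) /\
     gamma_index M = p_infty).
Proof.
  intros M HM _. split.
  - intros alpha Ha Hs. apply (Rbar_le_lt_trans _ (Finite alpha)); [apply base_Int_part|].
    now apply surjective_gamma_index.
  - intros H. assert (Hs : forall gamma, 0 < gamma -> Borel_surjective Atu M gamma) by (intros g Hg; apply H, Hg).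
    split; [|split; [exact H|split]].
    + intros gamma. split; [now intros [G _]|]. intros G. split; auto.
      apply Borel_surjective_A_class; [apply HM|]. apply Hs. lra.
    + intros gamma. split; [now intros [G _]|]. intros G. split; auto.
      intros a Ha. destruct (Hs gamma G a Ha) as [f [[Hf _] Hfa]]. exists f. split; auto. split; auto. now exists a.
    + assert (I := fun g Hg => surjective_gamma_index M g HM Hg (Hs g Hg)).
      destruct (gamma_index M) as [r| |]; auto; exfalso.
      * assert (T := I (Rmax r 1) ltac:(generalize (Rmax_r r 1); lra)). simpl in T. generalize (Rmax_l r 1); lra.
      * exact (I 1 Rlt_0_1).
Qed.
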